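(* Let $\mathcal{I}$ be a small category and let $\mathrm{Sd}(\mathcal{I})^{\mathrm{op}}$ be the opposite category of its barycentric subdivision. Then the $L^2$-Euler characteristic $\chi^{(2)}(\mathrm{Sd}(\mathcal{I})^{\mathrm{op}})$ exists (that is, $\mathrm{Sd}(\mathcal{I})^{\mathrm{op}}$ is of type $(L^2)$) if and only if $\mathcal{I}$ is a finite acyclic category, in which case $$\chi^{(2)}(\mathrm{Sd}(\mathcal{I})^{\mathrm{op}})=\chi^{(2)}(\mathcal{I}).$$
   Context: A small category is acyclic if all its endomorphisms are identities and, whenever there is a morphism $X\to Y$ with $X\neq Y$, there is no morphism $Y\to X$. A finite category has finitely many objects and morphisms. Nerve. For a natural number $n\ge 0$, $[n]=\{0,1,\dots,n\}$ is the poset with the usual order. For a small category $\mathcal{J}$, $N_n(\mathcal{J})$ is the set of chains $x_0\xrightarrow{f_1}x_1\to\cdots\xrightarrow{f_n}x_n$ in $\mathcal{J}$, i.e. functors $[n]\to\mathcal{J}$. The set of non-degenerate chains $\overline{N_n}(\mathcal{J})$ consists of those chains in which no $f_i$ is an identity, with $\overline{N_0}(\mathcal{J})=N_0(\mathcal{J})=\mathrm{Ob}(\mathcal{J})$. Barycentric subdivision. $\mathrm{Sd}(\mathcal{J})$ is the small category whose set of objects is $\coprod_{n\ge0}\overline{N_n}(\mathcal{J})$. An object $X$ of length $q_X$ is regarded as a functor $X:[q_X]\to\mathcal{J}$. The set of morphisms from $X$ to $Y$ is the quotient of the set of order-preserving maps $f:[q_X]\to[q_Y]$ with $Y\circ f=X$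 by the equivalence relation generated by: $f\sim g$ if for every $0\le i\le q_X$ the morphism $Y(\min\{f(i),g(i)\}\to\max\{f(i),g(i)\})$ is an identity. Composition is induced by composition of order-preserving maps. $L^2$-Euler characteristic. $\mathbb{C}\text{-vect}$ is the category of all complex vector spaces and $\mathrm{Func}(\mathcal{J}^{\mathrm{op}},\mathbb{C}\text{-vect})$ is the abelian category of functors; $\underline{\mathbb{C}}$ is the constant functor with value $\mathbb{C}$. For an object $x$ of $\mathcal{J}$, the splitting functor $S_x:\mathrm{Func}(\mathcal{J}^{\mathrm{op}},\mathbb{C}\text{-vect})\to\mathrm{Func}(\mathrm{Aut}(x)^{\mathrm{op}},\mathbb{C}\text{-vect})$ sends $F$ to the cokernel $$S_xF=\mathrm{Coker}\Big(\bigoplus_{u}F(u^{\mathrm{op}}):\bigoplus_{u}F(y)\longrightarrow F(x)\Big),$$ where $u:x\to y$ runs over all non-invertible morphisms of $\mathcal{J}$ with source $x$, with the induced right action of $\mathrm{Aut}(x)$; on natural transformations it is induced by the universal property of cokernels. Write $\mathbb{C}[x]=\mathbb{C}[\mathrm{Aut}(x)]$ for the group ring and $\mathcal{N}(x)=\mathcal{N}(\mathrm{Aut}(x))$ for the group von Neumann algebra of the discrete group $\mathrm{Aut}(x)$ (it is $\mathbb{C}[\mathrm{Aut}(x)]$ if $\mathrm{Aut}(x)$ is finite). Let $\dim_{\mathcal{N}(G)}$ be the (Lück extended) von Neumann dimension, defined on all algebraic $\mathcal{N}(G)$-modules with values in $[0,\infty]$; for a finite group $G$ it equals $\frac{1}{\#G}\dim_{\mathbb{C}}$.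 For a chain complex $C_*$ of $\mathcal{N}(G)$-modules set $b^{(2)}_p(C_* )=\dim_{\mathcal{N}(G)}(H_p(C_* ))$, $h^{(2)}(C_* )=\sum_{p\ge0}b^{(2)}_p(C_* )$, and, if $h^{(2)}(C_* )<\infty$, $\chi^{(2)}(C_* )=\sum_{p\ge0}(-1)^pb^{(2)}_p(C_* )$. A small category $\mathcal{J}$ is of type $(L^2)$ if for some projective resolution $P_*$ of $\underline{\mathbb{C}}$ in $\mathrm{Func}(\mathcal{J}^{\mathrm{op}},\mathbb{C}\text{-vect})$, $$\sum_{[x]\in\mathrm{iso}(\mathcal{J})}h^{(2)}(S_xP_*\otimes_{\mathbb{C}[x]}\mathcal{N}(x))<\infty,$$ where $\mathrm{iso}(\mathcal{J})$ is the set of isomorphism classes of objects. In that case its $L^2$-Euler characteristic is $$\chi^{(2)}(\mathcal{J})=\sum_{[x]\in\mathrm{iso}(\mathcal{J})}\chi^{(2)}(S_xP_*\otimes_{\mathbb{C}[x]}\mathcal{N}(x))\in\mathbb{R}.$$ *)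

(* Defs.v *)
From HB Require Import structures.
From mathcomp Require Import all_boot all_order all_algebra.
From mathcomp Require Import ring_quotient.
From mathcomp Require Import boolp classical_sets functions cardinality fsbigop.
From mathcomp Require Import reals ereal topology sequences esum numfun.
From Stdlib Require Import Relation_Operators.
From mathcomp Require Import complex finmap ring.

Set Implicit Arguments.
Unset Strict Implicit.
Unset Printing Implicit Defensive.

Import Order.TTheory GRing.Theory Num.Theory.
Import ComplexField.

Local Open Scope classical_set_scope.
Local Open Scope ring_scope.
Local Open Scope quotient_scope.
Local Open Scope complex_scope.

Record category := Category {
  ob :> Type;
  mor : ob -> ob -> Type;
  idm : forall x, mor x x;
  mcomp : forall x y z, mor y z -> mor x y -> mor x z;
  mcomp_idl : forall x y (f : mor x y), mcomp (idm y) f = f;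
  mcomp_idr : forall x y (f : mor x y), mcomp f (idm x) = f;
  compA : forall x y z w (h : mor z w) (g : mor y z) (f : mor x y),
    mcomp h (mcomp g f) = mcomp (mcomp h g) f }.

Arguments mor {_} _ _.
Arguments idm {_} _.
Arguments mcomp {_ _ _ _} _ _.

Definition opcat (C : category) : category :=
  @Category C (fun x y => mor y x) (fun x => idm x) (fun x y z g f => mcomp f g)
    (fun x y f => mcomp_idr f) (fun x y f => mcomp_idl f)
    (fun x y z w h g f => esym (compA f g h)).

Inductive is_identity (C : category) : forall x y : C, mor x y -> Prop :=
  IsIdentity x : is_identity (idm x).

Definition inverse (C : category) (x y : C) (u : mor x y) (v : mor y x) : Prop :=
  mcomp v u = idm x /\ mcomp u v = idm y.

Definition is_iso (C : category) (x y : C) (u : mor x y) : Prop :=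
  exists v, inverse u v.

Definition finite_category (C : category) : Prop :=
  finite_set [set: C] /\ finite_set [set: {x : C & {y : C & mor x y}}].

Definition acyclic (C : category) : Prop :=
  (forall (x : C) (f : mor x x), f = idm x) /\
  (forall x y : C, x <> y -> inhabited (mor x y) -> ~ inhabited (mor y x)).

Record functor (C D : category) := Functor {
  fob :> C -> D;
  fmor : forall x y, mor x y -> mor (fob x) (fob y);
  fmor_id : forall x, fmor (idm x) = idm (fob x);
  fmor_comp : forall x y z (g : mor y z) (f : mor x y),
    fmor (mcomp g f) = mcomp (fmor g) (fmor f) }.

Arguments fmor {_ _} _ {_ _} _.

Definition functor_id (C : category) : functor C C :=
  @Functor C C id (fun _ _ f => f) (fun _ => erefl) (fun _ _ _ _ _ => erefl).

Section FunctorComp.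
Variables (C D E : category) (G : functor D E) (F : functor C D).

Lemma functor_comp_id_subproof x : fmor G (fmor F (idm x)) = idm (G (F x)).
Proof. by rewrite !fmor_id. Qed.

Lemma functor_comp_comp_subproof x y z (g : mor y z) (f : mor x y) :
  fmor G (fmor F (mcomp g f)) = mcomp (fmor G (fmor F g)) (fmor G (fmor F f)).
Proof. by rewrite !fmor_comp. Qed.

Definition functor_comp : functor C E :=
  @Functor C E (fun x => G (F x)) (fun _ _ f => fmor G (fmor F f))
    functor_comp_id_subproof functor_comp_comp_subproof.
End FunctorComp.

Lemma functor_compA (C D E E' : category) (H : functor E E') (G : functor D E)
    (F : functor C D) :
  functor_comp H (functor_comp G F) = functor_comp (functor_comp H G) F.
Proof.
by rewrite /functor_comp; congr Functor; apply: Prop_irrelevance.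
Qed.

Lemma functor_compr1 (C D : category) (F : functor C D) :
  functor_comp F (functor_id C) = F.
Proof.
by case: F => o m i c; rewrite /functor_comp; congr Functor; apply: Prop_irrelevance.
Qed.

Lemma functor_compl1 (C D : category) (F : functor C D) :
  functor_comp (functor_id D) F = F.
Proof.
by case: F => o m i c; rewrite /functor_comp; congr Functor; apply: Prop_irrelevance.
Qed.

(* The poset [n] = {0, ..., n} as a category. *)
Definition ordcat (n : nat) : category :=
  @Category 'I_n.+1 (fun i j => (i <= j)%N) (fun i => leqnn i)
    (fun i j k jk ij => leq_trans ij jk)
    (fun _ _ _ => bool_irrelevance _ _) (fun _ _ _ => bool_irrelevance _ _)
    (fun _ _ _ _ _ _ _ => bool_irrelevance _ _).

Definition nondegenerate (C : category) (n : nat) (X : functor (ordcat n) C) : Prop :=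
  forall (i j : ordcat n) (ij : mor i j), val j = (val i).+1 -> ~ is_identity (fmor X ij).

Section Subdivision.
Variable C : category.

Record sd_ob := SdOb {
  sd_len : nat;
  sd_chain :> functor (ordcat sd_len) C;
  sd_nondeg : nondegenerate sd_chain }.

(* Order-preserving maps [p] -> [q] are the functors between these posets.  The
   equation X = Y o f is Leibniz equality of functors, which is the usual equality
   of functors by functional extensionality and proof irrelevance. *)
Record sd_map (X Y : sd_ob) := SdMap {
  sd_fun :> functor (ordcat (sd_len X)) (ordcat (sd_len Y));
  sd_funE : functor_comp Y sd_fun = X }.

HB.instance Definition _ X Y := gen_eqMixin (sd_map X Y).
HB.instance Definition _ X Y := gen_choiceMixin (sd_map X Y).

Definition sd_map_id (X : sd_ob) : sd_map X X := SdMap (functor_compr1 X).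

Lemma sd_map_comp_subproof (X Y Z : sd_ob) (g : sd_map Y Z) (f : sd_map X Y) :
  functor_comp Z (functor_comp g f) = X.
Proof. by rewrite functor_compA (sd_funE g) (sd_funE f). Qed.

Definition sd_map_comp (X Y Z : sd_ob) (g : sd_map Y Z) (f : sd_map X Y) :=
  SdMap (sd_map_comp_subproof g f).

Lemma min_hom_max (n : nat) (i j : 'I_n.+1) :
  @mor (ordcat n) (Order.min i j) (Order.max i j).
Proof. by rewrite /=; case: (leP i j) => // /ltW. Qed.

Definition sd_rel (X Y : sd_ob) (f g : sd_map X Y) : Prop :=
  forall i, is_identity (fmor Y (min_hom_max (f i) (g i))).

Definition sd_equiv (X Y : sd_ob) (f g : sd_map X Y) : bool :=
  `[< clos_refl_sym_trans _ (@sd_rel X Y) f g >].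

Lemma sd_equiv_refl X Y : reflexive (@sd_equiv X Y).
Proof. by move=> f; apply/asboolP; apply: rst_refl. Qed.
Lemma sd_equiv_sym X Y : symmetric (@sd_equiv X Y).
Proof. by move=> f g; apply/asboolP/asboolP => h; apply: rst_sym. Qed.
Lemma sd_equiv_trans X Y : transitive (@sd_equiv X Y).
Proof. by move=> g f h /asboolP fg /asboolP gh; apply/asboolP; apply: rst_trans fg gh. Qed.

Canonical sd_equiv_equiv X Y :=
  EquivRel (@sd_equiv X Y) (@sd_equiv_refl X Y) (@sd_equiv_sym X Y) (@sd_equiv_trans X Y).

Definition sd_hom (X Y : sd_ob) := {eq_quot @sd_equiv X Y}.

Definition sd_class X Y (f : sd_map X Y) : sd_hom X Y := \pi f.

Lemma sd_class_repr X Y (f : sd_hom X Y) : sd_class (repr f) = f.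
Proof. exact: reprK. Qed.

Lemma sd_mapP X Y (f g : sd_map X Y) : sd_fun f = sd_fun g -> f = g.
Proof.
case: f => f hf; case: g => g hg /= fg; subst g; congr SdMap; exact: Prop_irrelevance.
Qed.

Lemma sd_rel_compl X Y Z (h : sd_map Y Z) (f g : sd_map X Y) :
  sd_rel f g -> sd_rel (sd_map_comp h f) (sd_map_comp h g).
Proof.
move=> fg i.
have {fg} := fg i.
have -> : is_identity (fmor Y (min_hom_max (f i) (g i))) =
  is_identity (fmor (functor_comp Z h) (min_hom_max (f i) (g i))).
  by rewrite (sd_funE h).
rewrite /=.
have hle (a b : 'I_(sd_len Y).+1) : (a <= b)%N -> (h a <= h b)%O.
  by move=> ab; exact: (@fmor _ _ h a b ab).
have hmin a b : h (Order.min a b) = Order.min (h a) (h b).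
  by case: (leP a b) => [/hle ab|/ltW /hle ab]; rewrite ?(min_l ab) ?(min_r ab).
have hmax a b : h (Order.max a b) = Order.max (h a) (h b).
  by case: (leP a b) => [/hle ab|/ltW /hle ab]; rewrite ?(max_r ab) ?(max_l ab).
move: (fmor h _) (min_hom_max (h (f i)) _) => u v.
move: u v; rewrite /= -hmin -hmax => u v.
by rewrite (bool_irrelevance u v).
Qed.

Lemma sd_rel_compr X Y Z (f g : sd_map Y Z) (k : sd_map X Y) :
  sd_rel f g -> sd_rel (sd_map_comp f k) (sd_map_comp g k).
Proof. by move=> fg i; exact: fg. Qed.

Lemma sd_equiv_comp X Y Z (f f' : sd_map Y Z) (g g' : sd_map X Y) :
  sd_equiv f f' -> sd_equiv g g' -> sd_equiv (sd_map_comp f g) (sd_map_comp f' g').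
Proof.
move=> /asboolP ff' /asboolP gg'; apply/asboolP.
apply: (rst_trans _ _ _ (sd_map_comp f' g)).
  elim: ff' => [a b ab|a|a b _ ab|a b c _ ab _ bc].
  - by apply: rst_step; exact: sd_rel_compr.
  - exact: rst_refl.
  - exact: rst_sym.
  - exact: rst_trans ab bc.
elim: gg' => [a b ab|a|a b _ ab|a b c _ ab _ bc].
- by apply: rst_step; exact: sd_rel_compl.
- exact: rst_refl.
- exact: rst_sym.
- exact: rst_trans ab bc.
Qed.

Definition sd_idm (X : sd_ob) : sd_hom X X := sd_class (sd_map_id X).

Definition sd_comp (X Y Z : sd_ob) (g : sd_hom Y Z) (f : sd_hom X Y) : sd_hom X Z :=
  sd_class (sd_map_comp (repr g) (repr f)).

Lemma sd_compE X Y Z (g : sd_map Y Z) (f : sd_map X Y) :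
  sd_comp (sd_class g) (sd_class f) = sd_class (sd_map_comp g f).
Proof.
apply/eqP; rewrite /sd_class eqmodE; apply: sd_equiv_comp;
  by rewrite -eqmodE reprK.
Qed.

Lemma sd_comp_idl X Y (f : sd_hom X Y) : sd_comp (sd_idm Y) f = f.
Proof.
rewrite -[f]sd_class_repr sd_compE; congr sd_class; apply: sd_mapP.
exact: functor_compl1.
Qed.

Lemma sd_comp_idr X Y (f : sd_hom X Y) : sd_comp f (sd_idm X) = f.
Proof.
rewrite -[f]sd_class_repr sd_compE; congr sd_class; apply: sd_mapP.
exact: functor_compr1.
Qed.

Lemma sd_compA X Y Z W (h : sd_hom Z W) (g : sd_hom Y Z) (f : sd_hom X Y) :
  sd_comp h (sd_comp g f) = sd_comp (sd_comp h g) f.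
Proof.
rewrite -[f]sd_class_repr -[g]sd_class_repr -[h]sd_class_repr !sd_compE; congr sd_class.
by apply: sd_mapP; exact: functor_compA.
Qed.

Definition Sd : category := Category sd_comp_idl sd_comp_idr sd_compA.
End Subdivision.

Section LmodQuotient.
Variables (A : pzRingType) (V : lmodType A) (S : submodClosed V).

Definition submod_zmodClosed : zmodClosed V :=
  HB.pack (GRing.SubmodClosed.sort S) (GRing.isZmodClosed.Build V (GRing.SubmodClosed.sort S)
    (GRing.submod_closedB (submodClosedP S))).

Definition lmod_quot := Quotient.quot submod_zmodClosed.
HB.instance Definition _ := GRing.Zmodule.on lmod_quot.
HB.instance Definition _ := Quotient.on lmod_quot.

Definition lquot_class (v : V) : lmod_quot := \pi_(Quotient.quot submod_zmodClosed) v.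

Lemma lquot_eqE u v : (lquot_class u == lquot_class v) = (u - v \in S).
Proof. by rewrite -[LHS]Quotient.idealrBE. Qed.

Lemma lquot_reprK (x : lmod_quot) : lquot_class (repr x) = x.
Proof. exact: reprK. Qed.

Lemma lquot_classD : {morph lquot_class : u v / u + v}.
Proof. by move=> u v; rewrite /lquot_class; rewrite !piE. Qed.

Definition lquot_scale (a : A) (x : lmod_quot) : lmod_quot :=
  lquot_class (a *: repr x).

Lemma lquot_scaleE a v : lquot_scale a (lquot_class v) = lquot_class (a *: v).
Proof.
apply/eqP; rewrite lquot_eqE -scalerBr rpredZ // -lquot_eqE.
by rewrite lquot_reprK.
Qed.

Fact lquot_scaleA a b x : lquot_scale a (lquot_scale b x) = lquot_scale (a * b) x.
Proof. by rewrite -[x]lquot_reprK !lquot_scaleE scalerA. Qed.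
Fact lquot_scale1 : left_id 1 lquot_scale.
Proof. by move=> x; rewrite -[x]lquot_reprK lquot_scaleE scale1r. Qed.
Fact lquot_scaleDr : right_distributive lquot_scale +%R.
Proof.
move=> a x y; rewrite -[x]lquot_reprK -[y]lquot_reprK.
by rewrite -lquot_classD !lquot_scaleE -lquot_classD scalerDr.
Qed.
Fact lquot_scaleDl x : {morph lquot_scale^~ x : a b / a + b}.
Proof.
move=> a b; rewrite -[x]lquot_reprK !lquot_scaleE -lquot_classD.
by rewrite scalerDl.
Qed.
HB.instance Definition _ := GRing.Zmodule_isLmodule.Build A lmod_quot
  lquot_scaleA lquot_scale1 lquot_scaleDr lquot_scaleDl.

Fact lquot_class_linear : linear lquot_class.
Proof. by move=> a u v; rewrite lquot_classD -lquot_scaleE. Qed.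
HB.instance Definition _ := GRing.isLinear.Build A V lmod_quot *:%R lquot_class
  lquot_class_linear.

Lemma lquot_eq0 v : (lquot_class v == 0) = (v \in S).
Proof. by rewrite -[v in RHS]subr0 -lquot_eqE linear0. Qed.

Section Lift.
Variables (W : lmodType A) (f : {linear V -> W}).
Hypothesis fS : forall v, v \in S -> f v = 0.

Definition lquot_lift (x : lmod_quot) : W := let _ := fS in f (repr x).

Lemma lquot_liftE v : lquot_lift (lquot_class v) = f v.
Proof.
apply/eqP; rewrite -subr_eq0 -linearB fS //.
by rewrite -lquot_eqE lquot_reprK.
Qed.

Fact lquot_lift_linear : linear lquot_lift.
Proof.
move=> a x y; rewrite -[x]lquot_reprK -[y]lquot_reprK -linearP.
by rewrite !lquot_liftE linearP.
Qed.
HB.instance Definition _ := GRing.isLinear.Build A lmod_quot W *:%R lquot_lift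
  lquot_lift_linear.
End Lift.
End LmodQuotient.

Section LmodQuotientMap.
Variables (A : pzRingType) (V W : lmodType A).
Variables (S : submodClosed V) (T : submodClosed W) (f : {linear V -> W}).
Hypothesis fST : forall v, v \in S -> f v \in T.

Fact lquot_map_subproof v : v \in S -> (lquot_class T \o f) v = 0.
Proof. by move=> vS; apply/eqP; rewrite /= lquot_eq0 fST. Qed.

Definition lquot_map : lmod_quot S -> lmod_quot T := lquot_lift lquot_map_subproof.
HB.instance Definition _ := GRing.Linear.on lquot_map.

Lemma lquot_mapE v : lquot_map (lquot_class S v) = lquot_class T (f v).
Proof. by rewrite /lquot_map lquot_liftE. Qed.
End LmodQuotientMap.

Lemma lin_ker_closed (A : pzRingType) (V W : lmodType A) (f : {linear V -> W}) :
  submod_closed [pred v | f v == 0].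
Proof.
split=> [|a u v]; first by rewrite inE linear0.
by rewrite !inE => /eqP u0 /eqP v0; rewrite linearP u0 v0 scaler0 addr0.
Qed.

Lemma lin_preim_closed (A : pzRingType) (V W : lmodType A) (f : {linear V -> W})
    (T : submodClosed W) :
  submod_closed [pred v | f v \in T].
Proof.
split=> [|a u v]; first by rewrite inE linear0 rpred0.
by rewrite !inE => uT vT; rewrite linearP rpredD // rpredZ.
Qed.

Section Span.
Variables (A : pzRingType) (V : lmodType A) (D : set V).

Definition submod_span : {pred V} := [pred v |
  `[< forall S : {pred V}, submod_closed S -> (forall d, D d -> d \in S) -> v \in S >]].

Lemma submod_span_sub d : D d -> d \in submod_span.
Proof. by move=> Dd; apply/asboolP => S _; exact. Qed.

Lemma submod_span_min (S : {pred V}) : submod_closed S -> (forall d, D d -> d \in S) ->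
  {subset submod_span <= S}.
Proof. by move=> cS DS v /asboolP; exact. Qed.

Fact submod_span_closed : GRing.subsemimod_closed submod_span.
Proof.
apply: GRing.submod_closed_semi; split.
  by apply/asboolP => S [].
move=> a u v /asboolP uS /asboolP vS; apply/asboolP => S cS DS.
by case: (cS) => _; apply; [exact: uS|exact: vS].
Qed.
HB.instance Definition _ := GRing.isSubmodClosed.Build A V submod_span submod_span_closed.
End Span.

Section FreeModule.
Variables (A : pzRingType) (T : choiceType).

Definition finsupp_pred : {pred T -> A^o} :=
  [pred f | `[< finite_set [set t | f t != 0] >]].

Fact finsupp_closed : GRing.subsemimod_closed finsupp_pred.
Proof.
apply: GRing.submod_closed_semi; split.
  apply/asboolP; rewrite (_ : [set _ | _] = set0) //.
  by apply/seteqP; split=> t //=; rewrite eqxx.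
move=> a f g /asboolP hf /asboolP hg; apply/asboolP.
apply: sub_finite_set (_ : finite_set ([set t | f t != 0] `|` [set t | g t != 0])).
  move=> t /=; apply: contra_neqP => /not_orP[/negP/negPn/eqP ft /negP/negPn/eqP gt].
  by rewrite (_ : (a *: f + g) t = a * f t + g t) // ft gt mulr0 addr0.
by rewrite finite_setU.
Qed.
HB.instance Definition _ := GRing.isSubmodClosed.Build A (T -> A^o) finsupp_pred finsupp_closed.

Record free_module := FreeModule {
  free_coef :> T -> A^o;
  free_coefP : free_coef \in finsupp_pred }.
HB.instance Definition _ := [isSub for free_coef].
HB.instance Definition _ := [Choice of free_module by <:].
HB.instance Definition _ := [SubChoice_isSubLmodule of free_module by <:].

Fact free_gen_subproof t : (fun s => (s == t)%:R : A^o) \in finsupp_pred.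
Proof.
apply/asboolP; apply: (sub_finite_set _ (finite_set1 t)) => s /=.
by have [//|_] := eqVneq s t; rewrite eqxx.
Qed.
Definition free_gen t : free_module := FreeModule (free_gen_subproof t).

Section Lift.
Variables (V : lmodType A) (h : T -> V).
Definition free_lift (f : free_module) : V := \sum_(t \in [set: T]) (f t : A) *: h t.

Lemma free_liftE (f : free_module) (B : set T) : finite_set B ->
  (forall t, (f t : A^o) != 0 -> B t) ->
  free_lift f = \sum_(t <- fset_set B) (f t : A) *: h t.
Proof.
move=> fB fsub; rewrite -fsbig_finite //; symmetry; apply: fsbig_widen => // t [_ nBt].
by have [ft|/fsub//] := eqVneq (f t) 0; rewrite /= ft scale0r.
Qed.

Fact free_lift_linear : linear free_lift.
Proof.
move=> a f g; have /asboolP ff := free_coefP f; have /asboolP fg := free_coefP g.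
set B := [set t | f t != 0] `|` [set t | g t != 0].
have fB : finite_set B by rewrite finite_setU.
have zB t : ~ B t -> f t = 0 /\ g t = 0.
  by move=> /not_orP[/negP/negPn/eqP ft /negP/negPn/eqP gt].
have afgE t : (a *: f + g) t = a * f t + g t by [].
rewrite !(free_liftE fB).
- rewrite scaler_sumr -big_split; apply: eq_bigr => t _.
  by rewrite afgE scalerDl scalerA.
- by move=> t gt; right.
- by move=> t ft; left.
- move=> t; rewrite afgE; apply: contra_neqP => /zB[-> ->].
  by rewrite mulr0 addr0.
Qed.
HB.instance Definition _ := GRing.isLinear.Build A free_module V *:%R free_lift
  free_lift_linear.

Lemma free_lift_gen t : free_lift (free_gen t) = h t.
Proof.
rewrite (@free_liftE _ [set t] (finite_set1 t)) => [|s /=].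
  by rewrite fset_set1 big_seq_fset1 /= eqxx scale1r.
by have [//|_] := eqVneq s t; rewrite eqxx.
Qed.
End Lift.

Lemma free_lift_eq (V : lmodType A) (f : {linear free_module -> V}) :
  free_lift (f \o free_gen) =1 f.
Proof.
move=> u; have /asboolP fu := free_coefP u.
rewrite (free_liftE _ fu) //=.
rewrite [in RHS](_ : u = \sum_(t <- fset_set [set t | u t != 0]) (u t : A) *: free_gen t).
  by rewrite linear_sum; apply: eq_bigr => t _; rewrite linearZ.
apply: val_inj => /=; apply/funext => s.
have -> : val (\sum_(t <- fset_set [set t | u t != 0]) (u t : A) *: free_gen t) =
  \sum_(t <- fset_set [set t | u t != 0]) val ((u t : A) *: free_gen t).
  exact: (big_morph val).
rewrite fct_sumE /=.
have vE t : ((u t : A) *: free_coef (free_gen t)) s = (u t : A) * (s == t)%:R by [].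
under eq_bigr do rewrite vE.
have [us|us] := boolP (s \in fset_set [set t | u t != 0]).
  rewrite (big_fsetD1 s) //= eqxx mulr1 big1_seq ?addr0 // => t /andP[_].
  by rewrite in_fsetD1 => /andP[/negPf ts _]; rewrite eq_sym ts mulr0.
have -> : u s = 0.
  by move: us; rewrite in_fset_set //; apply: contraNeq; exact: mem_set.
rewrite big1_seq // => t /andP[_ ut].
by have [st|] := eqVneq s t; rewrite ?mulr0 //; rewrite st ut in us.
Qed.

Lemma free_lin_ext (V : lmodType A) (f g : {linear free_module -> V}) :
  (forall t, f (free_gen t) = g (free_gen t)) -> f =1 g.
Proof.
move=> fg u; rewrite -(free_lift_eq f) -(free_lift_eq g).
by congr free_lift; apply/funext => t /=.
Qed.
End FreeModule.

Section Homology.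
Variable A : pzRingType.

Record chain_complex := ChainComplex {
  cc_obj :> nat -> lmodType A;
  cc_d : forall n, {linear cc_obj n.+1 -> cc_obj n};
  cc_dd : forall n v, cc_d n (cc_d n.+1 v) = 0 }.

Variables (C : chain_complex) (p : nat).

Definition cycle_pred : {pred C p} :=
  match p return {pred C p} with
  | 0 => predT
  | q.+1 => [pred v | cc_d C q v == 0]
  end.

Fact cycle_closed : GRing.subsemimod_closed cycle_pred.
Proof.
apply: GRing.submod_closed_semi; rewrite /cycle_pred; case: p => [//|q].
split=> [|a u v]; first by rewrite inE linear0.
by rewrite !inE => /eqP u0 /eqP v0; rewrite linearP u0 v0 scaler0 addr0.
Qed.
HB.instance Definition _ := GRing.isSubmodClosed.Build A (C p) cycle_pred cycle_closed.

Record cycles := Cycle { cycle_val :> C p; cycleP : cycle_val \in cycle_pred }.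
HB.instance Definition _ := [isSub for cycle_val].
HB.instance Definition _ := [Choice of cycles by <:].
HB.instance Definition _ := [SubChoice_isSubLmodule of cycles by <:].

Definition boundary_pred : {pred cycles} :=
  [pred z | `[< exists v, cc_d C p v = val z >]].

Fact boundary_closed : GRing.subsemimod_closed boundary_pred.
Proof.
apply: GRing.submod_closed_semi; split=> [|a u v].
  by apply/asboolP; exists 0; rewrite linear0.
move=> /asboolP[u' uE] /asboolP[v' vE]; apply/asboolP; exists (a *: u' + v').
by rewrite linearP uE vE.
Qed.
HB.instance Definition _ := GRing.isSubmodClosed.Build A cycles boundary_pred boundary_closed.

Definition homology : lmodType A := lmod_quot boundary_pred.
End Homology.

Section Ell2.
Variables (R : realType) (G : groupType).

Definition sqmod (z : R[i]) : R := complex.Re z ^+ 2 + complex.Im z ^+ 2.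

Lemma sqmod_ge0 z : 0 <= sqmod z.
Proof. by rewrite addr_ge0 ?sqr_ge0. Qed.

Lemma sqmod0 : sqmod 0 = 0.
Proof. by rewrite /sqmod /= expr0n addr0. Qed.

Lemma sqmodM a z : sqmod (a * z) = sqmod a * sqmod z.
Proof. by case: a z => [a b] [c d]; rewrite /sqmod /=; ring. Qed.

Lemma sqmodD a z : sqmod (a + z) <= 2 * sqmod a + 2 * sqmod z.
Proof.
case: a z => [a b] [c d]; rewrite /sqmod /= -subr_ge0.
have -> : 2 * (a ^+ 2 + b ^+ 2) + 2 * (c ^+ 2 + d ^+ 2) -
  ((a + c) ^+ 2 + (b + d) ^+ 2) = (a - c) ^+ 2 + (b - d) ^+ 2 by ring.
by rewrite addr_ge0 ?sqr_ge0.
Qed.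

Definition sqnorm (f : G -> R[i]) : \bar R :=
  \esum_(g in [set: G]) (sqmod (f g))%:E.

Lemma sqnorm_ge0 f : (0 <= sqnorm f)%E.
Proof. by apply: esum_ge0 => g _; rewrite lee_fin sqmod_ge0. Qed.

Lemma esumZ (a : R) (F : G -> R) : 0 <= a -> (forall g, 0 <= F g) ->
  (\esum_(g in [set: G]) (a * F g)%:E <= a%:E * \esum_(g in [set: G]) (F g)%:E)%E.
Proof.
move=> a0 F0; apply: ge_ereal_sup => _ [X [fX _] <-].
have -> : (\sum_(g \in X) (a * F g)%:E)%E = (a%:E * \sum_(g \in X) (F g)%:E)%E.
  by rewrite !fsbig_finite //= !sumEFin -EFinM -mulr_sumr.
apply: lee_wpmul2l; first by rewrite lee_fin.
by apply: ereal_sup_ubound; exists X.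
Qed.

Lemma sqnormZ a f : (sqnorm (fun g => a * f g)%R <= (sqmod a)%:E * sqnorm f)%E.
Proof.
rewrite /sqnorm; under eq_esum do rewrite sqmodM.
by apply: esumZ => *; exact: sqmod_ge0.
Qed.

Lemma sqnormD f f' :
  (sqnorm (fun g => f g + f' g)%R <= 2%:E * sqnorm f + 2%:E * sqnorm f')%E.
Proof.
apply: (@le_trans _ _ (\esum_(g in [set: G]) ((2 * sqmod (f g))%:E + (2 * sqmod (f' g))%:E)))%E.
  by apply: le_esum => g _; rewrite -EFinD lee_fin sqmodD.
rewrite esumD; last 2 first.
- by move=> g _; rewrite lee_fin mulr_ge0 ?sqmod_ge0.
- by move=> g _; rewrite lee_fin mulr_ge0 ?sqmod_ge0.
by apply: leeD; apply: esumZ => // *; exact: sqmod_ge0.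
Qed.

Lemma sqnorm_reindex (s : G -> G) f : bijective s ->
  sqnorm (fun g => f (s g)) = sqnorm f.
Proof.
move=> bs; rewrite /sqnorm [RHS](reindex_esum [set: G] [set: G] s) //.
by rewrite setTT_bijective.
Qed.

Definition ell2_pred : {pred G -> R[i]^o} := [pred f | (sqnorm f < +oo)%E].

Fact ell2_closed : GRing.subsemimod_closed ell2_pred.
Proof.
apply: GRing.submod_closed_semi; split=> [|a f f'].
  by rewrite inE /sqnorm esum1 // => g _; rewrite sqmod0.
rewrite !inE => hf hf'.
apply: le_lt_trans (sqnormD (fun g => a * f g) f') _.
have af : (sqnorm (fun g => a * f g)%R < +oo)%E.
  apply: le_lt_trans (sqnormZ a f) _.
  by apply: lte_mul_pinfty => //; rewrite lee_fin sqmod_ge0.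
by apply: lte_add_pinfty; apply: lte_mul_pinfty.
Qed.
HB.instance Definition _ := GRing.isSubmodClosed.Build R[i] (G -> R[i]^o) ell2_pred ell2_closed.

Record ell2 := Ell2 { ell2_fun :> G -> R[i]^o; ell2P : ell2_fun \in ell2_pred }.
HB.instance Definition _ := [isSub for ell2_fun].
HB.instance Definition _ := [Choice of ell2 by <:].
HB.instance Definition _ := [SubChoice_isSubLmodule of ell2 by <:].

Fact ell2_delta_subproof : (fun g : G => (g == 1%g)%:R : R[i]^o) \in ell2_pred.
Proof.
rewrite inE (_ : sqnorm _ = \esum_(g in [set 1%g : G]) 1%:E); last first.
  rewrite [RHS]esum_mkcond; apply: eq_esum => g _.
  have -> : (g \in [set 1%g : G]) = (g == 1%g).
    by apply/idP/eqP => [/set_mem//|->]; exact: mem_set.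
  by case: eqP => _; rewrite /sqmod /= ?expr0n ?expr1n ?addr0.
by rewrite esum_set1 ?ltry // lee_fin.
Qed.
Definition ell2_delta : ell2 := Ell2 ell2_delta_subproof.

Fact ell2_reindex_subproof (s : G -> G) (f : ell2) : bijective s ->
  (fun g => f (s g)) \in ell2_pred.
Proof. by move=> bs; rewrite inE sqnorm_reindex //; exact: ell2P. Qed.

Fact mulg_bij (h : G) : bijective (fun g => h * g)%g.
Proof. by exists (fun g => h^-1 * g)%g => g; rewrite mulgA ?mulVg ?mulgV mul1g. Qed.

Fact mulgr_bij (h : G) : bijective (fun g => g * h)%g.
Proof. by exists (fun g => g * h^-1)%g => g; rewrite -mulgA ?mulVg ?mulgV mulg1. Qed.

(* On delta functions: ell2_lact h delta_g = delta_(h * g) and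
   ell2_ract h delta_g = delta_(g * h^-1). *)
Definition ell2_lact (h : G) (f : ell2) : ell2 :=
  Ell2 (ell2_reindex_subproof f (mulg_bij h^-1)%g).
Definition ell2_ract (h : G) (f : ell2) : ell2 :=
  Ell2 (ell2_reindex_subproof f (mulgr_bij h)).

Definition ell2_bounded (T : ell2 -> ell2) : Prop :=
  exists2 M : R, 0 <= M & forall f, (sqnorm (T f) <= M%:E * sqnorm f)%E.

Definition ell2_equivariant (T : ell2 -> ell2) : Prop :=
  forall h f, T (ell2_lact h f) = ell2_lact h (T f).

Definition vN_pred : {pred ell2 -> ell2} :=
  [pred T : ell2 -> ell2 | `[< [/\ linear T, ell2_bounded T & ell2_equivariant T] >]].

Fact vN_closed : GRing.subsemimod_closed vN_pred.
Proof.
apply: GRing.submod_closed_semi; split=> [|a T T'].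
  apply/asboolP; split => [b u v|| h f].
  - by rewrite /GRing.zero /= scaler0 addr0.
  - by exists 0 => // f; rewrite mul0e /sqnorm esum1 // => g _; rewrite sqmod0.
  - by apply: val_inj.
move=> /asboolP[lT [M M0 bT] eT] /asboolP[lT' [M' M'0 bT'] eT']; apply/asboolP.
have E f : (a *: T + T') f = a *: T f + T' f by [].
split=> [b u v||h f].
- rewrite !E lT lT' !scalerDr !scalerA addrACA; congr (_ + _ + _).
  by rewrite mulrC.
- exists (2 * (sqmod a * M) + 2 * M'); first by rewrite addr_ge0 ?mulr_ge0 ?sqmod_ge0.
  move=> f; apply: le_trans (sqnormD (fun g => a * T f g) (T' f)) _.
  rewrite [in leRHS]EFinD [leRHS]ge0_muleDl ?lee_fin ?mulr_ge0 ?sqmod_ge0 //.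
  apply: leeD; rewrite [in leRHS]EFinM -[leRHS]muleA; apply: lee_wpmul2l;
    rewrite ?lee_fin //.
  apply: le_trans (sqnormZ _ _) _; rewrite EFinM -muleA.
  by apply: lee_wpmul2l; rewrite ?lee_fin ?sqmod_ge0.
- by rewrite !E eT eT'; apply: val_inj.
Qed.
HB.instance Definition _ :=
  GRing.isSubmodClosed.Build R[i] (ell2 -> ell2) vN_pred vN_closed.

(* The group von Neumann algebra N(G): the bounded operators on l^2(G) that commute
   with the left action of G, multiplied by composition. *)
Record vN := VN { vN_op :> ell2 -> ell2; vNP : vN_op \in vN_pred }.
HB.instance Definition _ := [isSub for vN_op].
HB.instance Definition _ := [Choice of vN by <:].
HB.instance Definition _ := [SubChoice_isSubLmodule of vN by <:].

Fact vN_one_subproof : (id : ell2 -> ell2) \in vN_pred.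
Proof. by apply/asboolP; split=> //; exists 1 => // f; rewrite mul1e. Qed.
Definition vN_one := VN vN_one_subproof.

Fact vN_mul_subproof (S T : vN) : (S \o T) \in vN_pred.
Proof.
have /asboolP[lT [M M0 bT] eT] := vNP T; have /asboolP[lS [N N0 bS] eS] := vNP S.
apply/asboolP; split=> [a u v||h f] /=; [by rewrite lT lS| |by rewrite eT eS].
exists (N * M) => [|f]; first exact: mulr_ge0.
apply: le_trans (bS _) _; rewrite EFinM -muleA.
by apply: lee_wpmul2l; rewrite ?lee_fin.
Qed.
Definition vN_mul (S T : vN) := VN (vN_mul_subproof S T).

Fact vN_mulA : associative vN_mul.
Proof. by move=> *; apply: val_inj. Qed.
Fact vN_mul1 : left_id vN_one vN_mul.
Proof. by move=> *; apply: val_inj. Qed.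
Fact vN_mulr1 : right_id vN_one vN_mul.
Proof. by move=> *; apply: val_inj. Qed.
Fact vN_mulDl : left_distributive vN_mul +%R.
Proof. by move=> *; apply: val_inj. Qed.
Fact vN_mulDr : right_distributive vN_mul +%R.
Proof.
move=> T S S'; apply: val_inj; apply/funext => f /=.
have /asboolP[lT _ _] := vNP T.
by have := lT 1 (S f) (S' f); rewrite !scale1r.
Qed.
HB.instance Definition _ := GRing.Zmodule_isPzRing.Build vN
  vN_mulA vN_mul1 vN_mulr1 vN_mulDl vN_mulDr.

Fact vN_of_group_subproof (h : G) : ell2_ract h \in vN_pred.
Proof.
apply/asboolP; split => [a u v||k f]; first exact: val_inj.
  by exists 1 => // f; rewrite mul1e /= sqnorm_reindex //; exact: mulgr_bij.
by apply: val_inj; apply/funext => g /=; rewrite mulgA.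
Qed.
(* The inclusion of G in N(G) sends g to right translation by g^-1, so that it
   is multiplicative and commutes with the left action. *)
Definition vN_of_group (h : G) : vN := VN (vN_of_group_subproof h).

Lemma vN_of_groupM g h : vN_of_group (g * h)%g = vN_of_group g * vN_of_group h.
Proof. by apply: val_inj; apply/funext => f; apply: val_inj; apply/funext => k /=; rewrite mulgA. Qed.

Definition vN_tr (a : vN) : R[i] := a ell2_delta 1%g.

(* P is a finitely generated projective submodule of M, isomorphic to the image
   of the idempotent matrix e, and t is its von Neumann dimension.  Right
   N(G)-modules are left modules over the converse ring. *)
Definition vN_proj_dim (M : lmodType vN^c) (P : set M) (t : R) : Prop :=
  exists (n : nat) (e : 'M[vN^c]_n) (f : {linear 'rV[vN^c]_n -> M}),
    [/\ e *m e = e,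
        P = [set f (v *m e) | v in [set: 'rV[vN^c]_n]],
        forall v : 'rV[vN^c]_n, f (v *m e) = 0 -> v *m e = 0 &
        \sum_i vN_tr (e i i) = t%:C].

(* Lueck's extension of the dimension to arbitrary modules. *)
Definition vN_dim (M : lmodType vN^c) : \bar R :=
  ereal_sup [set t%:E | t in [set t | exists P : set M, vN_proj_dim P t]].
End Ell2.

Section Tensor.
Variables (R : realType) (G : groupType).
Local Notation C := (R[i]).
Local Notation N := (vN R G).

(* Functors from G^op to complex vector spaces, that is, right C[G]-modules. *)
Record right_rep := RightRep {
  rep_obj :> lmodType C;
  rep_act : G -> {linear rep_obj -> rep_obj};
  rep_act1 : forall v, rep_act 1%g v = v;
  rep_actM : forall g h v, rep_act (g * h)%g v = rep_act h (rep_act g v) }.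

Record rep_hom (M M' : right_rep) := RepHom {
  rep_fun :> {linear M -> M'};
  rep_equiv : forall g v, rep_fun (rep_act M g v) = rep_act M' g (rep_fun v) }.

(* M (x)_C[G] N(G): the free abelian group on M x N(G), made additive in the
   second variable, is the free right N(G)-module on M; it remains to impose
   additivity in M and to balance the actions of C and of G. *)
Definition tensor_rel (M : right_rep) : set (free_module N^c M) :=
  [set z | (exists v w, z = free_gen _ (v + w) - free_gen _ v - free_gen _ w) \/
    (exists (c : C) v, z = free_gen _ (c *: v) - (c *: (1 : N) : N^c) *: free_gen _ v) \/
    (exists g v, z = free_gen _ (rep_act M g v) - (vN_of_group R g : N^c) *: free_gen _ v)].

Arguments tensor_rel : clear implicits.

Definition tensor (M : right_rep) : lmodType N^c := lmod_quot (submod_span (tensor_rel M)).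

Definition tensor_mk (M : right_rep) (v : M) : tensor M := lquot_class _ (free_gen _ v).

Lemma tensor_mk0 (M : right_rep) : tensor_mk (0 : M) = 0.
Proof.
apply/eqP; rewrite lquot_eq0 -[X in X \in _]opprK rpredN.
apply: submod_span_sub; left; exists 0, 0.
by rewrite addr0 subrr add0r.
Qed.

Section Map.
Variables (M M' : right_rep) (f : rep_hom M M').
Local Notation F := (free_lift (fun v : M => tensor_mk (f v))).

Fact tensor_map_subproof z : z \in submod_span (tensor_rel M) -> F z = 0.
Proof.
move=> zS; apply/eqP; apply: (submod_span_min (lin_ker_closed F) _ zS) => {z zS} z.
rewrite inE => -[[v [w ->]]|[[c [v ->]]|[g [v ->]]]];
  rewrite !linearB ?linearZ /= !free_lift_gen -?linearZ -!linearB /= lquot_eq0.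
- by apply: submod_span_sub; left; exists (f v), (f w); rewrite linearD.
- by apply: submod_span_sub; right; left; exists c, (f v); rewrite linearZ.
- by apply: submod_span_sub; right; right; exists g, (f v); rewrite rep_equiv.
Qed.

Definition tensor_map : tensor M -> tensor M' := lquot_lift tensor_map_subproof.
HB.instance Definition _ := GRing.Linear.on tensor_map.
Lemma tensor_mapE v : tensor_map (tensor_mk v) = tensor_mk (f v).
Proof. by rewrite /tensor_map lquot_liftE /= free_lift_gen. Qed.
End Map.

Lemma tensor_lin_ext (M : right_rep) (W : lmodType N^c) (f g : {linear tensor M -> W}) :
  (forall v, f (tensor_mk v) = g (tensor_mk v)) -> f =1 g.
Proof.
move=> fg x; rewrite -[x]lquot_reprK.
exact: (@free_lin_ext _ _ _ (f \o lquot_class _) (g \o lquot_class _) fg).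
Qed.
End Tensor.

Section Aut.
Variables (J : category) (x : J).

Record aut := MkAut {
  aut_fun : mor x x;
  aut_inv : mor x x;
  aut_invP : inverse aut_fun aut_inv }.

HB.instance Definition _ := gen_eqMixin aut.
HB.instance Definition _ := gen_choiceMixin aut.

Lemma autP (g h : aut) : aut_fun g = aut_fun h -> g = h.
Proof.
case: g h => [g g' gP] [h h' hP] /= gh; subst h.
have gh' : g' = h'.
  by rewrite -[g']mcomp_idr -(proj2 hP) compA (proj1 gP) mcomp_idl.
by subst h'; congr MkAut; exact: Prop_irrelevance.
Qed.

Definition aut_one : aut := MkAut (conj (mcomp_idl (idm x)) (mcomp_idl (idm x))).
Definition aut_opp (g : aut) : aut :=
  MkAut (conj (proj2 (aut_invP g)) (proj1 (aut_invP g))).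

Fact aut_mul_subproof (g h : aut) :
  inverse (mcomp (aut_fun g) (aut_fun h)) (mcomp (aut_inv h) (aut_inv g)).
Proof.
case: g h => [g g' [gP gP']] [h h' [hP hP']] /=; split.
  by rewrite -compA [mcomp g' _]compA gP mcomp_idl hP.
by rewrite -compA [mcomp h _]compA hP' mcomp_idl gP'.
Qed.
Definition aut_mul (g h : aut) : aut := MkAut (aut_mul_subproof g h).

Fact aut_mulA : associative aut_mul.
Proof. by move=> g h k; apply: autP; rewrite /= compA. Qed.
Fact aut_mul1 : left_id aut_one aut_mul.
Proof. by move=> g; apply: autP; rewrite /= mcomp_idl. Qed.
Fact aut_mulr1 : right_id aut_one aut_mul.
Proof. by move=> g; apply: autP; rewrite /= mcomp_idr. Qed.
Fact aut_mulV : left_inverse aut_one aut_opp aut_mul.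
Proof. by move=> g; apply: autP; case: (aut_invP g). Qed.
Fact aut_mulrV : right_inverse aut_one aut_opp aut_mul.
Proof. by move=> g; apply: autP; case: (aut_invP g). Qed.
HB.instance Definition _ := isGroup.Build aut
  aut_mulA aut_mul1 aut_mulr1 aut_mulV aut_mulrV.
End Aut.

Section IsoClasses.
Variable J : category.

Definition isomorphic (x y : {classic J}) : bool :=
  `[< exists u : mor (x : J) y, is_iso u >].

Fact isomorphic_refl : reflexive isomorphic.
Proof.
by move=> x; apply/asboolP; exists (idm _), (idm _); split; exact: mcomp_idl.
Qed.
Fact isomorphic_sym : symmetric isomorphic.
Proof.
by move=> x y; apply/asboolP/asboolP => -[u [v [vu uv]]]; exists v, u; split.
Qed.
Fact isomorphic_trans : transitive isomorphic.
Proof.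
move=> y x z /asboolP[u [u' [P P']]] /asboolP[v [v' [Q Q']]]; apply/asboolP.
exists (mcomp v u), (mcomp u' v'); split.
  by rewrite -compA [mcomp v' _]compA Q mcomp_idl P.
by rewrite -compA [mcomp u _]compA P' mcomp_idl Q'.
Qed.
Canonical isomorphic_equiv :=
  EquivRel isomorphic isomorphic_refl isomorphic_sym isomorphic_trans.

Definition iso_class := {eq_quot isomorphic}.
HB.instance Definition _ := Choice.on iso_class.

Definition iso_repr (c : iso_class) : J := (repr c : {classic J}).
End IsoClasses.

Section Presheaves.
Variables (R : realType) (J : category).
Local Notation C := (R[i]).

(* Objects of Func(J^op, C-vect). *)
Record presheaf := Presheaf {
  ps_obj :> J -> lmodType C;
  ps_map : forall x y, mor x y -> {linear ps_obj y -> ps_obj x};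
  ps_map1 : forall x v, ps_map (idm x) v = v;
  ps_mapM : forall x y z (g : mor y z) (f : mor x y) v,
    ps_map (mcomp g f) v = ps_map f (ps_map g v) }.

Record nat_trans (F G : presheaf) := NatTrans {
  nt_fun :> forall x, {linear F x -> G x};
  nt_nat : forall x y (f : mor x y) v,
    nt_fun x (ps_map F f v) = ps_map G f (nt_fun y v) }.

Definition const_presheaf : presheaf :=
  @Presheaf (fun=> C^o) (fun _ _ _ => idfun) (fun _ _ => erefl)
    (fun _ _ _ _ _ _ => erefl).

(* Func(J^op, C-vect) is abelian with kernels and cokernels computed objectwise:
   epimorphisms and exactness are objectwise surjectivity and exactness. *)
Definition epi (F G : presheaf) (p : nat_trans F G) : Prop :=
  forall x w, exists v, p x v = w.

Definition projective (P : presheaf) : Prop :=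
  forall (F G : presheaf) (p : nat_trans F G) (f : nat_trans P G), epi p ->
    exists h : nat_trans P F, forall x v, p x (h x v) = f x v.

Record proj_resolution := ProjResolution {
  res_obj :> nat -> presheaf;
  res_proj : forall n, projective (res_obj n);
  res_d : forall n, nat_trans (res_obj n.+1) (res_obj n);
  res_aug : nat_trans (res_obj 0) const_presheaf;
  res_aug_epi : epi res_aug;
  res_exact0 : forall x v, res_aug x v = 0 <-> exists w, res_d 0 x w = v;
  res_exact : forall n x v, res_d n x v = 0 <-> exists w, res_d n.+1 x w = v }.

Section Splitting.
Variable x : J.

(* S_x F is the quotient of F x by the image of the direct sum of the F(u^op), that
   is, by the span of their images. *)
Definition split_rel (F : presheaf) : set (F x) :=
  [set v | exists y (u : mor x y) (w : F y), ~ is_iso u /\ v = ps_map F u w].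
Arguments split_rel : clear implicits.

Definition split_obj (F : presheaf) : lmodType C :=
  lmod_quot (submod_span (split_rel F)).

Fact split_act_subproof (F : presheaf) (g : aut x) v :
  v \in submod_span (split_rel F) ->
  ps_map F (aut_fun g) v \in submod_span (split_rel F).
Proof.
apply: (submod_span_min (lin_preim_closed (ps_map F (aut_fun g)) _)) => _ [y [u [w [nu ->]]]].
rewrite inE -ps_mapM; apply: submod_span_sub; exists y, (mcomp u (aut_fun g)), w.
split=> // -[k [ku uk]]; apply: nu; exists (mcomp (aut_fun g) k).
case: (aut_invP g) => g'g gg'; split; last by rewrite compA.
rewrite -[RHS]gg' -[in RHS](mcomp_idl (aut_inv g)) -ku.
by rewrite -!compA gg' mcomp_idr.
Qed.
Definition split_act (F : presheaf) (g : aut x) : {linear split_obj F -> split_obj F} :=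
  lquot_map (@split_act_subproof F g).

Fact split_act1 F v : split_act F 1%g v = v.
Proof.
rewrite -[v]lquot_reprK [LHS]lquot_mapE; congr lquot_class; exact: ps_map1.
Qed.

Fact split_actM F g h v : split_act F (g * h)%g v = split_act F h (split_act F g v).
Proof.
rewrite -[v]lquot_reprK [LHS]lquot_mapE [X in split_act F h X]lquot_mapE.
by rewrite [RHS]lquot_mapE; congr lquot_class; exact: ps_mapM.
Qed.

(* The splitting functor S_x on objects and on natural transformations. *)
Definition splitting (F : presheaf) : right_rep R (aut x) :=
  RightRep (@split_act1 F) (@split_actM F).

Section Map.
Variables (F G : presheaf) (f : nat_trans F G).

Fact splitting_map_subproof v :
  v \in submod_span (split_rel F) -> f x v \in submod_span (split_rel G).
Proof.
apply: (submod_span_min (lin_preim_closed (f x) _)) => _ [y [u [w [nu ->]]]].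
by rewrite inE nt_nat; apply: submod_span_sub; exists y, u, (f y w).
Qed.

Fact splitting_map_equiv g v :
  lquot_map splitting_map_subproof (rep_act (splitting F) g v) =
  rep_act (splitting G) g (lquot_map splitting_map_subproof v).
Proof.
rewrite -[v]lquot_reprK [X in lquot_map _ X]lquot_mapE !lquot_mapE.
by rewrite [RHS]lquot_mapE nt_nat.
Qed.

Definition splitting_map : rep_hom (splitting F) (splitting G) :=
  @RepHom _ _ (splitting F) (splitting G) (lquot_map splitting_map_subproof)
    splitting_map_equiv.
End Map.

Section L2Complex.
Variable P : proj_resolution.

Fact split_complex_dd n v :
  tensor_map (splitting_map (res_d P n)) (tensor_map (splitting_map (res_d P n.+1)) v) = 0.
Proof.
apply: (@tensor_lin_ext _ _ _ _
  (tensor_map (splitting_map (res_d P n)) \o tensor_map (splitting_map (res_d P n.+1))) \0) => {}v /=.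
rewrite !tensor_mapE -[v]lquot_reprK; move: (repr v) => {}v /=.
rewrite [X in lquot_map _ X]lquot_mapE lquot_mapE (_ : res_d P n x (res_d P n.+1 x v) = 0).
  by rewrite linear0 tensor_mk0.
by apply/res_exact; exists v.
Qed.

(* S_x P_* (x)_C[x] N(x), as a complex of right N(x)-modules. *)
Definition split_complex : chain_complex (vN R (aut x))^c :=
  ChainComplex split_complex_dd.
End L2Complex.
End Splitting.
End Presheaves.

Section L2Euler.
Variable R : realType.

Section Complex.
Variables (G : groupType) (K : chain_complex (vN R G)^c).

Definition l2_betti (p : nat) : \bar R := vN_dim (homology K p).
Definition h2_complex : \bar R := (\sum_(0 <= p <oo) l2_betti p)%E.
Definition chi2_complex : R :=
  fine (\sum_(0 <= p <oo) (((-1) ^+ p)%:E * l2_betti p))%E.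
End Complex.

Variable J : category.

Definition h2_res (P : proj_resolution R J) : \bar R :=
  \esum_(c in [set: iso_class J]) h2_complex (split_complex (iso_repr c) P).

(* The sum over isomorphism classes is unordered, as the difference of the sums of
   the positive and negative parts. *)
Definition chi2_res (P : proj_resolution R J) : R :=
  let a c := (chi2_complex (split_complex (iso_repr c) P))%:E in
  fine (\esum_(c in [set: iso_class J]) a^\+ c - \esum_(c in [set: iso_class J]) a^\- c)%E.

Definition typeL2 : Prop := exists P : proj_resolution R J, (h2_res P < +oo)%E.

(* Computed from a chosen resolution with finite h^(2); 0 outside type (L^2). *)
Definition chi2 : R :=
  if pselect typeL2 is left H then chi2_res (projT1 (cid H)) else 0.
End L2Euler.

(* Main.v *)
From HB Require Import structures.
From mathcomp Require Import all_boot all_order all_algebra.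
From mathcomp Require Import boolp classical_sets cardinality fsbigop.
From mathcomp Require Import reals ereal topology sequences esum numfun.
From Stdlib Require Import Relation_Operators Eqdep.
From mathcomp Require Import complex finmap zify lra.
Require Import Defs.

(** The subdivision [Sd I] never has morphisms other than identities from a chain
    to one that is not longer, since its morphisms are strictly increasing on
    vertices ([acyclic_opcat_Sd]).  All groups of automorphisms are therefore
    trivial, both in the opposite of [Sd I] and in an acyclic [I], and the von
    Neumann dimension is the complex dimension ([vN_dim_fin]).  The homology of
    the complexes that define the L2-Euler characteristic does not depend on the
    projective resolution ([l2_betti_eq]), so that it can be computed from a
    resolution by free presheaves; the splitting functor at [x] turns a free
    presheaf into a space with one dimension for each generator placed at [x]
    ([fin_dim_splitting]).

    The nondegenerate chains of [I] are the generators, in the degree given by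
    their lengths, of two such resolutions: one over the opposite of [Sd I], where
    a chain is placed at itself ([sd_resolution]), and the normalized bar
    resolution over [I], where a chain is placed at its source
    ([bar_resolution]).  Both are exact for the same reason.  At a given object
    they are normalized quotients of the complex of all the chains, in some
    category, that start at a fixed object, and repeating the first vertex
    contracts this complex ([pchain_homotopy]).  The contraction passes to the
    quotient ([nchain_exact]).  For the subdivision, the quotient at a chain [Z]
    identifies two subchains of [Z] when their vertices are pairwise joined by
    identities in [Z]; this is how the relation on the morphisms of [Sd I] enters
    ([sd_chain_eqP]).

    Over the opposite of [Sd I] each chain carries exactly one generator, so the
    total L2-homology has one dimension per nondegenerate chain.  It is finite if
    and only if there are finitely many nondegenerate chains.  Then [I] is finite,
    and acyclic because a nonidentity endomorphism, or a pair of morphisms in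
    opposite directions between different objects, composes with itself to
    arbitrarily long nondegenerate chains ([long_chains]).  Conversely the chains
    of a finite acyclic category have distinct vertices ([nchain_inj]), hence are
    finite in number.  In that case Euler's formula gives for both categories the
    same value, the alternating sum over the nondegenerate chains of the signs of
    their lengths ([chi2_finite]). *)

Set Implicit Arguments.
Unset Strict Implicit.
Unset Printing Implicit Defensive.

Import Order.TTheory GRing.Theory Num.Theory.
Import ComplexField.

Local Open Scope classical_set_scope.
Local Open Scope ring_scope.
Local Open Scope quotient_scope.
Local Open Scope complex_scope.

(** * Arrows and functors on finite ordinals *)

(** Morphisms with different endpoints are compared through the arrows they
    define, so that no cast is needed in equations between functors. *)
Definition arr (C : category) (x y : C) (u : mor x y) :
    {x : C & {y : C & mor x y}} := existT _ x (existT _ y u).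

Section Arrows.
Variable C : category.

Lemma arr_inj (x y : C) (u v : mor x y) : arr u = arr v -> u = v.
Proof. by move=> e; exact: inj_pair2 _ _ _ _ _ (inj_pair2 _ _ _ _ _ e). Qed.

Lemma arr_src (x y x' y' : C) (u : mor x y) (u' : mor x' y') :
  arr u = arr u' -> x = x'.
Proof. by move=> /(congr1 (@projT1 _ _)). Qed.

Lemma arr_tgt (x y x' y' : C) (u : mor x y) (u' : mor x' y') :
  arr u = arr u' -> y = y'.
Proof. by move=> /(congr1 (fun a => projT1 (projT2 a))). Qed.

Lemma is_identityE (x y : C) (u : mor x y) :
  is_identity u <-> arr u = arr (idm x).
Proof.
split=> [[]//|e]; move: (arr_tgt e) => yx; subst y.
by rewrite (arr_inj e); constructor.
Qed.

Lemma is_identity_eq (x y x' y' : C) (u : mor x y) (u' : mor x' y') :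
  arr u = arr u' -> is_identity u -> is_identity u'.
Proof.
move=> e /is_identityE iu; apply/is_identityE; rewrite -e iu.
by rewrite (arr_src e).
Qed.

Lemma is_identity_same_ends (x y : C) (u : mor x y) : is_identity u -> x = y.
Proof. by case. Qed.

Lemma arr_compl (x y z : C) (v : mor y z) (u : mor x y) :
  is_identity v -> arr (mcomp v u) = arr u.
Proof. by move=> iv; case: iv u => t u; rewrite mcomp_idl. Qed.

Lemma arr_compr (x y z : C) (v : mor y z) (u : mor x y) :
  is_identity u -> arr (mcomp v u) = arr v.
Proof. by move=> iu; case: iu v => t v; rewrite mcomp_idr. Qed.

Lemma arr_comp_eq (x y z x' y' z' : C) (v : mor y z) (u : mor x y)
    (v' : mor y' z') (u' : mor x' y') :
  arr v = arr v' -> arr u = arr u' -> arr (mcomp v u) = arr (mcomp v' u').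
Proof.
move=> ev eu; have ? := arr_src eu; have ? := arr_tgt eu; have ? := arr_tgt ev.
by subst; rewrite (arr_inj ev) (arr_inj eu).
Qed.

End Arrows.

Section FunctorArrows.
Variables C D : category.

Lemma arr_fmor (F : functor C D) (x y x' y' : C) (u : mor x y) (u' : mor x' y') :
  arr u = arr u' -> arr (fmor F u) = arr (fmor F u').
Proof.
move=> e; have ? := arr_src e; have ? := arr_tgt e.
by subst; rewrite (arr_inj e).
Qed.

Lemma functor_ext (F G : functor C D) :
  (forall x y (u : mor x y), arr (fmor F u) = arr (fmor G u)) -> F = G.
Proof.
move=> e; have eo : fob F = fob G.
  by apply/funext => x; exact: arr_src (e x x (idm x)).
case: F G e eo => o m i c [o' m' i' c'] /= e eo; subst o'.
have em : m = m'.
  by apply: functional_extensionality_dep => x;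
    apply: functional_extensionality_dep => y;
    apply/funext => u; exact: arr_inj (e x y u).
by subst m'; congr Functor; exact: Prop_irrelevance.
Qed.

End FunctorArrows.

Lemma functor_ord_ext (C : category) n (F G : functor C (ordcat n)) : fob F =1 fob G -> F = G.
Proof.
move=> e; apply: functor_ext => x y u.
move: (fmor F u) (fmor G u); rewrite !e => a b.
by rewrite (bool_irrelevance a b).
Qed.


Section Ordinals.

Definition ordf m n (f : 'I_m.+1 -> 'I_n.+1)
    (hf : {homo f : i j / (i <= j)%N >-> (i <= j)%N}) : functor (ordcat m) (ordcat n) :=
  @Functor (ordcat m) (ordcat n) f hf
    (fun _ => bool_irrelevance _ _) (fun _ _ _ _ _ => bool_irrelevance _ _).

Lemma lift_homo n (k : 'I_n.+2) : {homo @lift n.+2 k : i j / (i <= j)%N >-> (i <= j)%N}.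
Proof. by move=> i j ij; rewrite leq_bump2. Qed.

Definition coface n (k : 'I_n.+2) : functor (ordcat n) (ordcat n.+1) := ordf (@lift_homo n k).

Fact pred_subproof n (i : 'I_n.+2) : (i.-1 < n.+1)%N.
Proof. by case: i => -[]. Qed.
Fact pred_homo n : {homo (fun i : 'I_n.+2 => Ordinal (pred_subproof i)) : i j / (i <= j)%N >-> (i <= j)%N}.
Proof. by move=> i j /=; lia. Qed.
Definition codegen0 n : functor (ordcat n.+1) (ordcat n) := ordf (@pred_homo n).

Lemma fmor_irr n (C : category) (F : functor (ordcat n) C) (i j i' j' : 'I_n.+1)
    (u : @mor (ordcat n) i j) (u' : @mor (ordcat n) i' j') :
  i = i' -> j = j' -> arr (fmor F u) = arr (fmor F u').
Proof. by move=> ? ?; subst; rewrite (bool_irrelevance u u'). Qed.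

Lemma fmor_split n (C : category) (F : functor (ordcat n) C) (i j k : 'I_n.+1)
    (u : @mor (ordcat n) i j) (v : @mor (ordcat n) j k) (w : @mor (ordcat n) i k) :
  fmor F w = mcomp (fmor F v) (fmor F u).
Proof. by rewrite -fmor_comp; congr fmor; exact: bool_irrelevance. Qed.

(** This relation generates the identification of morphisms in the subdivision.
    It is already an equivalence relation: if two of the arrows [f], [g] and
    [g f] are identities, then so is the third. *)
Definition collapsed n (C : category) (F : functor (ordcat n) C) (i j : 'I_n.+1) : Prop :=
  is_identity (fmor F (min_hom_max i j)).

Section Collapsed.
Variables (n : nat) (C : category) (F : functor (ordcat n) C).

Lemma collapsed_sym i j : collapsed F i j -> collapsed F j i.
Proof.
by apply: is_identity_eq; apply: fmor_irr; rewrite ?(minC i) ?(maxC i).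
Qed.

Lemma collapsedE (i j : 'I_n.+1) (ij : @mor (ordcat n) i j) :
  collapsed F i j <-> is_identity (fmor F ij).
Proof.
have ij' : (i <= j)%O by exact: ij.
by split; apply: is_identity_eq; apply: fmor_irr; rewrite ?(min_l ij') ?(max_r ij').
Qed.

Lemma collapsed_refl i : collapsed F i i.
Proof.
apply/(collapsedE (leqnn i)); rewrite (_ : leqnn i = idm (i : ordcat n)) //.
by rewrite fmor_id; constructor.
Qed.

Lemma collapsed_between (i j k : 'I_n.+1) : (i <= j <= k)%N ->
  [/\ collapsed F i j -> collapsed F j k -> collapsed F i k,
      collapsed F i j -> collapsed F i k -> collapsed F j k &
      collapsed F j k -> collapsed F i k -> collapsed F i j].
Proof.
move=> /andP[ij jk]; have ik := leq_trans ij jk.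
rewrite (propext (collapsedE ij)) (propext (collapsedE jk)) (propext (collapsedE ik)).
rewrite (fmor_split F (ij : @mor (ordcat n) i j) (jk : @mor (ordcat n) j k)).
split=> a b.
- by apply: is_identity_eq b; rewrite arr_compr.
- by apply: is_identity_eq b; rewrite arr_compr.
- by apply: is_identity_eq b; rewrite arr_compl.
Qed.

Lemma collapsed_trans i j k : collapsed F i j -> collapsed F j k -> collapsed F i k.
Proof.
move=> a b; have a' := collapsed_sym a; have b' := collapsed_sym b.
have [ij|/ltnW ji] := leqP i j; have [jk|/ltnW kj] := leqP j k;
    have [ik|/ltnW ki] := leqP i k.
- by have [] := @collapsed_between i j k; [rewrite ij jk|auto].
- by have [] := @collapsed_between i j k; [rewrite ij jk|auto].
- by have [] := @collapsed_between i k j; [rewrite ik kj|auto].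
- by have [] := @collapsed_between k i j; [rewrite ki ij|move=> *; apply: collapsed_sym; auto].
- by have [] := @collapsed_between j i k; [rewrite ji ik|auto].
- by have [] := @collapsed_between j k i; [rewrite jk ki|move=> *; apply: collapsed_sym; auto].
- by have [] := @collapsed_between k j i; [rewrite kj ji|move=> *; apply: collapsed_sym; auto].
- by have [] := @collapsed_between k j i; [rewrite kj ji|move=> *; apply: collapsed_sym; auto].
Qed.

(** In a commutative square whose horizontal sides are identities, the vertical
    sides agree.  Hence a subchain does not change when its vertices are moved
    within their collapsing classes. *)
Lemma collapsed_subchain m (a b : functor (ordcat m) (ordcat n)) :
  (forall i, collapsed F (a i) (b i)) -> functor_comp F a = functor_comp F b.
Proof.
move=> ab; apply: functor_ext => i j ij /=.
wlog abi : a b ab / (a i <= b i)%N => [hw|].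
  have [/hw->//|/ltnW ba] := leqP (a i) (b i); symmetry; apply: hw => // k.
  exact/collapsed_sym.
have aij := fmor a ij; have bij := fmor b ij.
have /(collapsedE abi) ci := ab i.
have [abj|/ltnW baj] := leqP (a j) (b j).
  have /(collapsedE abj) cj := ab j.
  have aibj : (a i <= b j)%N := leq_trans abi bij.
  transitivity (arr (fmor F (aibj : @mor (ordcat n) (a i) (b j)))).
    by rewrite (fmor_split F (fmor a ij) (abj : @mor (ordcat n) _ _)) arr_compl.
  by rewrite (fmor_split F (abi : @mor (ordcat n) _ _) (fmor b ij)) arr_compr.
have /collapsed_sym/(collapsedE baj) cj := ab j.
rewrite (fmor_split F (abi : @mor (ordcat n) _ _) (leq_trans (fmor b ij) baj : @mor (ordcat n) _ _)) arr_compr //.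
by rewrite (fmor_split F (fmor b ij) (baj : @mor (ordcat n) _ _)) arr_compl.
Qed.

End Collapsed.

Lemma degenerateP n (C : category) (F : functor (ordcat n) C) :
  ~ nondegenerate F -> exists2 k : 'I_n, True & collapsed F (widen_ord (leqnSn n) k) (lift ord0 k).
Proof.
move=> /existsNP[i /existsNP[j /existsNP[ij /not_implyP[eij /contrapT cij]]]].
have ilt : (val i < n)%N by rewrite -ltnS -eij ltn_ord.
exists (Ordinal ilt) => //.
have -> : widen_ord (leqnSn n) (Ordinal ilt) = i by exact: val_inj.
have -> : lift ord0 (Ordinal ilt) = j by apply: val_inj; rewrite /= /bump /= eij.
exact/(collapsedE _ ij).
Qed.

End Ordinals.

(** Prepending an arrow to a chain.  The vertices of the longer chain are coded
    as those of the shorter one and an additional first vertex [None], so that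
    arrows can be defined by cases. *)
Section Prepend.
Variables (C : category) (n : nat) (s : functor (ordcat n) C) (y : C).
Variable u : mor y (s ord0).

Let pob (o : option 'I_n.+1) : C := if o is Some i then s i else y.

Let ole (a b : option 'I_n.+1) : bool :=
  match a, b with
  | None, _ => true
  | Some _, None => false
  | Some i, Some j => (i <= j)%N
  end.

Let pmor (a b : option 'I_n.+1) : ole a b -> mor (pob a) (pob b) :=
  match a, b with
  | None, None => fun _ => idm y
  | None, Some j => fun _ => mcomp (fmor s (leq0n j : @mor (ordcat n) ord0 j)) u
  | Some i, None => fun h => False_rect _ (Bool.diff_false_true h)
  | Some i, Some j => fun h => fmor s (h : @mor (ordcat n) i j)
  end.

Let pmor_id a (h : ole a a) : pmor h = idm _.
Proof.
case: a h => [i|] h //=; rewrite (bool_irrelevance h (idm (i : ordcat n))); exact: fmor_id.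
Qed.

Let pmor_comp a b c (g : ole b c) (f : ole a b) (h : ole a c) :
  pmor h = mcomp (pmor g) (pmor f).
Proof.
case: a b c g f h => [i|] [j|] [k|] //= g f h.
- exact: fmor_split.
- by rewrite compA; congr (mcomp _ u); exact: fmor_split.
- by rewrite mcomp_idr.
- by rewrite mcomp_idr.
Qed.

Let ole_unlift (i j : 'I_n.+2) : (i <= j)%N -> ole (unlift ord0 i) (unlift ord0 j).
Proof.
case: (unliftP ord0 i) => [i'|] ->; case: (unliftP ord0 j) => [j'|] -> //=.
Qed.

Definition prepend : functor (ordcat n.+1) C :=
  @Functor (ordcat n.+1) C (fun i => pob (unlift ord0 i))
    (fun i j ij => pmor (ole_unlift ij))
    (fun i => pmor_id _) (fun i j k g f => pmor_comp _ _ _).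

Lemma prepend_face0 : functor_comp prepend (coface ord0) = s.
Proof.
apply: functor_ext => i j ij.
have gen a b (h : ole a b) : a = Some i -> b = Some j -> arr (pmor h) = arr (fmor s ij).
  by move=> ? ?; subst; rewrite /= (bool_irrelevance h ij).
by apply: gen; exact: (liftK ord0).
Qed.

Lemma prepend_from (k : 'I_n.+1) (h : @mor (ordcat n.+1) ord0 (lift ord0 k))
    (h' : @mor (ordcat n) ord0 k) :
  arr (fmor prepend h) = arr (mcomp (fmor s h') u).
Proof.
have gen a b (l : ole a b) : a = None -> b = Some k ->
    arr (pmor l) = arr (mcomp (fmor s h') u).
  by move=> ? ?; subst => /=; rewrite (bool_irrelevance (leq0n k) h').
by apply: gen; [rewrite unlift_none|exact: (liftK ord0)].
Qed.

Lemma prepend_first (h : @mor (ordcat n.+1) ord0 (lift ord0 ord0)) :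
  arr (fmor prepend h) = arr u.
Proof.
by rewrite (prepend_from h (idm (ord0 : ordcat n))) fmor_id mcomp_idl.
Qed.

Lemma prepend0 : prepend ord0 = y.
Proof. exact: (arr_src (prepend_first (leq0n _ : @mor (ordcat n.+1) ord0 _))). Qed.

End Prepend.

(** Every arrow out of the first vertex factors through the first step. *)
Lemma functor_eq_prepend (C : category) n (F G : functor (ordcat n.+1) C)
    (h : @mor (ordcat n.+1) ord0 (lift ord0 ord0)) :
  functor_comp F (coface ord0) = functor_comp G (coface ord0) ->
  arr (fmor F h) = arr (fmor G h) -> F = G.
Proof.
move=> e e0; have es (i j : 'I_n.+1) (ij : @mor (ordcat n.+1) (lift ord0 i) (lift ord0 j)) :
    arr (fmor F ij) = arr (fmor G ij).
  have ij' : (i <= j)%N by move: ij; rewrite /= /bump /=; lia.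
  transitivity (arr (fmor (functor_comp F (coface ord0)) (ij' : @mor (ordcat n) i j))).
    exact: (fmor_irr F ij (fmor (@coface n ord0) (ij' : @mor (ordcat n) i j)) erefl erefl).
  rewrite e.
  exact: (fmor_irr G (fmor (@coface n ord0) (ij' : @mor (ordcat n) i j)) ij erefl erefl).
have id0 H : arr (@fmor (ordcat n.+1) C H _ _ (idm (ord0 : ordcat n.+1))) = arr (idm (H ord0)).
  by rewrite fmor_id.
apply: functor_ext => i j; case: (unliftP ord0 i) => [i'|] ->; case: (unliftP ord0 j) => [j'|] -> //= ij.
- have ij' : (@lift n.+2 ord0 ord0 <= lift ord0 j')%N by rewrite /= /bump /=; lia.
  rewrite !(fmor_split _ h (ij' : @mor (ordcat n.+1) _ _)).
  exact: arr_comp_eq.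
- rewrite (_ : ij = idm (ord0 : ordcat n.+1)); last exact: bool_irrelevance.
  by rewrite !id0 (arr_src e0).
Qed.

(** * Contractible complexes of chains with a fixed first vertex *)

(** The simplices of dimension [n] are the chains of length [n.+1] that start at
    [b]; their faces omit the vertices other than the first one.  Repeating the
    first vertex is then an extra degeneracy. *)
Record pointed (D : category) (b : D) (n : nat) := Pointed {
  pt_fun :> functor (ordcat n.+1) D;
  pt_base : pt_fun ord0 = b }.

HB.instance Definition _ D b n := gen_eqMixin (@pointed D b n).
HB.instance Definition _ D b n := gen_choiceMixin (@pointed D b n).

Section Pointed.
Variables (D : category) (b : D).
Local Notation pointed := (pointed b).

Lemma pointedP n (F G : pointed n) : pt_fun F = pt_fun G -> F = G.
Proof.
by case: F G => F f0 [G g0] /= e; subst G; congr Pointed; exact: Prop_irrelevance.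
Qed.

Fact pface_subproof n (i : 'I_n.+2) (F : pointed n.+1) :
  functor_comp F (coface (lift ord0 i)) ord0 = b.
Proof.
apply: etrans (pt_base F); rewrite /=; congr (pt_fun F _).
by apply: val_inj; rewrite /= /bump /=; lia.
Qed.
Definition pface n (i : 'I_n.+2) (F : pointed n.+1) : pointed n :=
  Pointed (pface_subproof i F).

Fact cone_subproof n (F : pointed n) : functor_comp F (codegen0 n.+1) ord0 = b.
Proof.
by apply: etrans (pt_base F); rewrite /=; congr (pt_fun F _); exact: val_inj.
Qed.
Definition cone n (F : pointed n) : pointed n.+1 := Pointed (cone_subproof F).

Definition const_functor (C : category) : functor C D :=
  @Functor C D (fun=> b) (fun _ _ _ => idm b) (fun=> erefl)
    (fun _ _ _ _ _ => esym (mcomp_idl _)).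

Definition base_point : pointed 0 := Pointed (erefl : const_functor (ordcat 1) ord0 = b).

Lemma pface_pface n (F : pointed n.+2) (i : 'I_n.+2) (j : 'I_n.+3) (j' : 'I_n.+2) (i' : 'I_n.+3) :
  (i < j)%N -> val i = i' -> val j = j'.+1 -> pface i (pface j F) = pface j' (pface i' F).
Proof.
move=> ij; rewrite /= => ii jj; apply: pointedP; rewrite /= -!functor_compA; congr functor_comp.
apply: functor_ord_ext => k; apply: val_inj; rewrite /= /bump /=. lia.
Qed.

Lemma pface0_cone n (F : pointed n) : pface ord0 (cone F) = F.
Proof.
apply: pointedP; rewrite /= -functor_compA -[RHS]functor_compr1; congr functor_comp.
by apply: functor_ord_ext => k; apply: val_inj; rewrite /= /bump /=; lia.
Qed.

Lemma pfaceS_cone n (F : pointed n.+1) (i : 'I_n.+2) :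
  pface (lift ord0 i) (cone F) = cone (pface i F).
Proof.
apply: pointedP; rewrite /= -!functor_compA; congr functor_comp.
by apply: functor_ord_ext => k; apply: val_inj; rewrite /= /bump /=; lia.
Qed.

Lemma pface1_cone (F : pointed 0) : pface (lift ord0 ord0) (cone F) = base_point.
Proof.
apply: pointedP; rewrite /= -functor_compA.
apply: functor_ext => i j ij; case: (F) => G G0 /=.
have -> : arr (idm b) = arr (fmor G (idm (ord0 : ordcat 1))) by rewrite fmor_id G0.
by apply: fmor_irr; apply: val_inj => /=; case: i j {ij} => -[|[|]] // ? [[|[|]] // ?].
Qed.

End Pointed.

Section PointedComplex.
Variables (K : numFieldType) (D : category) (b : D).
Local Notation pointed := (pointed b).
Local Notation chains n := (free_module K (pointed n)).

Definition pchain_d n : {linear chains n.+1 -> chains n} :=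
  free_lift (fun F => \sum_(i < n.+2) (-1) ^+ i *: free_gen K (pface i F)).

Definition pchain_h n : {linear chains n -> chains n.+1} :=
  free_lift (fun F => free_gen K (cone F)).

Lemma pchain_dE n (F : pointed n.+1) :
  pchain_d n (free_gen K F) = \sum_(i < n.+2) (-1) ^+ i *: free_gen K (pface i F).
Proof. exact: free_lift_gen. Qed.

Lemma pchain_hE n (F : pointed n) : pchain_h n (free_gen K F) = free_gen K (cone F).
Proof. exact: free_lift_gen. Qed.

Lemma pchain_dd n x : pchain_d n (pchain_d n.+1 x) = 0.
Proof.
apply: (free_lin_ext (f := pchain_d n \o pchain_d n.+1) (g := \0)) => F /=.
rewrite pchain_dE linear_sum /=.
pose G (p : 'I_n.+3 * 'I_n.+2) : chains n :=
  (-1) ^+ (p.1 + p.2) *: free_gen K (pface p.2 (pface p.1 F)).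
transitivity (\sum_p G p).
  rewrite -(pair_bigA _ (fun j i => G (j, i))) /=; apply: eq_bigr => j _.
  rewrite linearZ /= pchain_dE scaler_sumr; apply: eq_bigr => i _.
  by rewrite scalerA -exprD.
(* The simplicial identities pair the terms (j, i) with i < j with the others,
   with opposite signs. *)
pose s (p : 'I_n.+3 * 'I_n.+2) : 'I_n.+3 * 'I_n.+2 :=
  if (p.2 < p.1)%N then (inord p.2, inord p.1.-1) else (inord p.2.+1, inord p.1).
have sE1 (p : 'I_n.+3 * 'I_n.+2) : (p.2 < p.1)%N -> (val (s p).1 = p.2) /\ (val (s p).2 = p.1.-1).
  case: p => j i /= ij; rewrite /s /= ij /= !inordK //; have := ltn_ord j; have := ltn_ord i; lia.
have sE2 (p : 'I_n.+3 * 'I_n.+2) : (p.2 < p.1)%N = false -> (val (s p).1 = p.2.+1) /\ (val (s p).2 = p.1).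
  case: p => j i /= ij; rewrite /s /= ij /= !inordK //; have := ltn_ord j; have := ltn_ord i; lia.
have sK : involutive s.
  move=> p; apply/eqP; rewrite -pair_eqE; case e : (p.2 < p.1)%N.
    have [e1 e2] := sE1 _ e; have e' : ((s p).2 < (s p).1)%N = false.
      by rewrite [X in (X < _)%N]e2 e1; move: e; lia.
    have [e3 e4] := sE2 _ e'; rewrite /pair_eq /= -!val_eqE /= e3 e4 e1 e2.
    by rewrite !prednK ?eqxx //; move: e; lia.
  have [e1 e2] := sE2 _ e; have e' : ((s p).2 < (s p).1)%N.
    by rewrite [X in (X < _)%N]e2 e1; move: e; lia.
  by have [e3 e4] := sE1 _ e'; rewrite /pair_eq /= -!val_eqE /= e3 e4 e1 e2 /= !eqxx.
have sG (p : 'I_n.+3 * 'I_n.+2) : G (s p) = - G p.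
  rewrite /G -scaleNr; case e : (p.2 < p.1)%N.
    have [e1 e2] := sE1 _ e.
    rewrite (@pface_pface _ _ _ F p.2 p.1 (s p).2 (s p).1) //; last first.
      by rewrite [RHS](congr1 S e2) prednK //; move: e; lia.
    congr (_ *: _); rewrite [X in _ ^+ (X + _)]e1 [X in _ ^+ (_ + X)]e2.
    by case: p e {e1 e2} => [[[|j] ?] i] //= _; rewrite addSn exprS mulN1r opprK addnC.
  have [e1 e2] := sE2 _ e.
  rewrite (@pface_pface _ _ _ F (s p).2 (s p).1 p.2 p.1) //; last first.
    by rewrite [X in (X < _)%N]e2 e1; move: e; lia.
  congr (_ *: _); rewrite [X in _ ^+ (X + _)]e1 [X in _ ^+ (_ + X)]e2.
  by rewrite addSn exprS mulN1r addnC.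
have S0 : \sum_p G p = - \sum_p G p.
  rewrite -sumrN [LHS](reindex_inj (inv_inj sK)); apply: eq_bigr => p _; exact: sG.
apply/eqP; move/eqP: S0; rewrite -addr_eq0 -mulr2n -scaler_nat scaler_eq0.
by rewrite pnatr_eq0.
Qed.

(** The extra degeneracy commutes with the faces up to a shift of the index,
    except for the face that omits the repeated vertex, which undoes it. *)
Lemma pchain_homotopy n x : pchain_d n.+1 (pchain_h n.+1 x) = x - pchain_h n (pchain_d n x).
Proof.
have lin : linear (fun x => x - pchain_h n (pchain_d n x)).
  by move=> a u v; rewrite (linearP (pchain_d n)) (linearP (pchain_h n)) scalerBr opprD addrACA.
pose g := HB.pack (fun x => x - pchain_h n (pchain_d n x))
  (GRing.isLinear.Build _ _ _ _ _ lin) : {linear chains n.+1 -> chains n.+1}.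
apply: (free_lin_ext (f := pchain_d n.+1 \o pchain_h n.+1) (g := g)) => F /=.
rewrite pchain_hE !pchain_dE big_ord_recl pface0_cone expr0 scale1r; congr (_ + _).
rewrite (linear_sum (pchain_h n)) -sumrN; apply: eq_bigr => i _.
by rewrite linearZ /= pchain_hE pfaceS_cone exprS mulN1r scaleNr.
Qed.

Definition pchain_eps : {linear chains 0 -> K^o} := free_lift (fun=> 1 : K^o).

Lemma pchain_epsE F : pchain_eps (free_gen K F) = 1.
Proof. exact: free_lift_gen. Qed.

Lemma pchain_eps_d x : pchain_eps (pchain_d 0 x) = 0.
Proof.
apply: (free_lin_ext (f := pchain_eps \o pchain_d 0) (g := \0)) => F /=.
rewrite pchain_dE !big_ord_recl big_ord0 /= addr0 linearD !linearZ /= !pchain_epsE.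
by rewrite expr0 expr1 scale1r scaleN1r subrr.
Qed.

Lemma pchain_homotopy0 x :
  pchain_d 0 (pchain_h 0 x) = x - pchain_eps x *: free_gen K (base_point b).
Proof.
have lin : linear (fun x => x - pchain_eps x *: free_gen K (base_point b)).
  by move=> a u v; rewrite (linearP pchain_eps) scalerDl scalerBr opprD addrACA -scalerA.
pose g := HB.pack (fun x => x - pchain_eps x *: free_gen K (base_point b))
  (GRing.isLinear.Build _ _ _ _ _ lin) : {linear chains 0 -> chains 0}.
apply: (free_lin_ext (f := pchain_d 0 \o pchain_h 0) (g := g)) => F /=.
rewrite pchain_hE pchain_dE !big_ord_recl big_ord0 pface0_cone pface1_cone /= pchain_epsE.
by rewrite expr0 expr1 addr0 !scale1r scaleN1r.
Qed.

End PointedComplex.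

(** * Normalized quotients of the contractible complexes *)

(** The classes of the simplices over [md_base] are the elements of a basis of
    the normalized chains; degenerate simplices have no class.  The conditions
    ensure that the subspace spanned by the degenerate simplices and by the
    differences of simplices of the same class is stable under the boundary and
    under the contraction. *)
Record model (B : nat -> choiceType) := Model {
  md_cat : category;
  md_base : md_cat;
  md_class : forall n, pointed md_base n -> option (B n);
  md_class_surj : forall n (e : B n), exists F, md_class F = Some e;
  md_class_face : forall n (F F' : pointed md_base n.+1) e i,
    md_class F = Some e -> md_class F' = Some e ->
    md_class (pface i F) = md_class (pface i F');
  md_class_cone : forall n (F F' : pointed md_base n) e,
    md_class F = Some e -> md_class F' = Some e -> md_class (cone F) = md_class (cone F');
  md_degenerate_face : forall n (F : pointed md_base n.+1), md_class F = None ->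
    exists2 k : 'I_n.+1,
      md_class (pface (widen_ord (leqnSn _) k) F) = md_class (pface (lift ord0 k) F) &
      forall i, i != widen_ord (leqnSn _) k -> i != lift ord0 k ->
        md_class (pface i F) = None;
  md_degenerate_cone : forall n (F : pointed md_base n),
    md_class F = None -> md_class (cone F) = None;
  md_vertex : forall F : pointed md_base 0, md_class F <> None }.

Section Normalized.
Variables (K : numFieldType) (B : nat -> choiceType) (M : model B).
Local Notation pointed := (pointed (md_base M)).
Local Notation chains n := (free_module K (pointed n)).
Local Notation nchains n := (free_module K (B n)).

Definition class_chain n (F : pointed n) : nchains n :=
  if md_class F is Some e then free_gen K e else 0.

Definition normalize n : {linear chains n -> nchains n} := free_lift (@class_chain n).

Lemma normalizeE n (F : pointed n) : normalize n (free_gen K F) = class_chain F.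
Proof. exact: free_lift_gen. Qed.

Definition md_lift n (e : B n) : pointed n := projT1 (cid (@md_class_surj B M n e)).

Lemma md_liftK n (e : B n) : md_class (md_lift e) = Some e.
Proof. exact: projT2 (cid (@md_class_surj B M n e)). Qed.

Definition nlift n : {linear nchains n -> chains n} :=
  free_lift (fun e => free_gen K (md_lift e)).

Lemma nliftE n (e : B n) : nlift n (free_gen K e) = free_gen K (md_lift e).
Proof. exact: free_lift_gen. Qed.

Lemma nliftK n x : normalize n (nlift n x) = x.
Proof.
apply: (free_lin_ext (f := normalize n \o nlift n) (g := idfun)) => e /=.
by rewrite nliftE normalizeE /class_chain md_liftK.
Qed.

Definition nchain_d n : {linear nchains n.+1 -> nchains n} :=
  normalize n \o (pchain_d K (md_base M) n \o nlift n.+1).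

Definition nchain_h n : {linear nchains n -> nchains n.+1} :=
  normalize n.+1 \o (pchain_h K (md_base M) n \o nlift n).

Definition nchain_eps : {linear nchains 0 -> K^o} := free_lift (fun=> 1 : K^o).

Lemma normalize_pchain_dE n (F : pointed n.+1) :
  normalize n (pchain_d K _ n (free_gen K F)) = \sum_(i < n.+2) (-1) ^+ i *: class_chain (pface i F).
Proof.
rewrite pchain_dE linear_sum; apply: eq_bigr => i _.
by rewrite linearZ /= normalizeE.
Qed.

Lemma nchain_dE n (e : B n.+1) :
  nchain_d n (free_gen K e) = \sum_(i < n.+2) (-1) ^+ i *: class_chain (pface i (md_lift e)).
Proof.
transitivity (normalize n (pchain_d K _ n (nlift n.+1 (free_gen K e)))); first by [].
by rewrite nliftE normalize_pchain_dE.
Qed.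

Lemma nchain_hE n (e : B n) : nchain_h n (free_gen K e) = class_chain (cone (md_lift e)).
Proof.
transitivity (normalize n.+1 (pchain_h K _ n (nlift n (free_gen K e)))); first by [].
by rewrite nliftE pchain_hE normalizeE.
Qed.

(** The boundary does not depend on the chosen representatives.  A degenerate
    simplex has boundary zero modulo degenerate ones: the two faces at its
    degenerate step have the same class and opposite signs. *)
Lemma nchain_d_normalize n x :
  nchain_d n (normalize n.+1 x) = normalize n (pchain_d K _ n x).
Proof.
apply: (free_lin_ext (f := nchain_d n \o normalize n.+1)
  (g := normalize n \o pchain_d K _ n)) => F.
change (nchain_d n (normalize n.+1 (free_gen K F)) = normalize n (pchain_d K _ n (free_gen K F))).
rewrite normalizeE {1}/class_chain normalize_pchain_dE.
case eF : (md_class F) => [e|].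
  rewrite nchain_dE; apply: eq_bigr => i _; congr (_ *: _).
  by rewrite /class_chain (md_class_face i (md_liftK e) eF).
rewrite linear0; symmetry.
have [k ek e0] := md_degenerate_face eF.
have kk : lift ord0 k != widen_ord (leqnSn _) k by rewrite -val_eqE /= /bump /=; lia.
rewrite (bigD1 (widen_ord (leqnSn _) k)) //= (bigD1 (lift ord0 k)) //=.
rewrite big1 ?addr0 => [|i /andP[i1 i2]]; last first.
  by rewrite /class_chain e0 // scaler0.
rewrite /class_chain ek -scalerDl /= /bump /= exprD expr1 mulN1r subrr.
by rewrite scale0r.
Qed.

Lemma nchain_h_normalize n x :
  nchain_h n (normalize n x) = normalize n.+1 (pchain_h K _ n x).
Proof.
apply: (free_lin_ext (f := nchain_h n \o normalize n)
  (g := normalize n.+1 \o pchain_h K _ n)) => F.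
change (nchain_h n (normalize n (free_gen K F)) = normalize n.+1 (pchain_h K _ n (free_gen K F))).
rewrite normalizeE {1}/class_chain pchain_hE normalizeE.
case eF : (md_class F) => [e|].
  by rewrite nchain_hE /class_chain (md_class_cone (md_liftK e) eF).
by rewrite linear0 /class_chain md_degenerate_cone.
Qed.

Lemma nchain_eps_normalize x : nchain_eps (normalize 0 x) = pchain_eps K _ x.
Proof.
apply: (free_lin_ext (f := nchain_eps \o normalize 0) (g := pchain_eps K _)) => F /=.
rewrite normalizeE pchain_epsE /class_chain.
case eF : (md_class F) => [e|]; first exact: free_lift_gen.
by case: (md_vertex eF).
Qed.

(** Since normalization is surjective and commutes with the contraction, the
    contracting homotopy passes to the quotient. *)
Lemma nchain_exact n x : nchain_d n x = 0 <-> exists w, nchain_d n.+1 w = x.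
Proof.
split=> [dx|[w <-]].
  exists (nchain_h n.+1 x); rewrite -(nliftK x) nchain_h_normalize nchain_d_normalize.
  rewrite pchain_homotopy (linearB (normalize n.+1)) -nchain_h_normalize.
  rewrite -nchain_d_normalize nliftK dx.
  by rewrite linear0 subr0.
by rewrite -(nliftK w) !nchain_d_normalize pchain_dd linear0.
Qed.

Lemma nchain_exact0 x : nchain_eps x = 0 <-> exists w, nchain_d 0 w = x.
Proof.
split=> [dx|[w <-]].
  exists (nchain_h 0 x); rewrite -(nliftK x) nchain_h_normalize nchain_d_normalize.
  rewrite pchain_homotopy0 (linearB (normalize 0)) -nchain_eps_normalize nliftK dx.
  by rewrite scale0r linear0 subr0.
by rewrite -(nliftK w) nchain_d_normalize nchain_eps_normalize pchain_eps_d.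
Qed.

Lemma nchain_eps_surj c : exists x, nchain_eps x = c.
Proof.
exists (c *: normalize 0 (free_gen K (base_point (md_base M)))).
by rewrite linearZ /= nchain_eps_normalize pchain_epsE /GRing.scale /= mulr1.
Qed.

End Normalized.

(** A functor that moves the first vertex acts on chains after replacing the
    first arrow by its composite with an arrow from the new first vertex. *)
Section PointedMap.
Variables (D D' : category) (b : D) (b' : D') (A : functor D D') (a0 : mor b' (A b)).

Definition pmap_first n (F : pointed b n) : mor b' (functor_comp A F ord0) :=
  eq_rect b (fun z => mor b' (A z)) a0 _ (esym (pt_base F)).

Lemma arr_pmap_first n (F : pointed b n) : arr (pmap_first F) = arr a0.
Proof.
have gen z (e : b = z) : arr (eq_rect b (fun z => mor b' (A z)) a0 z e) = arr a0.
  by case: z / e.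
exact: gen.
Qed.

Let insert n (F : pointed b n) : functor (ordcat n.+2) D' := prepend (pmap_first F).

Fact pmap_subproof n (F : pointed b n) :
  functor_comp (insert F) (coface (lift ord0 ord0)) ord0 = b'.
Proof.
rewrite -[RHS](prepend0 (pmap_first F)) /=; congr (fob (insert F) _).
exact: val_inj.
Qed.
Definition pmap n (F : pointed b n) : pointed b' n := Pointed (pmap_subproof F).

Lemma pmap_face0 n (F : pointed b n) :
  functor_comp (pmap F) (coface ord0) = functor_comp A (functor_comp F (coface ord0)).
Proof.
rewrite functor_compA -(prepend_face0 (pmap_first F)) /= -!functor_compA.
congr functor_comp; apply: functor_ord_ext => k; apply: val_inj.
by rewrite /= /bump /=; lia.
Qed.

Lemma pmap_from n (F : pointed b n) (k : 'I_n.+1)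
    (h : @mor (ordcat n.+1) ord0 (lift ord0 k)) :
  arr (fmor (pmap F) h) = arr (mcomp (fmor A (fmor F h)) (pmap_first F)).
Proof.
have h' : @mor (ordcat n.+2) ord0 (lift ord0 (lift ord0 k)) by [].
rewrite -(prepend_from (pmap_first F) h' h).
apply: (fmor_irr (insert F) (fmor (coface (lift ord0 ord0)) h) h');
  by apply: val_inj; rewrite /= /bump /=; lia.
Qed.

Lemma pface_pmap n (F : pointed b n.+1) (i : 'I_n.+2) :
  pface i (pmap F) = pmap (pface i F).
Proof.
have facesC (G : functor (ordcat n.+2) D') :
    functor_comp (functor_comp G (coface (lift ord0 i))) (coface ord0) =
    functor_comp (functor_comp G (coface ord0)) (coface i).
  rewrite -!functor_compA; congr functor_comp.
  by apply: functor_ord_ext => k; apply: val_inj; rewrite /= /bump /=; lia.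
apply: pointedP; apply: (functor_eq_prepend (h := leq0n _)).
  rewrite (facesC (pmap F)) !pmap_face0 -!functor_compA; congr functor_comp; congr functor_comp.
  by apply: functor_ord_ext => k; apply: val_inj; rewrite /= /bump /=; lia.
rewrite pmap_from.
have h : @mor (ordcat n.+2) ord0 (lift ord0 (lift i ord0)) by [].
have e1 : lift (lift ord0 i) ord0 = ord0 by apply: val_inj; rewrite /= /bump /=; lia.
have e2 : lift (lift ord0 i) (lift ord0 ord0) = lift ord0 (lift i ord0) :> 'I_n.+3.
  by apply: val_inj; rewrite /= /bump /=; lia.
transitivity (arr (fmor (pmap F) h)).
  exact: (fmor_irr (pmap F) (fmor (coface (lift ord0 i)) (leq0n _ : @mor (ordcat n.+1) ord0 _)) h e1 e2).
rewrite pmap_from; apply: arr_comp_eq; last by rewrite !arr_pmap_first.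
apply: arr_fmor.
exact: (fmor_irr F h (fmor (coface (lift ord0 i)) (leq0n _ : @mor (ordcat n.+1) ord0 _)) (esym e1) (esym e2)).
Qed.

End PointedMap.

Section NormalizedMap.
Variables (K : numFieldType) (B B' : nat -> choiceType).
Variables (M : model B) (M' : model B').
Variable A : functor (md_cat M) (md_cat M').
Variable a0 : mor (md_base M') (A (md_base M)).
Variable a : forall n, B n -> B' n.

Hypothesis aE : forall n (F : pointed (md_base M) n),
  md_class (pmap a0 F) = omap (@a n) (md_class F).

Definition basis_map n : {linear free_module K (B n) -> free_module K (B' n)} :=
  free_lift (fun e => free_gen K (a e)).

Lemma basis_mapE n (e : B n) : basis_map n (free_gen K e) = free_gen K (a e).
Proof. exact: free_lift_gen. Qed.

Lemma basis_map_class n (F : pointed (md_base M) n) :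
  basis_map n (class_chain K F) = class_chain K (pmap a0 F).
Proof.
rewrite /class_chain aE; case: (md_class F) => [e|] /=; first exact: basis_mapE.
by rewrite linear0.
Qed.

(** Boundaries can be computed from any representatives of the classes, in
    particular from the images of those chosen in the source. *)
Lemma nchain_d_basis_map n x :
  nchain_d K M' n (basis_map n.+1 x) = basis_map n (nchain_d K M n x).
Proof.
apply: (free_lin_ext (f := nchain_d K M' n \o basis_map n.+1)
  (g := basis_map n \o nchain_d K M n)) => e /=.
have -> : free_gen K e = normalize K M n.+1 (free_gen K (md_lift M e)).
  by rewrite normalizeE /class_chain md_liftK.
rewrite [X in basis_map n X]nchain_d_normalize normalizeE basis_map_class.
rewrite -normalizeE [LHS]nchain_d_normalize !normalize_pchain_dE linear_sum.
apply: eq_bigr => i _; rewrite linearZ basis_map_class; congr (_ *: _).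
by rewrite pface_pmap.
Qed.

Lemma nchain_eps_basis_map x : nchain_eps K B' (basis_map 0 x) = nchain_eps K B x.
Proof.
apply: (free_lin_ext (f := nchain_eps K B' \o basis_map 0) (g := nchain_eps K B)) => e /=.
by rewrite basis_mapE /nchain_eps !free_lift_gen.
Qed.

End NormalizedMap.

(** * Free presheaves and their resolutions *)

(** This indexes a basis at [y] of the direct sum over [s] of the linearized
    representable presheaves of the objects [t s]. *)
Definition fbasis (J : category) (S : Type) (t : S -> J) (y : J) : Type :=
  {s : S & mor y (t s)}.
HB.instance Definition _ J S t y := gen_eqMixin (@fbasis J S t y).
HB.instance Definition _ J S t y := gen_choiceMixin (@fbasis J S t y).

Section FreePresheaf.
Variables (R : realType) (J : category) (S : Type) (t : S -> J).

Definition fbasis_act (x y : J) (f : mor x y) (e : fbasis t y) : fbasis t x :=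
  existT _ (projT1 e) (mcomp (projT2 e) f).

Definition free_ps_map (x y : J) (f : mor x y) :
    {linear free_module R[i] (fbasis t y) -> free_module R[i] (fbasis t x)} :=
  free_lift (fun e => free_gen R[i] (fbasis_act f e)).

Lemma free_ps_mapE (x y : J) (f : mor x y) e :
  free_ps_map f (free_gen R[i] e) = free_gen R[i] (fbasis_act f e).
Proof. exact: free_lift_gen. Qed.

Fact free_ps_map1 x v : free_ps_map (idm x) v = v.
Proof.
apply: (free_lin_ext (f := free_ps_map (idm x)) (g := idfun)) => -[s u].
by rewrite free_ps_mapE /fbasis_act /= mcomp_idr.
Qed.

Fact free_ps_mapM x y z (g : mor y z) (f : mor x y) v :
  free_ps_map (mcomp g f) v = free_ps_map f (free_ps_map g v).
Proof.
apply: (free_lin_ext (f := free_ps_map (mcomp g f)) (g := free_ps_map f \o free_ps_map g)) => -[s u].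
rewrite /= !free_ps_mapE /fbasis_act /=.
by rewrite compA.
Qed.

Definition free_presheaf : presheaf R J := Presheaf free_ps_map1 free_ps_mapM.

(** By Yoneda, a transformation out of a free presheaf amounts to a choice of
    values at the generators, and these values can be lifted one by one. *)
Lemma free_presheaf_projective : projective free_presheaf.
Proof.
move=> F G p f ep.
pose w s : F (t s) := projT1 (cid (ep (t s) (f (t s) (free_gen _ (existT _ s (idm (t s)) : fbasis t (t s)))))).
have wE s : p (t s) (w s) = f (t s) (free_gen _ (existT _ s (idm (t s)) : fbasis t (t s))).
  exact: projT2 (cid (ep _ _)).
pose h y : {linear free_presheaf y -> F y} :=
  free_lift (fun e : fbasis t y => ps_map F (projT2 e) (w (projT1 e))).
have hE y (e : fbasis t y) : h y (free_gen _ e) = ps_map F (projT2 e) (w (projT1 e)).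
  exact: free_lift_gen.
have hn x y (g : mor x y) v : h x (ps_map free_presheaf g v) = ps_map F g (h y v).
  apply: (free_lin_ext (f := h x \o free_ps_map g) (g := ps_map F g \o h y)) => e /=.
  by rewrite free_ps_mapE !hE ps_mapM.
exists (NatTrans hn) => x v.
apply: (free_lin_ext (f := p x \o h x) (g := f x)) => -[s u] /=.
rewrite hE /= nt_nat wE -nt_nat; congr (f x _).
by rewrite [LHS]free_ps_mapE /fbasis_act /= mcomp_idl.
Qed.

End FreePresheaf.

Section FreeResolution.
Variables (R : realType) (J : category) (S : nat -> Type) (t : forall n, S n -> J).
Variable M : forall y : J, model (fun n => fbasis (@t n) y).
Hypothesis M_nat : forall (x y : J) (a : mor x y),
  exists (A : functor (md_cat (M y)) (md_cat (M x))) (a0 : mor (md_base (M x)) (A (md_base (M y)))),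
    forall n (F : pointed (md_base (M y)) n),
      md_class (pmap a0 F) = omap (fbasis_act a) (md_class F).

Let P n := free_presheaf R (@t n).

Fact free_res_d_nat n x y (a : mor x y) (v : P n.+1 y) :
  nchain_d R[i] (M x) n (ps_map (P n.+1) a v) = ps_map (P n) a (nchain_d R[i] (M y) n v).
Proof. by have [A [hA AE]] := M_nat a; exact: (nchain_d_basis_map (AE)). Qed.

Definition free_res_d n : nat_trans (P n.+1) (P n) :=
  @NatTrans R J (P n.+1) (P n) (fun x => nchain_d R[i] (M x) n) (@free_res_d_nat n).

Fact free_res_aug_nat x y (a : mor x y) (v : P 0 y) :
  nchain_eps R[i] (fun n => fbasis (@t n) x) (ps_map (P 0) a v) =
  ps_map (const_presheaf R J) a (nchain_eps R[i] (fun n => fbasis (@t n) y) v).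
Proof.
exact: (@nchain_eps_basis_map R[i] _ _ (fun n => @fbasis_act J (S n) (@t n) x y a) v).
Qed.

Definition free_res_aug : nat_trans (P 0) (const_presheaf R J) :=
  @NatTrans R J (P 0) (const_presheaf R J)
    (fun x => nchain_eps R[i] (fun n => fbasis (@t n) x)) free_res_aug_nat.

Definition free_resolution : proj_resolution R J :=
  @ProjResolution R J P (fun n => @free_presheaf_projective R J (S n) (@t n))
    free_res_d free_res_aug
    (fun x => nchain_eps_surj (M x))
    (fun x => nchain_exact0 (M x))
    (fun n x => @nchain_exact _ _ (M x) n).

End FreeResolution.

(** * The two resolutions by nondegenerate chains *)

Definition nchain (I : category) (n : nat) : Type :=
  {s : functor (ordcat n) I | nondegenerate s}.

Lemma nchainP (I : category) n (s s' : nchain I n) : proj1_sig s = proj1_sig s' -> s = s'.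
Proof. by case: s s' => s hs [s' hs'] /= e; subst s'; congr exist; exact: Prop_irrelevance. Qed.

Section Degenerate.
Variable C : category.

Lemma nondegenerate0 (F : functor (ordcat 0) C) : nondegenerate F.
Proof. by move=> [[|i] // ?] [[|j] // ?]. Qed.

Lemma nondegenerate_tail n (F : functor (ordcat n.+1) C) :
  nondegenerate F -> nondegenerate (functor_comp F (coface ord0)).
Proof.
move=> nF i j ij eij; apply: (nF (lift ord0 i) (lift ord0 j)).
by rewrite /= /bump /= eij.
Qed.

(** Omitting a vertex not involved in an identity step keeps that step. *)
Lemma degenerate_face n (F : functor (ordcat n.+1) C) (k : 'I_n.+1) (i : 'I_n.+2) :
  collapsed F (widen_ord (leqnSn _) k) (lift ord0 k) ->
  i != widen_ord (leqnSn _) k -> i != lift ord0 k ->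
  ~ nondegenerate (functor_comp F (coface i)).
Proof.
move=> ck; rewrite -!val_eqE /= /bump /= => ik iSk nF.
have kn := ltn_ord k; have iN := ltn_ord i.
pose a := (if (i < k)%N then k.-1 else k)%N.
have aP : (a.+1 < n.+1)%N by rewrite /a; case: ifP; lia.
pose a' : 'I_n.+1 := Ordinal (ltnW aP); pose b' : 'I_n.+1 := Ordinal aP.
have ea : lift i a' = widen_ord (leqnSn _) k.
  by apply: val_inj; rewrite /= /bump /a; case: ifP; lia.
have eb : lift i b' = lift ord0 k.
  by apply: val_inj; rewrite /= /bump /a /=; case: ifP; lia.
have ab : @mor (ordcat n) a' b' by rewrite /= leqnSn.
have h : @mor (ordcat n.+1) (widen_ord (leqnSn _) k) (lift ord0 k) by rewrite /= /bump /=; lia.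
apply: (nF a' b' ab) => //; apply: is_identity_eq (proj1 (collapsedE F h) ck).
exact: (fmor_irr F h (fmor (coface i) ab) (esym ea) (esym eb)).
Qed.

Lemma collapsed_comp m n (Z : functor (ordcat n) C) (f : functor (ordcat m) (ordcat n))
    (i j : 'I_m.+1) : (i <= j)%N ->
  collapsed (functor_comp Z f) i j -> collapsed Z (f i) (f j).
Proof. by move=> ij /(collapsedE _ ij) /=; move: (fmor f _) => h /(collapsedE _ h). Qed.

Lemma lift_adjacent n (j k : 'I_n.+2) (i : 'I_n.+1) : val k = (val j).+1 ->
  lift j i = lift k i \/ (lift j i = k /\ lift k i = j).
Proof.
move=> /= jk; have [ij|ij] := eqVneq (val i) (val j); [right; split|left];
  by apply: val_inj; move: ij; rewrite /= /bump /=; lia.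
Qed.

Lemma collapsed_same m n (F : functor (ordcat n) C) (a b : functor (ordcat m) (ordcat n)) :
  a = b -> forall i, collapsed F (a i) (b i).
Proof. by move=> -> i; exact: collapsed_refl. Qed.

End Degenerate.

Section Subdivision.
Variable I : category.
Local Notation J := (opcat (Sd I)).

Definition sd_of_nchain n (s : nchain I n) : J := SdOb (proj2_sig s).

(** The relation that generates the identification of maps is pointwise
    collapsing, which is an equivalence relation. *)
Lemma sd_class_eqP (X Y : sd_ob I) (f g : sd_map X Y) :
  sd_class f = sd_class g <-> forall i, collapsed Y (f i) (g i).
Proof.
split=> [e|fg]; last first.
  by apply/eqP; rewrite /sd_class eqmodE; apply/asboolP; apply: rst_step.
have /asboolP : sd_equiv f g by rewrite -eqmodE; apply/eqP.
elim=> [a b ab i|a i|a b _ ab i|a b c _ ab _ bc i]; first exact: ab.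
- exact: collapsed_refl.
- exact: collapsed_sym.
- exact: collapsed_trans (ab i) (bc i).
Qed.

(** The chain that a map cuts out of [Z] depends only on the collapsing classes
    of the vertices; so these classes determine source and morphism together. *)
Lemma sd_chain_eqP n (Z : J) (s s' : nchain I n)
    (u : sd_map (sd_of_nchain s) Z) (u' : sd_map (sd_of_nchain s') Z) :
  existT (fun s => @mor J Z (sd_of_nchain s)) s (sd_class u) = existT _ s' (sd_class u') <->
  forall i : 'I_n.+1, collapsed Z (u i) (u' i).
Proof.
split=> [e|uu'].
  have ss' : s = s' := congr1 (@projT1 _ _) e; subst s'.
  exact: (proj1 (sd_class_eqP u u') (inj_pair2 _ _ _ _ _ e)).
have ss' : s = s'.
  apply: nchainP; rewrite -[LHS](sd_funE u) -[RHS](sd_funE u').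
  exact: collapsed_subchain.
by subst s'; congr existT; exact: (proj2 (sd_class_eqP u u') uu').
Qed.

Section Model.
Variable Z : J.
Local Notation D := (ordcat (sd_len Z)).
Local Notation simplex n := (@pointed D ord0 n).

Definition sd_tail n (F : simplex n) : functor (ordcat n) D := functor_comp F (coface ord0).

(** A simplex over [Z] is a weakly increasing sequence of vertices of [Z] after
    the vertex 0.  Its class is the chain that the sequence cuts out of [Z], provided
    this chain is nondegenerate, with the morphism that the sequence represents. *)
Definition sd_basis_elt n (F : simplex n)
    (h : nondegenerate (functor_comp Z (sd_tail F))) : fbasis (@sd_of_nchain n) Z :=
  existT _ (exist _ _ h) (sd_class (@SdMap I (SdOb h) Z (sd_tail F) erefl)).

Definition sd_simplex_class n (F : simplex n) : option (fbasis (@sd_of_nchain n) Z) :=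
  if pselect (nondegenerate (functor_comp Z (sd_tail F))) is left h
  then Some (sd_basis_elt h) else None.

Lemma sd_simplex_classE n (F : simplex n) (h : nondegenerate (functor_comp Z (sd_tail F))) :
  sd_simplex_class F = Some (sd_basis_elt h).
Proof.
rewrite /sd_simplex_class; case: pselect => // h'.
by rewrite (Prop_irrelevance h h').
Qed.

Lemma sd_simplex_class_None n (F : simplex n) :
  sd_simplex_class F = None <-> ~ nondegenerate (functor_comp Z (sd_tail F)).
Proof. by rewrite /sd_simplex_class; case: pselect. Qed.

Lemma sd_simplex_class_eq n (F F' : simplex n) :
  (forall i : 'I_n.+2, collapsed Z (F i) (F' i)) -> sd_simplex_class F = sd_simplex_class F'.
Proof.
move=> FF'; have tt i : collapsed Z (sd_tail F i) (sd_tail F' i) by exact: FF'.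
have e : functor_comp Z (sd_tail F) = functor_comp Z (sd_tail F') by exact: collapsed_subchain.
have [h|h] := pselect (nondegenerate (functor_comp Z (sd_tail F))); last first.
  by rewrite (sd_simplex_class_None F).2 // (sd_simplex_class_None F').2 // -e.
have h' : nondegenerate (functor_comp Z (sd_tail F')) by rewrite -e.
rewrite (sd_simplex_classE h) (sd_simplex_classE h'); congr Some.
exact/sd_chain_eqP.
Qed.

Lemma sd_simplex_class_inj n (F F' : simplex n) e :
  sd_simplex_class F = Some e -> sd_simplex_class F' = Some e ->
  forall i : 'I_n.+2, collapsed Z (F i) (F' i).
Proof.
have [h|/sd_simplex_class_None -> //] := pselect (nondegenerate (functor_comp Z (sd_tail F))).
have [h'|/sd_simplex_class_None -> //] := pselect (nondegenerate (functor_comp Z (sd_tail F'))).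
rewrite (sd_simplex_classE h) (sd_simplex_classE h') => <- /(@Some_inj _ _ _)/sd_chain_eqP tt i.
apply: collapsed_sym.
case: (unliftP ord0 i) => [j|] -> ; first exact: tt.
by rewrite !pt_base; exact: collapsed_refl.
Qed.

Fact sd_class_surj n (e : fbasis (@sd_of_nchain n) Z) : exists F, sd_simplex_class F = Some e.
Proof.
case: e => s u; rewrite -[u]sd_class_repr; move: (repr u) => {u} f.
pose u0 : @mor D ord0 (f ord0) := leq0n _.
pose F : simplex n := Pointed (prepend0 u0).
have Ff : sd_tail F = f by exact: prepend_face0.
have h : nondegenerate (functor_comp Z (sd_tail F)).
  by rewrite Ff (sd_funE f); exact: proj2_sig s.
exists F; rewrite (sd_simplex_classE h); congr Some; apply/sd_chain_eqP => i.
exact: (collapsed_same Z Ff i).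
Qed.

Fact sd_degenerate_face n (F : simplex n.+1) : sd_simplex_class F = None ->
  exists2 k : 'I_n.+1,
    sd_simplex_class (pface (widen_ord (leqnSn _) k) F) =
      sd_simplex_class (pface (lift ord0 k) F) &
    forall i, i != widen_ord (leqnSn _) k -> i != lift ord0 k ->
      sd_simplex_class (pface i F) = None.
Proof.
move=> /sd_simplex_class_None/degenerateP[k _ ck]; exists k => [|i i1 i2].
  apply: sd_simplex_class_eq => i /=.
  have kk : (widen_ord (leqnSn n.+1) k <= lift ord0 k)%N by rewrite /= /bump /=; lia.
  have /= ck' := collapsed_comp kk ck.
  by have [|->|[-> ->]] := @lift_adjacent _ (lift ord0 (widen_ord (leqnSn n.+1) k)) (lift ord0 (lift ord0 k)) i;
    [rewrite /= /bump /=; lia|exact: collapsed_refl|exact: collapsed_sym].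
apply/sd_simplex_class_None; move: (degenerate_face ck i1 i2).
congr (~ nondegenerate _); rewrite /sd_tail /= -!functor_compA; congr functor_comp; congr functor_comp.
by apply: functor_ord_ext => j; apply: val_inj; rewrite /= /bump /=; lia.
Qed.

Fact sd_degenerate_cone n (F : simplex n) :
  sd_simplex_class F = None -> sd_simplex_class (cone F) = None.
Proof.
move=> /sd_simplex_class_None h; apply/sd_simplex_class_None => /nondegenerate_tail h'.
apply: h; move: h'; congr (nondegenerate _); rewrite /sd_tail /= -!functor_compA; congr functor_comp.
congr functor_comp.
by apply: functor_ord_ext => j; apply: val_inj; rewrite /= /bump /=; lia.
Qed.

Fact sd_class_face n (F F' : simplex n.+1) e i :
  sd_simplex_class F = Some e -> sd_simplex_class F' = Some e ->
  sd_simplex_class (pface i F) = sd_simplex_class (pface i F').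
Proof.
move=> h h'; apply: sd_simplex_class_eq => j.
exact: (sd_simplex_class_inj h h' (coface (lift ord0 i) j)).
Qed.

Fact sd_class_cone n (F F' : simplex n) e :
  sd_simplex_class F = Some e -> sd_simplex_class F' = Some e ->
  sd_simplex_class (cone F) = sd_simplex_class (cone F').
Proof.
move=> h h'; apply: sd_simplex_class_eq => j.
exact: (sd_simplex_class_inj h h' (codegen0 n.+1 j)).
Qed.

Definition sd_model : model (fun n => fbasis (@sd_of_nchain n) Z) :=
  @Model (fun n => fbasis (@sd_of_nchain n) Z) D ord0 sd_simplex_class sd_class_surj
    sd_class_face sd_class_cone
    sd_degenerate_face sd_degenerate_cone
    (fun F h => (sd_simplex_class_None F).1 h (@nondegenerate0 _ _)).

End Model.

Fact sd_model_natural (X Y : J) (a : mor X Y) :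
  exists (A : functor (md_cat (sd_model Y)) (md_cat (sd_model X)))
         (a0 : mor (md_base (sd_model X)) (A (md_base (sd_model Y)))),
    forall n (F : pointed (md_base (sd_model Y)) n),
      md_class (pmap a0 F) = omap (fbasis_act a) (md_class F).
Proof.
pose f : sd_map Y X := repr (a : sd_hom Y X).
exists (sd_fun f), (leq0n _ : @mor (ordcat (sd_len X)) ord0 _) => n F /=.
set G := pmap _ F; have tG : sd_tail G = functor_comp f (sd_tail F) by exact: pmap_face0.
have e : functor_comp X (sd_tail G) = functor_comp Y (sd_tail F).
  by rewrite tG functor_compA (sd_funE f).
have [h|h] := pselect (nondegenerate (functor_comp Y (sd_tail F))); last first.
  by rewrite (sd_simplex_class_None F).2 // (sd_simplex_class_None G).2 // e.
have h' : nondegenerate (functor_comp X (sd_tail G)) by rewrite e.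
rewrite (sd_simplex_classE h) (sd_simplex_classE h') /=; congr Some.
rewrite /fbasis_act /= -[a](@sd_class_repr I Y X) -/f.
rewrite sd_compE; apply/sd_chain_eqP => i.
exact: (collapsed_same X tG i).
Qed.

End Subdivision.

Section Bar.
Variable I : category.

Definition source_of_nchain n (s : nchain I n) : I := proj1_sig s ord0.

Section Model.
Variable y : I.
Local Notation simplex n := (@pointed I y n).

Definition bar_tail n (F : simplex n) : functor (ordcat n) I := functor_comp F (coface ord0).

Definition bar_first n (F : simplex n) : mor y (bar_tail F ord0) :=
  eq_rect (F ord0) (fun z => mor z _)
    (fmor F (leq0n _ : @mor (ordcat n.+1) ord0 (lift ord0 ord0))) y (pt_base F).

Lemma arr_bar_first n (F : simplex n) (h : @mor (ordcat n.+1) ord0 (lift ord0 ord0)) :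
  arr (bar_first F) = arr (fmor F h).
Proof.
have gen z (e : F ord0 = z) (u : mor (F ord0) (bar_tail F ord0)) :
    arr (eq_rect (F ord0) (fun z => mor z (bar_tail F ord0)) u z e) = arr u.
  by case: z / e.
by rewrite /bar_first (bool_irrelevance (leq0n _) h); exact: gen.
Qed.

(** The simplices over [y] are the chains that start at [y]; separating the first
    arrow from the others gives the usual basis of the normalized bar
    resolution, in which only the other arrows must not be identities. *)
Definition bar_basis_elt n (F : simplex n) (h : nondegenerate (bar_tail F)) :
    fbasis (@source_of_nchain n) y :=
  existT _ (exist _ _ h) (bar_first F).

Definition bar_class n (F : simplex n) : option (fbasis (@source_of_nchain n) y) :=
  if pselect (nondegenerate (bar_tail F)) is left h then Some (bar_basis_elt h) else None.

Lemma bar_classE n (F : simplex n) (h : nondegenerate (bar_tail F)) :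
  bar_class F = Some (bar_basis_elt h).
Proof.
by rewrite /bar_class; case: pselect => // h'; rewrite (Prop_irrelevance h h').
Qed.

Lemma bar_class_None n (F : simplex n) : bar_class F = None <-> ~ nondegenerate (bar_tail F).
Proof. by rewrite /bar_class; case: pselect. Qed.

Lemma bar_basisP n (s s' : nchain I n) (u : mor y (source_of_nchain s))
    (u' : mor y (source_of_nchain s')) :
  existT (fun s => mor y (source_of_nchain s)) s u = existT _ s' u' <->
  proj1_sig s = proj1_sig s' /\ arr u = arr u'.
Proof.
split=> [e|[/nchainP ss' uu']].
  have ss' : s = s' := congr1 (@projT1 _ _) e; subst s'.
  by rewrite (inj_pair2 _ _ _ _ _ e).
by subst s'; rewrite (arr_inj uu').
Qed.

Lemma bar_class_inj n (F F' : simplex n) e :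
  bar_class F = Some e -> bar_class F' = Some e -> F = F'.
Proof.
have [h|/bar_class_None -> //] := pselect (nondegenerate (bar_tail F)).
have [h'|/bar_class_None -> //] := pselect (nondegenerate (bar_tail F')).
rewrite (bar_classE h) (bar_classE h') => <- /(@Some_inj _ _ _)/esym/bar_basisP[/= tt ff].
apply: pointedP; apply: (functor_eq_prepend (h := leq0n _)) => //.
by rewrite -!arr_bar_first.
Qed.

Fact bar_class_surj n (e : fbasis (@source_of_nchain n) y) : exists F, bar_class F = Some e.
Proof.
case: e => s u; pose F : simplex n := Pointed (prepend0 u).
have Fs : bar_tail F = proj1_sig s by exact: prepend_face0.
have h : nondegenerate (bar_tail F) by rewrite Fs; exact: proj2_sig s.
exists F; rewrite (bar_classE h); congr Some; apply/bar_basisP; split=> //.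
by rewrite (arr_bar_first _ (leq0n _)); exact: prepend_first.
Qed.

Fact bar_degenerate_face n (F : simplex n.+1) : bar_class F = None ->
  exists2 k : 'I_n.+1,
    bar_class (pface (widen_ord (leqnSn _) k) F) = bar_class (pface (lift ord0 k) F) &
    forall i, i != widen_ord (leqnSn _) k -> i != lift ord0 k -> bar_class (pface i F) = None.
Proof.
move=> /bar_class_None/degenerateP[k _ ck]; exists k => [|i i1 i2].
  congr bar_class; apply: pointedP => /=; apply: collapsed_subchain => i /=.
  have kk : (widen_ord (leqnSn n.+1) k <= lift ord0 k)%N by rewrite /= /bump /=; lia.
  have /= ck' := collapsed_comp kk ck.
  by have [|->|[-> ->]] := @lift_adjacent _ (lift ord0 (widen_ord (leqnSn n.+1) k)) (lift ord0 (lift ord0 k)) i;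
    [rewrite /= /bump /=; lia|exact: collapsed_refl|exact: collapsed_sym].
apply/bar_class_None; move: (degenerate_face ck i1 i2).
congr (~ nondegenerate _); rewrite /bar_tail /= -!functor_compA; congr functor_comp.
by apply: functor_ord_ext => j; apply: val_inj; rewrite /= /bump /=; lia.
Qed.

Fact bar_degenerate_cone n (F : simplex n) : bar_class F = None -> bar_class (cone F) = None.
Proof.
move=> /bar_class_None h; apply/bar_class_None => /nondegenerate_tail h'.
apply: h; move: h'; congr (nondegenerate _); rewrite /bar_tail /= -!functor_compA; congr functor_comp.
by apply: functor_ord_ext => j; apply: val_inj; rewrite /= /bump /=; lia.
Qed.

Definition bar_model : model (fun n => fbasis (@source_of_nchain n) y) :=
  @Model (fun n => fbasis (@source_of_nchain n) y) I y bar_class bar_class_surj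
    (fun n F F' e i h h' => congr1 (fun F => bar_class (pface i F)) (bar_class_inj h h'))
    (fun n F F' e h h' => congr1 (fun F => bar_class (cone F)) (bar_class_inj h h'))
    bar_degenerate_face bar_degenerate_cone
    (fun F h => (bar_class_None F).1 h (@nondegenerate0 _ _)).

End Model.

Fact bar_model_natural (x y : I) (a : mor x y) :
  exists (A : functor (md_cat (bar_model y)) (md_cat (bar_model x)))
         (a0 : mor (md_base (bar_model x)) (A (md_base (bar_model y)))),
    forall n (F : pointed (md_base (bar_model y)) n),
      md_class (pmap a0 F) = omap (fbasis_act a) (md_class F).
Proof.
exists (functor_id I), a => n F /=.
set G := pmap _ F; have e : bar_tail G = bar_tail F.
  by rewrite -[RHS]functor_compl1; exact: pmap_face0.
have [h|h] := pselect (nondegenerate (bar_tail F)); last first.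
  by rewrite (bar_class_None F).2 // (bar_class_None G).2 // e.
have h' : nondegenerate (bar_tail G) by rewrite e.
rewrite (bar_classE h) (bar_classE h') /=; congr Some; apply/bar_basisP; split=> //=.
rewrite (arr_bar_first _ (leq0n _)) pmap_from; apply: arr_comp_eq; last exact: (@arr_pmap_first I I y x (functor_id I) a n F).
by symmetry; exact: arr_bar_first.
Qed.

End Bar.

Definition sd_resolution (R : realType) (I : category) : proj_resolution R (opcat (Sd I)) :=
  free_resolution R (@sd_model_natural I).

Definition bar_resolution (R : realType) (I : category) : proj_resolution R I :=
  free_resolution R (@bar_model_natural I).

(** * Independence of the projective resolution *)

Section Kernel.
Variables (A : pzRingType) (V W : lmodType A) (f : {linear V -> W}).

Definition ker_pred : {pred V} := [pred v | f v == 0].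
Fact ker_pred_closed : GRing.subsemimod_closed ker_pred.
Proof. exact/GRing.submod_closed_semi/lin_ker_closed. Qed.
HB.instance Definition _ := GRing.isSubmodClosed.Build A V ker_pred ker_pred_closed.

Record ker := Ker { ker_val :> V; kerP : ker_val \in ker_pred }.
HB.instance Definition _ := [isSub for ker_val].
HB.instance Definition _ := [Choice of ker by <:].
HB.instance Definition _ := [SubChoice_isSubLmodule of ker by <:].
End Kernel.

Section CoRestriction.
Variables (A : pzRingType) (U V W : lmodType A) (f : {linear V -> W}) (g : {linear U -> V}).
Hypothesis gf0 : forall u, f (g u) = 0.

Fact ker_lift_subproof u : g u \in ker_pred f.
Proof. by rewrite inE gf0. Qed.
Definition ker_lift (u : U) : ker f := Ker (ker_lift_subproof u).
Fact ker_lift_linear : linear ker_lift.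
Proof. by move=> a u v; apply: val_inj; rewrite /= linearP. Qed.
HB.instance Definition _ := GRing.isLinear.Build A U (ker f) *:%R ker_lift ker_lift_linear.
End CoRestriction.

Section Comparison.
Variables (R : realType) (J : category).

Section NatTrans.
Variables F G H : presheaf R J.

Fact nt_comp_subproof (q : nat_trans G H) (p : nat_trans F G) x y (f : mor x y) v :
  (q x \o p x) (ps_map F f v) = ps_map H f ((q y \o p y) v).
Proof. by rewrite /= !nt_nat. Qed.
Definition nt_comp (q : nat_trans G H) (p : nat_trans F G) : nat_trans F H :=
  @NatTrans R J F H (fun x => q x \o p x) (nt_comp_subproof q p).

Fact nt_sub_subproof (p q : nat_trans F G) x y (f : mor x y) v :
  (p x \- q x) (ps_map F f v) = ps_map G f ((p y \- q y) v).
Proof. by rewrite /= !nt_nat linearB. Qed.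
Definition nt_sub (p q : nat_trans F G) : nat_trans F G :=
  @NatTrans R J F G (fun x => p x \- q x) (nt_sub_subproof p q).
End NatTrans.

Definition nt_id (F : presheaf R J) : nat_trans F F :=
  @NatTrans R J F F (fun=> idfun) (fun _ _ _ _ => erefl).

Section KernelPresheaf.
Variables (G H : presheaf R J) (e : nat_trans G H).

Fact ker_ps_subproof x y (f : mor x y) (v : ker (e y)) : e x ((ps_map G f \o val) v) = 0.
Proof. by rewrite /= nt_nat (eqP (kerP v)) linear0. Qed.

Definition ker_ps_map x y (f : mor x y) : {linear ker (e y) -> ker (e x)} :=
  ker_lift (ker_ps_subproof f).

Definition kernel_presheaf : presheaf R J.
Proof.
refine (@Presheaf R J (fun x => ker (e x)) ker_ps_map _ _).
- by move=> x v; apply: val_inj; rewrite /= ps_map1.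
- by move=> x y z g f v; apply: val_inj; rewrite /= ps_mapM.
Defined.

(** Exactness at [G] makes [F] map onto the kernel of [e], through which [a]
    factors. *)
Lemma projective_lift (P F : presheaf R J) (d : nat_trans F G) (a : nat_trans P G) :
  projective P -> (forall x v, e x v = 0 <-> exists w, d x w = v) ->
  (forall x v, e x (a x v) = 0) ->
  exists b : nat_trans P F, forall x v, d x (b x v) = a x v.
Proof.
move=> projP exact_d ea.
have ed x w : e x (d x w) = 0 by apply/exact_d; exists w.
have dn x y (f : mor x y) v : ker_lift (ed x) (ps_map F f v) = ker_ps_map f (ker_lift (ed y) v).
  by apply: val_inj; rewrite /= nt_nat.
have an x y (f : mor x y) v : ker_lift (ea x) (ps_map P f v) = ker_ps_map f (ker_lift (ea y) v).
  by apply: val_inj; rewrite /= nt_nat.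
pose d' := @NatTrans R J F kernel_presheaf (fun x => ker_lift (ed x)) dn.
pose a' := @NatTrans R J P kernel_presheaf (fun x => ker_lift (ea x)) an.
have [|b bP] := projP _ _ d' a'.
  move=> x w; have [v vw] := (exact_d x (val w)).1 (eqP (kerP w)).
  by exists v; apply: val_inj.
by exists b => x v; have /(congr1 val) := bP x v.
Qed.

End KernelPresheaf.

Implicit Types P Q : proj_resolution R J.

(** Continuing the boundary by the augmentation lets degree 0 be treated like
    the others. *)
Definition res_prev P n : presheaf R J := if n is m.+1 then P m else const_presheaf R J.

Definition res_bound P n : nat_trans (P n) (res_prev P n) :=
  if n is m.+1 return nat_trans (P n) (res_prev P n) then res_d P m else res_aug P.

Lemma res_boundE P n x v : res_bound P n x v = 0 <-> exists w, res_d P n x w = v.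
Proof. by case: n v => [|n] v; [exact: res_exact0|exact: res_exact]. Qed.

Lemma res_bound_d P n x w : res_bound P n x (res_d P n x w) = 0.
Proof. by apply/res_boundE; exists w. Qed.

Lemma res_d_d P n x w : res_d P n x (res_d P n.+1 x w) = 0.
Proof. by apply/res_exact; exists w. Qed.

Lemma comparison_map P Q : exists f : forall n, nat_trans (P n) (Q n),
  (forall x v, res_aug Q x (f 0%N x v) = res_aug P x v) /\
  (forall n x v, res_d Q n x (f n.+1 x v) = f n x (res_d P n x v)).
Proof.
pose cyc n (f : nat_trans (P n) (Q n)) :=
  forall x v, res_bound Q n x (f x (res_d P n x v)) = 0.
have [f0 f0P] := @res_proj R J P 0%N (Q 0%N) _ (res_aug Q) (res_aug P) (@res_aug_epi R J Q).
have cyc0 : cyc 0%N f0 by move=> x v; rewrite /= f0P; exact: res_bound_d P 0%N _ _.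
have step n (u : {f | cyc n f}) : exists u' : {f | cyc n.+1 f},
    forall x v, res_d Q n x (proj1_sig u' x v) = proj1_sig u x (res_d P n x v).
  case: u => f cf; have [g gP] := projective_lift (a := nt_comp f (res_d P n))
    (@res_proj _ _ P n.+1) (@res_boundE Q n) cf.
  suff cg : cyc n.+1 g by exists (exist _ g cg).
  by move=> x v; rewrite /= gP /= res_d_d linear0.
pose fs := fix fs n : {f | cyc n f} :=
  if n is m.+1 return {f | cyc n f} then projT1 (cid (step m (fs m))) else exist _ f0 cyc0.
exists (fun n => proj1_sig (fs n)); split=> // n x v.
exact: (projT2 (cid (step n (fs n)))).
Qed.

Lemma comparison_homotopy P Q (f : forall n, nat_trans (P n) (Q n)) :
  (forall x v, res_aug Q x (f 0%N x v) = 0) ->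
  (forall n x v, res_d Q n x (f n.+1 x v) = f n x (res_d P n x v)) ->
  exists s : forall n, nat_trans (P n) (Q n.+1),
    (forall x v, res_d Q 0%N x (s 0%N x v) = f 0%N x v) /\
    (forall n x v, res_d Q n.+1 x (s n.+1 x v) = f n.+1 x v - s n x (res_d P n x v)).
Proof.
move=> f0 fd.
pose cyc n (s : nat_trans (P n) (Q n.+1)) :=
  forall x v, res_d Q n x (s x (res_d P n x v)) = f n x (res_d P n x v).
have [s0 s0P] := projective_lift (a := f 0%N) (@res_proj _ _ P 0%N) (@res_boundE Q 0%N) f0.
have cyc0 : cyc 0%N s0 by move=> x v; rewrite s0P.
have step n (u : {s | cyc n s}) : exists u' : {s | cyc n.+1 s}, forall x v,
    res_d Q n.+1 x (proj1_sig u' x v) = f n.+1 x v - proj1_sig u x (res_d P n x v).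
  case: u => s cs.
  have [|s' s'P] := projective_lift (a := nt_sub (f n.+1) (nt_comp s (res_d P n)))
    (@res_proj _ _ P n.+1) (@res_boundE Q n.+1).
    by move=> x v; rewrite /= linearB /= fd cs subrr.
  suff cs' : cyc n.+1 s' by exists (exist _ s' cs').
  by move=> x v; rewrite s'P /= res_d_d linear0 subr0.
pose ss := fix ss n : {s | cyc n s} :=
  if n is m.+1 return {s | cyc n s} then projT1 (cid (step m (ss m))) else exist _ s0 cyc0.
exists (fun n => proj1_sig (ss n)); split=> // n x v.
exact: (projT2 (cid (step n (ss n)))).
Qed.

End Comparison.

Section HomologyMap.
Variables (A : pzRingType) (K L : chain_complex A).
Variable f : forall n, {linear K n -> L n}.
Hypothesis f_d : forall n z, cc_d L n (f n.+1 z) = f n (cc_d K n z).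

Fact cycle_map_subproof p (z : cycles K p) : f p (val z) \in @cycle_pred A L p.
Proof.
case: z => z; case: p z => [|p] z //=; rewrite !inE => /eqP dz.
by rewrite f_d dz linear0.
Qed.
Definition cycle_map p (z : cycles K p) : cycles L p := Cycle (cycle_map_subproof z).
Fact cycle_map_linear p : linear (@cycle_map p).
Proof. by move=> a u v; apply: val_inj; rewrite /= linearP. Qed.
HB.instance Definition _ p := GRing.isLinear.Build A (cycles K p) (cycles L p) *:%R
  (@cycle_map p) (@cycle_map_linear p).

Fact homology_map_subproof p z : z \in @boundary_pred A K p -> @cycle_map p z \in @boundary_pred A L p.
Proof.
by move=> /asboolP[v vz]; apply/asboolP; exists (f p.+1 v); rewrite f_d vz.
Qed.
Definition homology_map p : {linear homology K p -> homology L p} :=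
  lquot_map (@homology_map_subproof p).

Hypothesis g : forall n, {linear L n -> K n}.
Hypothesis g_d : forall n z, cc_d K n (g n.+1 z) = g n (cc_d L n z).
Variable s : forall n, {linear K n -> K n.+1}.
Hypothesis s0 : forall z, g 0%N (f 0%N z) = z + cc_d K 0%N (s 0%N z).
Hypothesis sS : forall n z,
  g n.+1 (f n.+1 z) = z + (cc_d K n.+1 (s n.+1 z) + s n (cc_d K n z)).

(** A left inverse up to homotopy is enough for injectivity. *)
Lemma homology_map_inj p x : homology_map p x = 0 -> x = 0.
Proof.
rewrite -[x]lquot_reprK; move: (repr x) => {x} z.
rewrite [homology_map _ _]lquot_mapE => /eqP; rewrite lquot_eq0 => /asboolP[w wz].
apply/eqP; rewrite lquot_eq0; apply/asboolP; exists (g p.+1 w - s p (val z)).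
rewrite linearB g_d wz /=; case: z {wz}; case: p w => [|p] w z /= cz.
  by rewrite s0 addrK.
by move: cz; rewrite inE => /eqP dz; rewrite sS dz linear0 addr0 addrK.
Qed.

End HomologyMap.

Section Dimension.
Variables (R : realType) (G : groupType).
Implicit Types M : lmodType (vN R G)^c.

(** An injective map carries a finitely generated projective submodule to one
    that is the image of the same idempotent. *)
Lemma vN_dim_le M M' (f : {linear M -> M'}) : (forall v, f v = 0 -> v = 0) ->
  (vN_dim M <= vN_dim M')%E.
Proof.
move=> f_inj; apply: ereal_sup_le => _ [t [P [n [e [h [eP _ hP te]]]]] <-].
exists t => //; exists [set (f \o h) (v *m e) | v in [set: 'rV[(vN R G)^c]_n]].
exists n, e, (f \o h); split=> // v /= fh0; apply: hP.
exact: f_inj.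
Qed.

End Dimension.

Section SplitTensor.
Variables (R : realType) (J : category) (x : J).
Local Notation T F := (tensor (splitting x F)).

Definition split_tensor_mk (F : presheaf R J) (v : F x) : T F :=
  tensor_mk (lquot_class _ v : splitting x F).

Lemma tensor_mkD G (M : right_rep R G) (v w : M) : tensor_mk (v + w) = tensor_mk v + tensor_mk w.
Proof.
apply/eqP; rewrite -subr_eq0 -linearD -linearB lquot_eq0 opprD addrA.
by apply: submod_span_sub; left; exists v, w.
Qed.

Lemma split_tensor_mkD (F : presheaf R J) (v w : F x) :
  split_tensor_mk (v + w) = split_tensor_mk v + split_tensor_mk w.
Proof. by rewrite /split_tensor_mk linearD tensor_mkD. Qed.

Definition split_tensor_map (F F' : presheaf R J) (p : nat_trans F F') : {linear T F -> T F'} :=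
  tensor_map (splitting_map x p).

Lemma split_tensor_mapE (F F' : presheaf R J) (p : nat_trans F F') v :
  split_tensor_map p (split_tensor_mk v) = split_tensor_mk (p x v).
Proof.
rewrite [LHS]tensor_mapE; congr tensor_mk.
exact: lquot_mapE.
Qed.

Lemma split_tensor_ext (F : presheaf R J) (W : lmodType (vN R (aut x))^c) (f g : {linear T F -> W}) :
  (forall v, f (split_tensor_mk v) = g (split_tensor_mk v)) -> f =1 g.
Proof.
move=> fg; apply: tensor_lin_ext => v; rewrite -[v]lquot_reprK.
exact: fg.
Qed.

(** Comparison maps are homotopy equivalences, and the splitting functor and the
    tensor product preserve the homotopies because they are additive. *)
Lemma l2_betti_le (P Q : proj_resolution R J) p :
  (l2_betti (split_complex x P) p <= l2_betti (split_complex x Q) p)%E.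
Proof.
have [f [f0 fd]] := comparison_map P Q.
have [g [g0 gd]] := comparison_map Q P.
have [||s [s0 sS]] := @comparison_homotopy _ _ P P (fun n => nt_sub (nt_comp (g n) (f n)) (nt_id (P n))).
- by move=> y v; rewrite /= linearB /= g0 f0 subrr.
- by move=> n y v; rewrite /= linearB /= gd fd.
pose Tf n : {linear split_complex x P n -> split_complex x Q n} := split_tensor_map (f n).
pose Tg n : {linear split_complex x Q n -> split_complex x P n} := split_tensor_map (g n).
pose Ts n : {linear split_complex x P n -> split_complex x P n.+1} := split_tensor_map (s n).
have Td (X : proj_resolution R J) n : cc_d (split_complex x X) n =1 split_tensor_map (res_d X n) by [].
have Tfd n z : cc_d (split_complex x Q) n (Tf n.+1 z) = Tf n (cc_d (split_complex x P) n z).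
  apply: (split_tensor_ext (f := split_tensor_map (res_d Q n) \o split_tensor_map (f n.+1))
    (g := split_tensor_map (f n) \o split_tensor_map (res_d P n))) => v /=.
  by rewrite !split_tensor_mapE fd.
have Tgd n z : cc_d (split_complex x P) n (Tg n.+1 z) = Tg n (cc_d (split_complex x Q) n z).
  apply: (split_tensor_ext (f := split_tensor_map (res_d P n) \o split_tensor_map (g n.+1))
    (g := split_tensor_map (g n) \o split_tensor_map (res_d Q n))) => v /=.
  by rewrite !split_tensor_mapE gd.
apply: (vN_dim_le (f := homology_map Tfd p)).
apply: (@homology_map_inj _ (split_complex x P) (split_complex x Q) Tf Tfd Tg Tgd Ts).
- move=> z; apply: (split_tensor_ext (f := split_tensor_map (g 0%N) \o split_tensor_map (f 0%N))
    (g := idfun \+ (split_tensor_map (res_d P 0%N) \o split_tensor_map (s 0%N)))) => v /=.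
  by rewrite !split_tensor_mapE s0 /= -split_tensor_mkD addrC subrK.
- move=> n z; apply: (split_tensor_ext (f := split_tensor_map (g n.+1) \o split_tensor_map (f n.+1))
    (g := idfun \+ ((split_tensor_map (res_d P n.+1) \o split_tensor_map (s n.+1)) \+
      (split_tensor_map (s n) \o split_tensor_map (res_d P n))))) => v /=.
  by rewrite !split_tensor_mapE sS /= -!split_tensor_mkD subrK addrC subrK.
Qed.

Lemma l2_betti_eq (P Q : proj_resolution R J) p :
  l2_betti (split_complex x P) p = l2_betti (split_complex x Q) p.
Proof. by apply/eqP; rewrite eq_le !l2_betti_le. Qed.

End SplitTensor.

(** * Dimensions over a trivial group *)

Definition fin_dim (K : fieldType) (V : lmodType K) (n : nat) : Prop :=
  exists (f : {linear 'rV[K]_n -> V}) (g : {linear V -> 'rV[K]_n}), cancel f g /\ cancel g f.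

Lemma fin_dim_bij (K : fieldType) (V : lmodType K) n (f : {linear 'rV[K]_n -> V}) :
  (forall v, f v = 0 -> v = 0) -> (forall w, exists v, f v = w) -> fin_dim V n.
Proof.
move=> f0 fs; have f_inj : injective f.
  by move=> u v /eqP; rewrite -subr_eq0 -linearB => /eqP/f0/eqP; rewrite subr_eq0 => /eqP.
pose g w := projT1 (cid (fs w)); have gK : cancel g f by move=> w; exact: projT2 (cid (fs w)).
have lg : linear g by move=> a u v; apply: f_inj; rewrite linearP !gK.
pose g' := HB.pack g (GRing.isLinear.Build _ _ _ _ g lg) : {linear V -> 'rV[K]_n}.
by exists f, g'; split=> // v; apply: f_inj; rewrite /= gK.
Qed.

(** In a rank factorization of an idempotent the two factors, multiplied in the
    other order, give the identity of size the rank. *)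
Lemma mxtrace_idempotent (K : fieldType) m (E : 'M[K]_m) :
  E *m E = E -> \tr E = (\rank E)%:R.
Proof.
move=> EE; have e : row_base E *m col_base E = 1%:M.
  apply: (row_free_inj (row_base_free E)); apply: (row_full_inj (col_base_full E)).
  by rewrite mul1mx -mulmxA !mulmx_base mulmxA mulmx_base EE.
by rewrite -[E in LHS]mulmx_base mxtrace_mulC e mxtrace1.
Qed.

Section TrivialGroup.
Variables (R : realType) (G : groupType).
Local Notation C := R[i].
Local Notation N := (vN R G)^c.

Definition vN_scalar (c : C) : N := (c *: (1 : vN R G) : vN R G).

Lemma vN_scalarD a b : vN_scalar (a + b) = vN_scalar a + vN_scalar b.
Proof. by rewrite /vN_scalar scalerDl. Qed.

Lemma vN_scalarM a b : vN_scalar (a * b) = vN_scalar a * vN_scalar b.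
Proof.
apply: val_inj; apply/funext => f; apply: val_inj; apply/funext => g.
have E : (a * b) * (f g : C) = b * (a * (f g : C)) by rewrite mulrCA mulrA.
exact: E.
Qed.

Lemma vN_scalar1 : vN_scalar 1 = 1.
Proof. by rewrite /vN_scalar scale1r. Qed.

Lemma vN_trD (S T : N) : vN_tr (S + T) = vN_tr S + vN_tr T.
Proof. by []. Qed.

Lemma vN_tr0 : vN_tr (0 : N) = 0.
Proof. by []. Qed.

Lemma vN_tr_sum (I : Type) (r : seq I) (P : pred I) (F : I -> N) :
  vN_tr (\sum_(i <- r | P i) F i) = \sum_(i <- r | P i) vN_tr (F i).
Proof. exact: (big_morph _ vN_trD vN_tr0). Qed.

Lemma vN_scalarK c : vN_tr (vN_scalar c) = c.
Proof.
have E : c * (1%g == 1%g :> G)%:R = c by rewrite eqxx mulr1.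
exact: E.
Qed.

(** Restriction of scalars along the constants. *)
Definition restr (M : lmodType N) : Type := M.
HB.instance Definition _ M := GRing.Zmodule.on (restr M).

Section Restr.
Variable M : lmodType N.
Definition restr_scale (c : C) (v : restr M) : restr M := vN_scalar c *: (v : M).
Fact restr_scaleA a b v : restr_scale a (restr_scale b v) = restr_scale (a * b) v.
Proof. by rewrite /restr_scale vN_scalarM scalerA. Qed.
Fact restr_scale1 : left_id 1 restr_scale.
Proof. by move=> v; rewrite /restr_scale vN_scalar1 scale1r. Qed.
Fact restr_scaleDr : right_distributive restr_scale +%R.
Proof. by move=> a u v; rewrite /restr_scale scalerDr. Qed.
Fact restr_scaleDl v : {morph restr_scale^~ v : a b / a + b}.
Proof. by move=> a b; rewrite /restr_scale vN_scalarD scalerDl. Qed.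
HB.instance Definition _ := GRing.Zmodule_isLmodule.Build C (restr M)
  restr_scaleA restr_scale1 restr_scaleDr restr_scaleDl.

Lemma restr_scaleE (c : C) (v : M) : c *: (v : restr M) = vN_scalar c *: v.
Proof. by []. Qed.
End Restr.

Section RestrMap.
Variables (M M' : lmodType N) (f : {linear M -> M'}).
Definition restr_map (v : restr M) : restr M' := f v.
Fact restr_map_linear : linear restr_map.
Proof. by move=> a u v; rewrite /restr_map !restr_scaleE linearP. Qed.
HB.instance Definition _ := GRing.isLinear.Build C (restr M) (restr M') *:%R
  restr_map restr_map_linear.
End RestrMap.

Hypothesis triv : forall g : G, g = 1%g.

(** For the trivial group, square-summable functions form a line, so that
    operators are scalars. *)
Lemma vN_trK : cancel (@vN_tr R G : N -> C) vN_scalar.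
Proof.
move=> T; apply: val_inj; apply/funext => f.
have /asboolP[linT _ _] := vNP T.
have -> : f = (f 1%g : C) *: ell2_delta R G.
  apply: val_inj; apply/funext => g; rewrite (triv g).
  have E : (f 1%g : C) = f 1%g * (1%g == 1%g :> G)%:R by rewrite eqxx mulr1.
  exact: E.
set c := f 1%g; apply: val_inj; apply/funext => g; rewrite (triv g).
have cT : vN_op T (c *: ell2_delta R G) = c *: vN_op T (ell2_delta R G).
  have := linT c (ell2_delta R G) 0; rewrite !addr0 => ->.
  have -> : vN_op T 0 = 0.
    by have := linT (-1) 0 0; rewrite scaler0 addr0 scaleN1r addNr.
  by rewrite addr0.
have E : vN_tr T * (c * (1%g == 1%g :> G)%:R) = c * vN_tr T by rewrite eqxx mulr1 mulrC.
by apply: etrans E _; rewrite [RHS](congr1 (fun h : ell2 R G => h 1%g) cT).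
Qed.

Lemma vN_trM (S T : N) : vN_tr (S * T) = vN_tr S * vN_tr T.
Proof. by apply: (can_inj vN_scalarK); rewrite vN_scalarM !vN_trK. Qed.

Definition mx_tr m n (A : 'M[N]_(m, n)) : 'M[C]_(m, n) := map_mx (fun a : N => vN_tr a) A.
Definition mx_scalar m n (A : 'M[C]_(m, n)) : 'M[N]_(m, n) := map_mx vN_scalar A.

Lemma mx_trK m n (A : 'M[N]_(m, n)) : mx_scalar (mx_tr A) = A.
Proof. by apply/matrixP => i j; rewrite !mxE vN_trK. Qed.
Lemma mx_scalarK m n (A : 'M[C]_(m, n)) : mx_tr (mx_scalar A) = A.
Proof. by apply/matrixP => i j; rewrite !mxE vN_scalarK. Qed.
Lemma mx_trM m n p (A : 'M[N]_(m, n)) (B : 'M[N]_(n, p)) :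
  mx_tr (A *m B) = mx_tr A *m mx_tr B.
Proof.
apply/matrixP => i j; rewrite !mxE vN_tr_sum; apply: eq_bigr => k _.
by rewrite !mxE vN_trM.
Qed.
Lemma mx_scalarM m n p (A : 'M[C]_(m, n)) (B : 'M[C]_(n, p)) :
  mx_scalar (A *m B) = mx_scalar A *m mx_scalar B.
Proof. by rewrite -[RHS]mx_trK mx_trM !mx_scalarK. Qed.
Lemma mx_trP m n a (A B : 'M[N]_(m, n)) : mx_tr (a *: A + B) = vN_tr a *: mx_tr A + mx_tr B.
Proof. by apply/matrixP => i j; rewrite !mxE vN_trD vN_trM. Qed.
Lemma mx_scalarP m n a (A B : 'M[C]_(m, n)) :
  mx_scalar (a *: A + B) = vN_scalar a *: mx_scalar A + mx_scalar B.
Proof. by rewrite -[RHS]mx_trK mx_trP !mx_scalarK vN_scalarK. Qed.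

Lemma restr_scale_tr (M : lmodType N) (a : N) (v : M) : vN_tr a *: (v : restr M) = a *: v.
Proof. by rewrite restr_scaleE vN_trK. Qed.

(** Idempotent matrices have their rank as trace, and an image that embeds into
    an [n]-dimensional space has rank at most [n]; the identity attains it. *)
Lemma vN_dim_fin (M : lmodType N) n : fin_dim (restr M) n -> vN_dim M = n%:R%:E.
Proof.
move=> [f [g [fK gK]]]; apply/eqP; rewrite eq_le; apply/andP; split.
  apply: ge_ereal_sup => _ [t [P [m [e [h [ee _ hP te]]]]] <-].
  pose E := mx_tr e; have EE : E *m E = E by rewrite -mx_trM ee.
  have -> : t = (\rank E)%:R.
    apply: (fmorph_inj (real_complex R)); rewrite [RHS]rmorph_nat.
    rewrite -(mxtrace_idempotent EE).
    by rewrite -[LHS]te; apply: eq_bigr => i _; rewrite mxE.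
  rewrite lee_fin ler_nat.
  pose k (w : 'rV[C]_m) : 'rV[C]_n := g (h (mx_scalar w)).
  have lk : linear k.
    move=> a u v; rewrite /k mx_scalarP linearP.
    exact: (linearP g a (h (mx_scalar u) : restr M)).
  pose k' := HB.pack k (GRing.isLinear.Build _ _ _ _ k lk) : {linear 'rV[C]_m -> 'rV[C]_n}.
  have : row_free (row_base E *m lin1_mx k').
    apply: inj_row_free => v; rewrite mulmxA mul_rV_lin1 /= /k => gh0.
    have /submxP[u uE] : (v *m row_base E <= E)%MS.
      by apply: submx_trans (submxMl _ _) _; rewrite eq_row_base.
    have h0 : h (mx_scalar u *m e) = 0.
      move: (congr1 f gh0); rewrite gK linear0 uE mx_scalarM /E mx_trK.
      by [].
    have : v *m row_base E = 0.
      by rewrite uE -[u]mx_scalarK -mx_trM (hP _ h0); apply/matrixP => i j; rewrite !mxE.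
    by move/eqP; rewrite mulmx_free_eq0 ?row_base_free // => /eqP.
  by move/eqP <-; exact: rank_leq_col.
apply: ereal_sup_ubound; exists n%:R => //.
pose h (v : 'rV[N]_n) : M := f (mx_tr v).
have lh : linear h.
  by move=> a u v; rewrite /h mx_trP linearP /= restr_scale_tr.
pose h' := HB.pack h (GRing.isLinear.Build _ _ _ _ h lh) : {linear 'rV[N]_n -> M}.
exists [set h' (v *m 1%:M) | v in [set: 'rV[N]_n]], n, 1%:M, h'; split=> //.
- by rewrite mulmx1.
- move=> v; rewrite mulmx1 /= /h => fv0; rewrite -[v]mx_trK -[mx_tr v]fK fv0 linear0.
  by apply/matrixP => i j; rewrite !mxE /vN_scalar scale0r.
- under eq_bigr => i _ do rewrite mxE eqxx.
  rewrite -vN_scalar1; under eq_bigr => i _ do rewrite vN_scalarK.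
  by rewrite sumr_const card_ord rmorph_nat.
Qed.

Lemma tensor_mkZ (W : right_rep R G) (c : C) (v : W) :
  tensor_mk (c *: v) = vN_scalar c *: tensor_mk v.
Proof.
apply/eqP; rewrite -subr_eq0 -linearZ -linearB lquot_eq0.
by apply: submod_span_sub; right; left; exists c, v.
Qed.

(** Over the trivial group the tensor product is a change of scalars along an
    isomorphism, so that [v] and the class of [v] have the same coordinates. *)
Lemma fin_dim_tensor (W : right_rep R G) n : fin_dim W n -> fin_dim (restr (tensor W)) n.
Proof.
move=> [f [g [fK gK]]].
pose L0 := free_lift (fun v : W => mx_scalar (g v)).
have L0P z : z \in submod_span (tensor_rel (M := W)) -> L0 z = 0.
  move=> zS; apply/eqP; apply: (submod_span_min (lin_ker_closed L0) _ zS) => {z zS} z.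
  rewrite inE => -[[v [w ->]]|[[c [v ->]]|[a [v ->]]]].
  - rewrite !linearB /= !free_lift_gen linearD /= -addrA -opprD subr_eq0.
    by apply/eqP/matrixP => i j; rewrite !mxE vN_scalarD.
  - rewrite linearB linearZ /= !free_lift_gen linearZ /= subr_eq0.
    by apply/eqP/matrixP => i j; rewrite !mxE vN_scalarM.
  - rewrite linearB linearZ /= !free_lift_gen (triv a) rep_act1.
    have -> : (vN_of_group R (1%g : G) : N) = 1.
      by apply: val_inj; apply/funext => u; apply: val_inj; apply/funext => k /=; rewrite mulg1.
    by rewrite scale1r subrr.
pose L : {linear tensor W -> 'rV[N]_n} := lquot_lift L0P.
have LE v : L (tensor_mk v) = mx_scalar (g v) by rewrite [LHS]lquot_liftE; exact: free_lift_gen.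
pose F (v : 'rV[C]_n) : restr (tensor W) := tensor_mk (f v).
have lF : linear F by move=> a u v; rewrite /F linearP tensor_mkD tensor_mkZ.
pose F' := HB.pack F (GRing.isLinear.Build _ _ _ _ F lF) : {linear 'rV[C]_n -> restr (tensor W)}.
have FL : forall z : tensor W, F (mx_tr (L z)) = z.
  have lFL : linear (fun z : tensor W => F (mx_tr (L z)) : tensor W).
    by move=> a u v; rewrite linearP mx_trP lF restr_scale_tr.
  pose FL' := HB.pack (fun z : tensor W => F (mx_tr (L z)) : tensor W)
    (GRing.isLinear.Build _ _ _ _ _ lFL) : {linear tensor W -> tensor W}.
  apply: (tensor_lin_ext (f := FL') (g := idfun)) => v.
  change (F (mx_tr (L (tensor_mk v))) = tensor_mk v).
  by rewrite LE mx_scalarK /F gK.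
apply: (fin_dim_bij (f := F')) => [v /= Fv0|w]; last by exists (mx_tr (L w)); exact: FL.
have := LE (f v); rewrite fK -/(F v) Fv0 linear0 => /(congr1 (@mx_tr 1 n)).
by rewrite mx_scalarK => <-; apply/matrixP => i j; rewrite !mxE.
Qed.

End TrivialGroup.

(** * Homology of complexes of finite-dimensional modules *)

Section HomologyDimension.
Variables (R : realType) (G : groupType).
Local Notation C := R[i].
Local Notation N := (vN R G)^c.
Variables (K : chain_complex N) (c : nat -> nat).
Hypothesis K_dim : forall n, fin_dim (restr (K n)) (c n).

Let f n : {linear 'rV[C]_(c n) -> restr (K n)} := projT1 (cid (K_dim n)).
Let g n : {linear restr (K n) -> 'rV[C]_(c n)} := projT1 (cid (projT2 (cid (K_dim n)))).
Let fK n : cancel (f n) (g n).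
Proof. exact: (proj1 (projT2 (cid (projT2 (cid (K_dim n)))))). Qed.
Let gK n : cancel (g n) (f n).
Proof. exact: (proj2 (projT2 (cid (projT2 (cid (K_dim n)))))). Qed.

Let D n : 'M[C]_(c n.+1, c n) := lin1_mx (g n \o (restr_map (cc_d K n) \o f n.+1)).

Let DE n v : f n (v *m D n) = cc_d K n (f n.+1 v).
Proof. by rewrite /D mul_rV_lin1 /= gK. Qed.

Let f_inj n : injective (f n). Proof. exact: can_inj (fK (n := n)). Qed.

Let DD n : D n.+1 *m D n = 0.
Proof.
apply/row_matrixP => i; rewrite row_mul row0; apply: f_inj; rewrite linear0 DE.
by rewrite rowE DE cc_dd.
Qed.

Definition boundary_rank p : nat := if p is q.+1 then \rank (D q) else 0%N.

(* The cycles, as a row space. *)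
Let Z p : 'M[C]_(c p) :=
  if p is q.+1 return 'M[C]_(c p) then kermx (D q) else 1%:M.

Let rank_Z p : \rank (Z p) = (c p - boundary_rank p)%N.
Proof. by case: p => [|p] /=; rewrite ?mxrank1 ?subn0 ?mxrank_ker. Qed.

Let D_sub_Z p : (D p <= Z p)%MS.
Proof. by case: p => [|p] /=; rewrite ?submx1 // sub_kermx DD. Qed.

Let Z_cycle p v : (v <= Z p)%MS -> (f p v : K p) \in @cycle_pred N K p.
Proof.
case: p v => [|p] v //= /sub_kermxP vD; rewrite inE.
by rewrite -DE vD linear0.
Qed.

Let cycle_Z p (z : cycles K p) : (g p (val z : restr (K p)) <= Z p)%MS.
Proof.
case: z => z; case: p z => [|p] z /= hz; first exact: submx1.
apply/sub_kermxP; apply: f_inj; rewrite DE gK linear0.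
by move: hz; rewrite inE => /eqP.
Qed.

Lemma boundary_rank_le p : (boundary_rank p.+1 + boundary_rank p <= c p)%N.
Proof.
have := mxrankS (D_sub_Z p); rewrite rank_Z /= => h.
have : (boundary_rank p <= c p)%N by case: (p) => [|q] //=; exact: rank_leq_row.
by lia.
Qed.

(** A complement of the boundaries in the cycles represents the homology. *)
Lemma fin_dim_homology p :
  fin_dim (restr (homology K p)) (c p - boundary_rank p - boundary_rank p.+1).
Proof.
pose H := (Z p :\: D p)%MS.
have rH : \rank H = (c p - boundary_rank p - boundary_rank p.+1)%N.
  have := mxrank_cap_compl (Z p) (D p); rewrite rank_Z -/H.
  have -> : \rank (Z p :&: D p)%MS = boundary_rank p.+1.
    by rewrite /=; apply/eqmx_rank/eqmxP/capmx_idPr.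
  by move=> <-; rewrite addKn.
rewrite -rH; pose B := row_base H.
have BZ (v : 'rV_(\rank H)) : (v *m B <= Z p)%MS.
  by rewrite (submx_trans (submxMl _ _)) // eq_row_base diffmxSl.
pose F0 (v : 'rV[C]_(\rank H)) : cycles K p := Cycle (Z_cycle (BZ v)).
pose F (v : 'rV[C]_(\rank H)) : restr (homology K p) := lquot_class (@boundary_pred N K p) (F0 v).
have lF : linear F.
  move=> a u v; rewrite restr_scaleE -[RHS]linearP; congr (lquot_class _ _).
  apply: val_inj => /=; rewrite mulmxDl -scalemxAl linearP.
  by [].
pose F' := HB.pack F (GRing.isLinear.Build _ _ _ _ F lF)
  : {linear 'rV[C]_(\rank H) -> restr (homology K p)}.
apply: (fin_dim_bij (f := F')) => [v|w] /=.
  move/eqP; rewrite lquot_eq0 => /asboolP[w /= ew].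
  have vD : (v *m B <= D p)%MS.
    apply/submxP; exists (g p.+1 (w : restr (K p.+1))); apply: f_inj.
    by rewrite DE gK ew.
  have vH : (v *m B <= H)%MS by rewrite (submx_trans (submxMl _ _)) // eq_row_base.
  have : (v *m B <= H :&: D p)%MS by rewrite sub_capmx vH vD.
  rewrite /H capmx_diff submx0 mulmx_free_eq0 ?row_base_free // => /eqP.
  by [].
rewrite -[w]lquot_reprK; move: (repr w) => {w} z.
have : (g p (val z : restr (K p)) <= Z p)%MS := cycle_Z z.
rewrite -(addsmx_diff_cap_eq (Z p) (D p)) => /sub_addsmxP[[u1 u2] /= e].
have u1B : (u1 *m H <= B)%MS by rewrite eq_row_base submxMl.
case/submxP: u1B => v ev; exists v.
apply/eqP; rewrite lquot_eqE; apply/asboolP.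
have /submxP[w ew] : (u2 *m (Z p :&: D p) <= D p)%MS.
  by rewrite (submx_trans (submxMl _ _)) // capmxSr.
exists (- f p.+1 w); rewrite linearN -DE /= -ew -ev.
rewrite -[X in _ = _ - X](gK (val z : restr (K p))) e linearD /= opprD addrA.
by rewrite -/H subrr sub0r.
Qed.

End HomologyDimension.

(** * Splitting free presheaves on acyclic categories *)

Section Acyclic.
Variables (J : category).
Hypothesis acyc : acyclic J.

Lemma acyclic_antisym (x y : J) (u : mor x y) (v : mor y x) : x = y.
Proof.
apply: contrapT => xy; have [_ /(_ x y xy (inhabits u))] := acyc.
by apply; constructor.
Qed.

Lemma acyclic_hom_eq (x y : J) (u v : mor x y) : y = x -> u = v.
Proof. by move=> yx; subst y; rewrite ((proj1 acyc) x u) ((proj1 acyc) x v). Qed.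

Lemma acyclic_iso_eq (x y : J) (u : mor x y) : is_iso u -> x = y.
Proof. by case=> v _; exact: acyclic_antisym u v. Qed.

Lemma acyclic_aut (x : J) (g : aut x) : g = 1%g.
Proof. by apply: autP; exact: (proj1 acyc). Qed.

Lemma acyclic_iso_class (x y : J) : isomorphic (x : {classic J}) y -> x = y.
Proof. by move=> /asboolP[u]; exact: acyclic_iso_eq. Qed.

Section Splitting.
Variables (R : realType) (S : Type) (t : S -> J) (x : J).
Variables (n : nat) (b : 'I_n -> fbasis t x).
Hypothesis b_inj : injective b.
Hypothesis bP : forall e : fbasis t x, t (projT1 e) = x <-> exists i, b i = e.
Local Notation F := (free_presheaf R t).

Let coord : {linear F x -> 'rV[R[i]]_n} :=
  free_lift (fun e => \row_i (e == b i)%:R).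

Let coordE e : coord (free_gen _ e) = \row_i (e == b i)%:R.
Proof. exact: free_lift_gen. Qed.

(* A basis element that factors through a non-isomorphism out of x sits at an
   object other than x. *)
Let coord_span v : v \in submod_span (@split_rel R J x F) -> coord v = 0.
Proof.
move=> vS; apply/eqP; apply: (submod_span_min (lin_ker_closed coord) _ vS).
move=> _ [y [u [w [nu ->]]]]; rewrite inE; apply/eqP.
apply: (free_lin_ext (f := coord \o ps_map F u) (g := \0)) => e.
change (coord (free_ps_map R t u (free_gen _ e)) = 0).
rewrite free_ps_mapE coordE; apply/rowP => i; rewrite !mxE.
case: eqP => // be; have ex : t (projT1 e) = x.
  by apply: (proj2 (bP (fbasis_act u e))); exists i.
case: e ex {be} => s a /= sx; exfalso; apply: nu.
have a' : mor y x by rewrite -sx.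
have yx := acyclic_antisym a' u; subst y.
exists (idm x); rewrite (proj1 acyc x u).
by split; rewrite mcomp_idl.
Qed.

(** Precomposition with a non-isomorphism produces all the basis elements at
    [x] whose generator is placed elsewhere, and none of the others. *)
Lemma fin_dim_splitting : fin_dim (splitting x F) n.
Proof.
pose g : {linear splitting x F -> 'rV[R[i]]_n} := lquot_lift coord_span.
pose cls (e : fbasis t x) : splitting x F := lquot_class (submod_span (@split_rel R J x F)) (free_gen _ e).
pose f0 (v : 'rV[R[i]]_n) : splitting x F := \sum_i v ord0 i *: cls (b i).
have lf : linear f0.
  move=> a u v; rewrite /f0 scaler_sumr -big_split; apply: eq_bigr => i _.
  by rewrite !mxE scalerDl scalerA.
pose f := HB.pack f0 (GRing.isLinear.Build _ _ _ _ f0 lf) : {linear 'rV[R[i]]_n -> splitting x F}.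
have gE e : g (cls e) = \row_i (e == b i)%:R.
  by rewrite [LHS]lquot_liftE; exact: coordE.
exists f, g; split=> [v|z].
  change (g (f0 v) = v); rewrite /f0 (linear_sum g).
  under eq_bigr => i _ do rewrite (linearZ_LR g) gE.
  rewrite [RHS]row_sum_delta; apply: eq_bigr => i _; congr (_ *: _).
  by apply/rowP => j; rewrite !mxE eqxx /= (inj_eq b_inj) eq_sym.
rewrite -[z]lquot_reprK; move: (repr z) => {z} v.
apply: (free_lin_ext (f := f \o (g \o lquot_class (submod_span (@split_rel R J x F))))
  (g := lquot_class _)) => e.
change (f0 (g (cls e)) = cls e); rewrite gE /f0.
have [/bP[i <-]|ne] := pselect (t (projT1 e) = x).
  rewrite (bigD1 i) //= big1 ?addr0 => [|j ji]; first by rewrite mxE eqxx scale1r.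
  by rewrite mxE (inj_eq b_inj) eq_sym (negPf ji) scale0r.
rewrite big1 => [|i _]; last first.
  rewrite mxE; case: eqP => [eb|]; last by rewrite scale0r.
  by exfalso; apply: ne; apply/bP; exists i.
symmetry; apply/eqP; rewrite lquot_eq0; apply: submod_span_sub.
case: e ne => s u /= ne; exists (t s), u, (free_gen _ (existT _ s (idm (t s)) : fbasis t (t s))).
split; first by move=> /acyclic_iso_eq/esym.
by rewrite [RHS]free_ps_mapE /fbasis_act /= mcomp_idl.
Qed.

End Splitting.

Section FreeComplex.
Variables (R : realType) (P : proj_resolution R J) (S : nat -> Type) (t : forall n, S n -> J).
Hypothesis P_free : forall n, P n = free_presheaf R (@t n).
Variables (x : J) (c : nat -> nat) (b : forall n, 'I_(c n) -> fbasis (@t n) x).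
Hypothesis b_inj : forall n, injective (@b n).
Hypothesis bP : forall n (e : fbasis (@t n) x), t (projT1 e) = x <-> exists i, b i = e.

Lemma fin_dim_split_complex n : fin_dim (restr (split_complex x P n)) (c n).
Proof.
apply: fin_dim_tensor; first exact: acyclic_aut.
rewrite P_free; exact: (fin_dim_splitting _ (@b_inj n) (@bP n)).
Qed.

Definition split_rank : nat -> nat := boundary_rank fin_dim_split_complex.

Lemma l2_betti_free p :
  l2_betti (split_complex x P) p = (c p - split_rank p - split_rank p.+1)%:R%:E.
Proof.
by apply: vN_dim_fin; [exact: acyclic_aut|exact: fin_dim_homology].
Qed.

Lemma split_rank_le p : (split_rank p.+1 + split_rank p <= c p)%N.
Proof. exact: boundary_rank_le. Qed.

End FreeComplex.

End Acyclic.

(** * The Euler characteristic of a finite free resolution *)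

Lemma esum_seq (R : realType) (T : choiceType) (s : seq T) (F : T -> \bar R) :
  uniq s -> (forall c, (0 <= F c)%E) -> (forall c, c \notin s -> F c = 0%E) ->
  (\esum_(c in [set: T]) F c = \sum_(c <- s) F c)%E.
Proof.
move=> us F0 Fs; transitivity (\esum_(c in [set` s]) F c)%E.
  rewrite [RHS]esum_mkcond; apply: eq_esum => c _.
  by rewrite mem_setE; case: ifPn => // /Fs.
by rewrite esum_fset // -fsbig_seq.
Qed.

Lemma nneseries_finite (R : realType) (u : nat -> \bar R) n :
  (forall p, (n <= p)%N -> u p = 0%E) ->
  (\sum_(0 <= p <oo) u p = \sum_(0 <= p < n) u p)%E.
Proof.
move=> u0; apply: lim_near_cst => //.
near=> m; have nm : (n <= m)%N by near: m; exact: nbhs_infty_ge.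
rewrite (big_cat_nat (n := n)) //= [X in (_ + X)%E]big_nat_cond [X in (_ + X)%E]big1 ?adde0 //.
by move=> p /andP[/andP[np _] _]; exact: u0.
Unshelve. all: by end_near.
Qed.

(** Euler's formula: the ranks of the boundaries cancel in pairs. *)
Lemma euler_formula (R : nzRingType) (c r : nat -> nat) n :
  r 0%N = 0%N -> (forall p, (r p.+1 + r p <= c p)%N) ->
  \sum_(0 <= p < n) (-1) ^+ p * (c p - r p - r p.+1)%:R =
  \sum_(0 <= p < n) (-1) ^+ p * (c p)%:R + (-1) ^+ n * (r n)%:R :> R.
Proof.
move=> r0 rc; elim: n => [|n IHn]; first by rewrite !big_nil r0 mulr0 addr0.
rewrite !big_nat_recr //= IHn -!addrA; congr (_ + _).
have := rc n; rewrite addnC => h; rewrite -subnDA natrB // natrD -mulrDr opprD !addrA.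
by rewrite [_ + (c n)%:R]addrC addrK mulrBr exprS mulN1r mulNr.
Qed.

Section EulerCharacteristic.
Variables (R : realType) (J : category).
Hypothesis acyc : acyclic J.

Lemma l2_betti_fun_eq x (P Q : proj_resolution R J) :
  l2_betti (split_complex x P) = l2_betti (split_complex x Q).
Proof. by apply/funext => p; exact: l2_betti_eq. Qed.

Lemma h2_res_eq (P Q : proj_resolution R J) : h2_res P = h2_res Q.
Proof. by apply: eq_esum => c _; rewrite /h2_complex (l2_betti_fun_eq _ P Q). Qed.

Lemma chi2_complex_eq x (P Q : proj_resolution R J) :
  chi2_complex (split_complex x P) = chi2_complex (split_complex x Q).
Proof. by rewrite /chi2_complex (l2_betti_fun_eq _ P Q). Qed.

Lemma chi2_res_eq (P Q : proj_resolution R J) : chi2_res P = chi2_res Q.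
Proof.
have e : (fun c => (chi2_complex (split_complex (iso_repr c) P))%:E) =
         (fun c => (chi2_complex (split_complex (iso_repr c) Q))%:E).
  by apply/funext => c; rewrite (chi2_complex_eq (iso_repr c) P Q).
exact: (congr1 (fun a : iso_class J -> \bar R =>
  fine (\esum_(c in [set: iso_class J]) a^\+ c - \esum_(c in [set: iso_class J]) a^\- c)%E) e).
Qed.

Lemma chi2_resE (P : proj_resolution R J) : typeL2 R J -> chi2 R J = chi2_res P.
Proof.
move=> h; rewrite /chi2; case: pselect => [h'|nh]; last by case: (nh h).
exact: (chi2_res_eq (projT1 (cid h')) P).
Qed.

Definition iso_cls (x : J) : iso_class J := \pi_(iso_class J) (x : {classic J}).

Lemma iso_cls_repr c : iso_cls (iso_repr c) = c.
Proof. exact: reprK. Qed.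

Lemma iso_repr_cls x : iso_repr (iso_cls x) = x.
Proof.
apply: (acyclic_iso_class acyc); have := iso_cls_repr (iso_cls x).
by move/eqP; rewrite eqmodE.
Qed.

Variables (P : proj_resolution R J) (S : nat -> Type) (t : forall n, S n -> J).
Hypothesis P_free : forall n, P n = free_presheaf R (@t n).
Variables (m : nat) (sigma : 'I_m -> {n : nat & S n}).
Hypothesis sigma_inj : injective sigma.
Hypothesis sigma_surj : forall s, exists k, sigma k = s.

Let deg (k : 'I_m) : nat := projT1 (sigma k).
Let loc (k : 'I_m) : J := t (projT2 (sigma k)).

Let gens n x : {set 'I_m} := [set k : 'I_m | (deg k == n) && `[< loc k = x >]]%SET.

Let gens_basis n x : exists b : 'I_#|gens n x| -> fbasis (@t n) x,
  injective b /\ forall e : fbasis (@t n) x, t (projT1 e) = x <-> exists i, b i = e.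
Proof.
have ex (i : 'I_#|gens n x|) : exists e : fbasis (@t n) x,
    existT S n (projT1 e) = sigma (enum_val i) /\ t (projT1 e) = x.
  have := enum_valP i; rewrite inE /deg /loc; case: (sigma _) => n' s /=.
  move=> /andP[/eqP n'n /asboolP sx]; subst n' x.
  by exists (existT _ s (idm _)).
have [b bE] : exists b : 'I_#|gens n x| -> fbasis (@t n) x, forall i,
    existT S n (projT1 (b i)) = sigma (enum_val i) /\ t (projT1 (b i)) = x.
  by exists (fun i => projT1 (cid (ex i))) => i; exact: projT2 (cid (ex i)).
exists b; split=> [i j ij|e].
  by apply: enum_val_inj; apply: sigma_inj; rewrite -(bE i).1 -(bE j).1 ij.
split=> [ex'|[i <-]]; last by have [] := bE i.
have [k kE] := sigma_surj (existT S n (projT1 e)).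
have kg : k \in gens n x by rewrite inE /deg /loc kE /= eqxx; apply/asboolP.
exists (enum_rank_in kg k); have [+ _] := bE (enum_rank_in kg k).
rewrite enum_rankK_in // kE; move: (b _) => e' e1.
have := inj_pair2 _ _ _ _ _ e1; case: e e' ex' {kE e1} => s u [s' u'] /= sx ss'; subst s'.
by rewrite (acyclic_hom_eq acyc u u' sx).
Qed.

Let top : nat := \max_k (deg k).+1.

Let gens0 n x : (top <= n)%N -> #|gens n x| = 0%N.
Proof.
move=> tn; apply/eqP; rewrite cards_eq0; apply/eqP/setP => k; rewrite !inE.
apply/negP => /andP[/eqP dk _]; have := leq_bigmax (F := fun k => (deg k).+1) k.
by rewrite -/top dk => h; have := leq_trans h tn; rewrite ltnn.
Qed.

Let betti x : exists r : nat -> nat, [/\ r 0%N = 0%N,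
  (forall p, (r p.+1 + r p <= #|gens p x|)%N) &
  forall p, l2_betti (split_complex x P) p = (#|gens p x| - r p - r p.+1)%:R%:E].
Proof.
pose b n := projT1 (cid (gens_basis n x)).
have b_inj n : injective (b n) := proj1 (projT2 (cid (gens_basis n x))).
have bP n := proj2 (projT2 (cid (gens_basis n x))).
exists (split_rank acyc P_free b_inj bP); split=> //.
- by move=> p; exact: split_rank_le.
- by move=> p; exact: l2_betti_free.
Qed.

Let h2_split x : h2_complex (split_complex x P) =
  (\sum_(0 <= p < top) l2_betti (split_complex x P) p)%E.
Proof.
apply: nneseries_finite => p tp; have [r [_ _ ->]] := betti x.
by rewrite gens0.
Qed.

Let chi2_split x : chi2_complex (split_complex x P) = \sum_(k | `[< loc k = x >]) (-1) ^+ deg k.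
Proof.
have [r [r0 rc bE]] := betti x.
rewrite /chi2_complex (@nneseries_finite _ _ top) => [|p tp]; last first.
  by rewrite bE gens0 // mule0.
under eq_bigr do rewrite bE -EFinM; rewrite sumEFin /= euler_formula //.
have -> : r top = 0%N by have := rc top; rewrite gens0 //; lia.
rewrite mulr0 addr0 big_mkord.
have dt k : (deg k < top)%N by exact: (leq_bigmax (F := fun k => (deg k).+1) k).
rewrite [RHS](partition_big (fun k => Ordinal (dt k)) predT) //=.
apply: eq_bigr => p _; rewrite -sum1_card natr_sum mulr_sumr.
apply: eq_big => [k|k]; first by rewrite inE andbC -val_eqE.
by rewrite inE => /andP[/eqP -> _]; rewrite mulr1.
Qed.

Let supp : seq (iso_class J) := undup [seq iso_cls (loc k) | k <- enum 'I_m].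

Let loc_supp k : iso_cls (loc k) \in supp.
Proof. by rewrite mem_undup; apply/mapP; exists k; rewrite ?mem_enum. Qed.

Let loc_iso k c : loc k = iso_repr c <-> iso_cls (loc k) = c.
Proof.
split=> [->|<-]; first exact: iso_cls_repr.
by rewrite iso_repr_cls.
Qed.

Let notin_supp c k : c \notin supp -> loc k <> iso_repr c.
Proof. by move=> cs /loc_iso ck; move: cs; rewrite -ck loc_supp. Qed.

Lemma typeL2_finite : typeL2 R J.
Proof.
exists P; rewrite /h2_res (@esum_seq _ _ supp); first last.
- move=> c cs; rewrite h2_split big1 // => p _; have [r [_ _ ->]] := betti (iso_repr c).
  have -> // : #|gens p (iso_repr c)| = 0%N.
  apply/eqP; rewrite cards_eq0; apply/eqP/setP => k; rewrite !inE.
  by apply/negP => /andP[_ /asboolP]; exact: notin_supp.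
- move=> c; rewrite h2_split; apply: sume_ge0 => p _; have [r [_ _ ->]] := betti (iso_repr c).
  by rewrite lee_fin.
- exact: undup_uniq.
apply: lte_sum_pinfty => c _; rewrite h2_split; apply: lte_sum_pinfty => p _.
by have [r [_ _ ->]] := betti (iso_repr c); exact: ltry.
Qed.

(** At each object Euler's formula leaves the signed count of the generators
    placed there; distinct objects of an acyclic category are not isomorphic, so
    that summing over the isomorphism classes counts each generator once. *)
Lemma chi2_finite : chi2 R J = \sum_(k < m) (-1) ^+ projT1 (sigma k).
Proof.
rewrite (chi2_resE P typeL2_finite) /chi2_res.
pose a c := chi2_complex (split_complex (iso_repr c) P).
have a0 c : c \notin supp -> a c = 0.
  move=> cs; rewrite /a chi2_split big1 // => k /asboolP.
  by move/(notin_supp cs).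
rewrite (@esum_seq _ _ supp) ?undup_uniq //; last first.
  by move=> c /a0 ac; rewrite funeposE -/(a c) ac maxxx.
rewrite (@esum_seq _ _ supp) ?undup_uniq //; last first.
  by move=> c /a0 ac; rewrite funenegE -/(a c) ac oppe0 maxxx.
transitivity (\sum_(c <- supp) a c).
  have -> : (\sum_(c <- supp) (fun c => (a c)%:E)^\+ c)%E = (\sum_(c <- supp) Num.max (a c) 0)%:E.
    by rewrite -sumEFin; apply: eq_bigr => c _; rewrite funeposE EFin_max.
  have -> : (\sum_(c <- supp) (fun c => (a c)%:E)^\- c)%E = (\sum_(c <- supp) Num.max (- a c) 0)%:E.
    by rewrite -sumEFin; apply: eq_bigr => c _; rewrite funenegE EFin_max.
  rewrite -EFinB /= -sumrB; apply: eq_bigr => c _.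
  by have [ac|ac] := leP 0 (a c); rewrite ?oppr_le0 ?oppr_cp0; case: ltgtP => //; lra.
under eq_bigr => c _ do rewrite /a chi2_split big_mkcond.
rewrite exchange_big /=; apply: eq_bigr => k _.
rewrite (bigD1_seq (iso_cls (loc k))) ?undup_uniq ?loc_supp //=.
rewrite iso_repr_cls big1 => [|c ck].
  by case: asboolP => // _; rewrite addr0.
by case: asboolP => // /loc_iso e; rewrite e eqxx in ck.
Qed.

End EulerCharacteristic.

(** * Subdivisions and chains of finite acyclic categories *)

Section SubdivisionAcyclic.
Variable I : category.

Lemma sd_map_lt (X Y : sd_ob I) (f : sd_map X Y) (i j : 'I_(sd_len X).+1) :
  (i < j)%N -> (f i < f j)%N.
Proof.
move=> ij; have fij : (f i <= f j)%N := fmor f (ltnW ij : @mor (ordcat _) i j).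
rewrite ltn_neqAle fij andbT; apply/negP => /eqP/val_inj eij.
have iS : (i.+1 < (sd_len X).+1)%N by exact: leq_ltn_trans ij (ltn_ord j).
pose i' : 'I_(sd_len X).+1 := Ordinal iS.
have ii' : @mor (ordcat (sd_len X)) i i' by rewrite /= leqnSn.
have fi : f i = f i'.
  apply: val_inj; apply/eqP; rewrite eqn_leq (fmor f ii' : (f i <= f i')%N) /= eij.
  exact: (fmor f (ij : @mor (ordcat _) i' j)).
apply: (@sd_nondeg I X i i' ii') => //; have : collapsed Y (f i) (f i') by rewrite -fi; exact: collapsed_refl.
move=> /(collapsedE _ (fmor f ii')); apply: is_identity_eq.
by rewrite -[in RHS](sd_funE f).
Qed.

Lemma sd_map_ge (X Y : sd_ob I) (f : sd_map X Y) (i : 'I_(sd_len X).+1) : (i <= f i)%N.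
Proof.
case: i => k; elim: k => [//|k IHk] kX; have kX' := ltnW kX.
exact: leq_ltn_trans (IHk kX') (@sd_map_lt _ _ f (Ordinal kX') (Ordinal kX) (leqnn _)).
Qed.

Lemma sd_map_le (X Y : sd_ob I) (f : sd_map X Y) (i : 'I_(sd_len X).+1) :
  (f i + (sd_len X - i) <= sd_len Y)%N.
Proof.
have gen k (kX : (sd_len X - k < (sd_len X).+1)%N) : (k <= sd_len X)%N ->
    (f (Ordinal kX) + k <= sd_len Y)%N.
  elim: k kX => [|k IHk] kX kl; first by rewrite addn0 -ltnS.
  have kX' : (sd_len X - k < (sd_len X).+1)%N by lia.
  have := IHk kX' (ltnW kl).
  have /= : (f (Ordinal kX) < f (Ordinal kX'))%N by apply: sd_map_lt => /=; lia.
  by lia.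
have iX := ltn_ord i; have kX : (sd_len X - (sd_len X - i) < (sd_len X).+1)%N by lia.
have := gen _ kX (leq_subr _ _).
by rewrite (_ : Ordinal kX = i) //; apply: val_inj => /=; lia.
Qed.

Lemma sd_len_le (X Y : sd_ob I) (f : sd_map X Y) : (sd_len X <= sd_len Y)%N.
Proof. by have := sd_map_le f ord0; rewrite subn0; lia. Qed.

Lemma sd_map_same_len (X Y : sd_ob I) (f : sd_map X Y) (i : 'I_(sd_len X).+1) :
  sd_len X = sd_len Y -> val (f i) = i.
Proof. by move=> e; have := sd_map_le f i; have := sd_map_ge f i; have := ltn_ord i; rewrite /=; lia. Qed.

(** Morphisms of the subdivision are strictly increasing on vertices, so that
    they cannot go back and forth between different chains. *)
Lemma acyclic_opcat_Sd : acyclic (opcat (Sd I)).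
Proof.
split=> [X f|X Y XY [f] [g]].
  rewrite -[LHS](@sd_class_repr I X X f); congr sd_class; apply: sd_mapP.
  by apply: functor_ord_ext => i; apply: val_inj; exact: (sd_map_same_len (repr (f : sd_hom X X)) i erefl).
have {f} f : sd_map Y X := repr (f : sd_hom Y X).
have {g} g : sd_map X Y := repr (g : sd_hom X Y).
have e : sd_len X = sd_len Y by apply/eqP; rewrite eqn_leq (sd_len_le f) (sd_len_le g).
apply: XY; case: X Y f g e => n X hX [n' Y hY] /= f g e; subst n'.
have XY : X = Y.
  rewrite -[LHS](sd_funE g) -[RHS]functor_compr1; congr functor_comp.
  by apply: functor_ord_ext => i; apply: val_inj; exact: (sd_map_same_len g i erefl).
by subst Y; congr SdOb; exact: Prop_irrelevance.
Qed.

End SubdivisionAcyclic.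

Section SubdivisionTypeL2.
Variables (R : realType) (I : category).
Local Notation J := (opcat (Sd I)).

Definition sd_gens (X : J) (n : nat) : nat := n == sd_len X.

Lemma sd_basis (X : J) : exists b : forall n, 'I_(sd_gens X n) -> fbasis (@sd_of_nchain I n) X,
  (forall n, injective (b n)) /\
  (forall n (e : fbasis (@sd_of_nchain I n) X),
     sd_of_nchain (projT1 e) = X <-> exists i, b n i = e).
Proof.
have uniqI (k : bool) (i j : 'I_k) : i = j.
  by apply: val_inj; case: k i j => -[i hi] [j hj] /=; move: hi hj; case: i => //; case: j.
have ex n (i : 'I_(sd_gens X n)) : exists e : fbasis (@sd_of_nchain I n) X,
    sd_of_nchain (projT1 e) = X.
  have /eqP nX : n == sd_len X by case: i; rewrite /sd_gens; case: (n == _).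
  by case: X i nX => l X hX /= _ nX; subst l;
    exists (existT _ (exist _ X hX : nchain I n) (idm (SdOb hX : J))).
have [b bE] : exists b : forall n, 'I_(sd_gens X n) -> fbasis (@sd_of_nchain I n) X,
    forall n i, sd_of_nchain (projT1 (b n i)) = X.
  by exists (fun n i => projT1 (cid (ex n i))) => n i; exact: projT2 (cid (ex n i)).
exists b; split=> [n i j _|n e]; first exact: (uniqI (n == sd_len X)).
split=> [eX|[i <-]]; last exact: bE.
have nX : n == sd_len X by rewrite -(congr1 (@sd_len I) eX).
have i : 'I_(sd_gens X n) by rewrite /sd_gens nX; exact: ord0.
exists i; have := bE n i; move: (b n i) => e' e'X.
case: e e' eX e'X => s u [s' u'] /= sX s'X.
have ss' : s' = s.
  move: s'X; rewrite -sX => /(congr1 (fun Z : sd_ob I => existT (fun l => functor (ordcat l) I) _ (sd_chain Z))).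
  by move=> e; apply: nchainP; exact: (inj_pair2 _ _ _ _ _ e).
by subst s'; rewrite (acyclic_hom_eq (acyclic_opcat_Sd I) u u' sX).
Qed.

(** The resolution has a single generator placed at [X], in the degree that is
    the length of [X], so that the complex of [X] is a line in this degree. *)
Lemma h2_sd_ge1 (X : J) : (1 <= h2_complex (split_complex X (sd_resolution R I)))%E.
Proof.
have [b [b_inj bP]] := sd_basis X.
pose P_free n : sd_resolution R I n = free_presheaf R (@sd_of_nchain I n) := erefl.
pose r := split_rank (acyclic_opcat_Sd I) P_free b_inj bP.
have rc p : (r p.+1 + r p <= sd_gens X p)%N by exact: split_rank_le.
have r1 : r (sd_len X).+1 = 0%N by have := rc (sd_len X).+1; rewrite /sd_gens; case: eqP; lia.
have r0 : r (sd_len X) = 0%N.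
  rewrite /r; case e : (sd_len X) => [//|l]; have := rc l; rewrite /r /sd_gens.
  by case: eqP; lia.
have bX : l2_betti (split_complex X (sd_resolution R I)) (sd_len X) = 1%E.
  by rewrite (l2_betti_free (acyclic_opcat_Sd I) P_free b_inj bP) -/r r0 r1 /sd_gens eqxx.
have b0 p : (0 <= l2_betti (split_complex X (sd_resolution R I)) p)%E.
  by rewrite (l2_betti_free (acyclic_opcat_Sd I) P_free b_inj bP) lee_fin.
apply: le_trans (nneseries_lim_ge (sd_len X).+1 (fun p _ _ => b0 p)).
by rewrite big_nat_recr //= bX leeDr // sume_ge0.
Qed.

Lemma esum_ge1_finite (T : choiceType) (F : T -> \bar R) :
  (forall x, (1 <= F x)%E) -> (\esum_(x in [set: T]) F x < +oo)%E -> finite_set [set: T].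
Proof.
move=> F1 Foo; apply: contrapT => /infinite_set_fset infT.
have F0 : (0 <= \esum_(x in [set: T]) F x)%E.
  by apply: esum_ge0 => x _; exact: le_trans (F1 x).
pose M := fine (\esum_(x in [set: T]) F x).
have ME : (\esum_(x in [set: T]) F x = M%:E)%E by rewrite fineK // ge0_fin_numE.
have [B _ BM] := infT (Num.bound M).
have : (\sum_(x \in [set` B]) F x <= M%:E)%E.
  by rewrite -ME; apply: esum_ge; exists [set` B] => //; split.
apply/negP; rewrite -ltNge; apply: (@lt_le_trans _ _ (#|` B|%:R%:E)%E).
  rewrite lte_fin; apply: (@lt_le_trans _ _ (Num.bound M)%:R); last by rewrite ler_nat.
  by apply: archi_boundP; rewrite -lee_fin -ME.
rewrite fsbig_finite // set_fsetK.
have -> : (#|` B|%:R%:E = \sum_(x <- B) (1%:E : \bar R))%E.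
  by rewrite sumEFin big_const_seq count_predT -Monoid.iteropE.
by apply: lee_sum => x _.
Qed.

Lemma typeL2_finite_sd_ob : typeL2 R J -> finite_set [set: sd_ob I].
Proof.
move=> [P]; rewrite (h2_res_eq P (sd_resolution R I)) => h.
have fc : finite_set [set: iso_class J].
  by apply: esum_ge1_finite h => c; exact: h2_sd_ge1.
have cls_inj : injective (@iso_cls J).
  by move=> x y e; rewrite -(iso_repr_cls (acyclic_opcat_Sd I) x) e iso_repr_cls //;
    exact: acyclic_opcat_Sd.
by have := finite_preimage (fun x y _ _ e => cls_inj x y e) fc; rewrite preimage_setT.
Qed.

End SubdivisionTypeL2.

(** * Finiteness of the set of nondegenerate chains *)

Section ChainsFinite.
Variable I : category.

Lemma nondegenerate_prepend n (F : functor (ordcat n.+1) I)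
    (h : @mor (ordcat n.+1) ord0 (lift ord0 ord0)) :
  nondegenerate (functor_comp F (coface ord0)) -> ~ is_identity (fmor F h) -> nondegenerate F.
Proof.
move=> nF nh i j ij eij; case: (unliftP ord0 j) (ij) eij => [j'|] -> ij' //=.
rewrite /bump /= add1n => -[ji].
case: (unliftP ord0 i) ij' ji => [i'|] -> /= ij' ji.
  have i'j' : @mor (ordcat n) i' j' by rewrite /= ji /= /bump /=; lia.
  move=> idF; apply: (nF i' j' i'j'); first by rewrite /= ji /= /bump /=; lia.
  apply: is_identity_eq idF.
  exact: (@fmor_irr n.+1 I F (lift ord0 i') (lift ord0 j') (lift ord0 i') (lift ord0 j')
    ij' (fmor (@coface n ord0) i'j') erefl erefl).
move=> idF; apply: nh; apply: is_identity_eq idF; apply: fmor_irr => //.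
by apply: val_inj; rewrite /= /bump /= ji.
Qed.

(** Prepending a non-identity from an object of [B] keeps the source in [B], so
    that chains can be prolonged backwards for ever. *)
Lemma long_chains (B : set I) : (exists x, B x) ->
  (forall x, B x -> exists y (u : mor y x), B y /\ ~ is_identity u) ->
  forall n, exists s : nchain I n, B (source_of_nchain s).
Proof.
move=> [x Bx] Bpre; elim=> [|n [s Bs]].
  by exists (exist _ (const_functor x (ordcat 0)) (@nondegenerate0 _ _)).
have [y [u [By nu]]] := Bpre _ Bs.
suff hs : nondegenerate (prepend u).
  exists (exist _ _ hs); change (B (prepend u ord0)).
  by rewrite (prepend0 u).
apply: (nondegenerate_prepend (h := leq0n _)); first by rewrite prepend_face0; exact: proj2_sig s.
by move=> idu; apply: nu; apply: is_identity_eq idu; exact: prepend_first.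
Qed.

Section SdFinite.
Hypothesis sd_fin : finite_set [set: sd_ob I].

Lemma sd_finite_category : finite_category I.
Proof.
split.
  apply: sub_finite_set (finite_image (fun X : sd_ob I => X ord0) sd_fin) => x _.
  by exists (SdOb (@nondegenerate0 _ (const_functor x (ordcat 0)))).
apply: sub_finite_set (finite_image (fun X : sd_ob I =>
  arr (fmor X (leq0n _ : @mor (ordcat _) ord0 ord_max))) sd_fin) => -[x [y u]] _.
have [iu|nu] := pselect (is_identity u).
  exists (SdOb (@nondegenerate0 _ (const_functor x (ordcat 0)))) => //=.
  by symmetry; exact/is_identityE.
pose s := const_functor y (ordcat 0); pose u' : mor x (s ord0) := u.
have hs : nondegenerate (prepend u').
  apply: (nondegenerate_prepend (h := leq0n _)); first exact: nondegenerate0.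
  by move=> idu; apply: nu; apply: is_identity_eq idu; exact: prepend_first.
exists (SdOb hs) => //; rewrite -[RHS]/(arr u') -(prepend_first u' (leq0n _)).
have e : ord_max = lift ord0 ord0 :> 'I_2 by exact: val_inj.
exact: (@fmor_irr 1 I (prepend u') ord0 ord_max ord0 (lift ord0 ord0) (leq0n _) (leq0n _) erefl e).
Qed.

Lemma sd_finite_not_long : ~ forall n, exists s : nchain I n, True.
Proof.
move=> long; apply: infinite_nat.
apply: sub_finite_set (finite_image (@sd_len I) sd_fin) => n _.
by have [s _] := long n; exists (sd_of_nchain s).
Qed.

Lemma sd_finite_acyclic : acyclic I.
Proof.
split=> [x f|x y xy [u] [v]]; apply: contrapT => nf; apply: sd_finite_not_long => n.
  have [|z ->|s _] := @long_chains [set x] _ _ n; [by exists x| |by exists s].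
  by exists x, f; split=> // /is_identityE/arr_inj.
have [|z [->|->]|s _] := @long_chains [set x; y] _ _ n; [by exists x; left| | |by exists s].
- by exists y, v; split; [right|move=> /is_identity_same_ends/esym].
- by exists x, u; split; [left|move=> /is_identity_same_ends].
Qed.

End SdFinite.

Section FiniteAcyclic.
Hypothesis fin : finite_category I.
Hypothesis acyc : acyclic I.

(** A chain is determined by its first arrow and the chain that follows it. *)
Lemma finite_functors n : finite_set [set: functor (ordcat n) I].
Proof.
elim: n => [|n IHn].
  have inj : injective (fun F : functor (ordcat 0) I => F ord0).
    move=> F G e; apply: functor_ext => i j ij.
    have i0 : i = ord0 by exact: (ord1 i).
    have j0 : j = ord0 by exact: (ord1 j).
    subst; rewrite (_ : ij = idm (ord0 : ordcat 0)); last exact: bool_irrelevance.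
    by rewrite !fmor_id e.
  by have := finite_preimage (fun x y _ _ e => inj x y e) (proj1 fin); rewrite preimage_setT.
pose h : @mor (ordcat n.+1) ord0 (lift ord0 ord0) := leq0n _.
have inj : injective (fun F : functor (ordcat n.+1) I => (functor_comp F (coface ord0), arr (fmor F h))).
  move=> F G e.
  exact: (functor_eq_prepend (h := h) (congr1 (@fst _ _) e) (congr1 (@snd _ _) e)).
have := finite_preimage (fun x y _ _ e => inj x y e) (finite_setX IHn (proj2 fin)).
by rewrite setXTT preimage_setT.
Qed.

(** A nondegenerate chain that comes back to a vertex would contain a step with
    a morphism in the opposite direction. *)
Lemma nchain_inj n (s : nchain I n) (i j : 'I_n.+1) :
  (i < j)%N -> proj1_sig s i <> proj1_sig s j.
Proof.
case: s => s hs /= ij sij.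
have iS : (i.+1 < n.+1)%N by exact: leq_ltn_trans ij (ltn_ord j).
pose i' : 'I_n.+1 := Ordinal iS.
have ii' : @mor (ordcat n) i i' by rewrite /= leqnSn.
have i'j : @mor (ordcat n) i' j by exact: ij.
have back : mor (s i') (s i) by rewrite sij; exact: (fmor s i'j).
have e : s i = s i' := acyclic_antisym acyc (fmor s ii') back.
apply: (hs i i' ii') => //; apply/is_identityE.
by move: (fmor s ii'); rewrite -e => u; rewrite (proj1 acyc _ u).
Qed.

Lemma nchain_len_lt : exists m, forall n (s : nchain I n), (n < m)%N.
Proof.
pose A := fset_set [set: {classic I}].
have fI : finite_set [set: {classic I}] := proj1 fin.
exists (size (enum_fset A)).+1 => n s; rewrite ltnS.
pose f (i : 'I_n.+1) : {classic I} := proj1_sig s i.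
have f_inj : injective f.
  move=> i j fij; apply: val_inj; case: (ltngtP i j) => // ij.
    by case: (nchain_inj (s := s) ij fij).
  by case: (nchain_inj (s := s) ij (esym fij)).
have := @uniq_leq_size _ [seq f i | i <- enum 'I_n.+1] (enum_fset A).
rewrite size_map size_enum_ord map_inj_uniq ?enum_uniq //.
by move=> /(_ isT) h; apply: leq_trans (leqnSn n) (h _) => x _; rewrite in_fset_set // mem_setT.
Qed.

Lemma nchain_enum : exists (m : nat) (sigma : 'I_m -> {n : nat & nchain I n}),
  injective sigma /\ forall s, exists k, sigma k = s.
Proof.
have [m mP] := nchain_len_lt.
have fS : finite_set [set: {classic {n : nat & nchain I n}}].
  apply: sub_finite_set (bigcup_finite (finite_II m)
    (F := fun n => (fun s : nchain I n => existT _ n s : {classic {n : nat & nchain I n}}) @` [set: nchain I n]) _).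
    by move=> [n s] _; exists n; [exact: mP|exists s].
  move=> n _; apply: finite_image.
  have inj : injective (fun s : nchain I n => proj1_sig s) by move=> s s'; exact: nchainP.
  by have := finite_preimage (fun x y _ _ e => inj x y e) (finite_functors n); rewrite preimage_setT.
pose A := enum_fset (fset_set [set: {classic {n : nat & nchain I n}}]).
have uA : uniq A by exact: fset_uniq.
have mA s : s \in A by rewrite in_fset_set // mem_setT.
exists (size A), (fun k => tnth (in_tuple A) k); split=> [|s].
  exact: (elimT (tuple_uniqP (in_tuple A)) uA).
have /tnthP[k ->] : s \in in_tuple A by exact: mA.
by exists k.
Qed.

End FiniteAcyclic.

End ChainsFinite.

Theorem theorem1p2 (R : realType) (I : category) :
  (typeL2 R (opcat (Sd I)) <-> finite_category I /\ acyclic I) /\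
  (finite_category I /\ acyclic I ->
    typeL2 R I /\ chi2 R (opcat (Sd I)) = chi2 R I).
Proof.
have acyc_sd := acyclic_opcat_Sd I.
have chi_fin : finite_category I /\ acyclic I ->
    typeL2 R (opcat (Sd I)) /\ (typeL2 R I /\ chi2 R (opcat (Sd I)) = chi2 R I).
  move=> [fin acyc]; have [m [sigma [s_inj s_surj]]] := nchain_enum fin acyc.
  pose sd_free n : sd_resolution R I n = free_presheaf R (@sd_of_nchain I n) := erefl.
  pose bar_free n : bar_resolution R I n = free_presheaf R (@source_of_nchain I n) := erefl.
  split; first exact: (typeL2_finite acyc_sd sd_free s_inj s_surj).
  split; first exact: (typeL2_finite acyc bar_free s_inj s_surj).
  by rewrite (chi2_finite acyc_sd sd_free s_inj s_surj) (chi2_finite acyc bar_free s_inj s_surj).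
split; last by move=> /chi_fin[].
split=> [/typeL2_finite_sd_ob sd_fin|/chi_fin[] //].
by split; [exact: sd_finite_category|exact: sd_finite_acyclic].
Qed.
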